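(* Let $\Pi$ be the preprojective algebra of a finite connected graph $\Gamma$ without loops which is not of finite type. Then the functor $$D^b(\mathrm{Nilp}\,\Pi)\longrightarrow D^b_{\mathrm{Nilp}}(\mathrm{Mod}\,\Pi)$$ induced by the inclusion $\mathrm{Nilp}\,\Pi\subset\mathrm{Mod}\,\Pi$ is an equivalence of (triangulated) categories; that is, the standard heart $\mathrm{Nilp}\,\Pi$ is faithful in $D^b_{\mathrm{Nilp}}(\mathrm{Mod}\,\Pi)$.
   Context: $\Gamma$ may have multiple edges; it is of finite type if its generalised Cartan matrix $2I-\mathrm{Adjacency}(\Gamma)$ is positive definite. The doubled quiver of $\Gamma$ has an arrow pair $a,a^*$ (opposite orientations, $(a^* )^*=a$) for each edge; choose signs $\varepsilon(a)\in\{\pm1\}$ with $\varepsilon(a)\ne\varepsilon(a^* )$. The preprojective algebra $\Pi$ is the path algebra over $\mathbb C$ of the doubled quiver modulo the two-sided ideal generated by $\sum_a\varepsilon(a)aa^*$ (independent of $\varepsilon$ up to isomorphism). $\mathrm{Mod}\,\Pi$ is the category of all right $\Pi$-modules. $\mathrm{Nilp}\,\Pi$ is the full subcategory of finite-dimensional modules $M$ with $MJ^{\ell}=0$ for some $\ell\ge0$, where $J\subset\Pi$ is the ideal generated by the arrows. $D^b_{\mathrm{Nilp}}(\mathrm{Mod}\,\Pi)\subset D^b(\mathrm{Mod}\,\Pi)$ is the full subcategory of complexes all of whose cohomology modules lie in $\mathrm{Nilp}\,\Pi$. The heart $\mathcal A$ of a bounded t-structure on a triangulated category $\mathcal T$ is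 faithful if the inclusion $\mathcal A\subset\mathcal T$ induces a triangulated equivalence $D^b(\mathcal A)\to\mathcal T$. *)

(* Defs.v *)
From HB Require Import structures.
From mathcomp Require Import all_boot all_order all_algebra.
From mathcomp Require Import generic_quotient ring_quotient.
From mathcomp Require Import boolp classical_sets functions reals.

Set Implicit Arguments.
Unset Strict Implicit.
Unset Printing Implicit Defensive.

Import Order.TTheory GRing.Theory Num.Theory.
Local Open Scope ring_scope.
Local Open Scope quotient_scope.

Section SubmodulePredicates.
Variables (A : pzRingType) (M N : lmodType A) (f : {linear M -> N}).

Definition ker_pred : {pred M} := fun x => f x == 0.

Lemma ker_submod_closed : submod_closed ker_pred.
Proof.
split; first by rewrite unfold_in /ker_pred linear0.
move=> a x y; rewrite !unfold_in /ker_pred => /eqP fx /eqP fy.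
by rewrite linearP fx fy scaler0 addr0.
Qed.

HB.instance Definition _ := GRing.isSubmodClosed.Build A M ker_pred
  (GRing.submod_closed_semi ker_submod_closed).

Definition im_pred : {pred N} := fun y => `[< exists x, f x = y >].

Lemma im_submod_closed : submod_closed im_pred.
Proof.
split; first by apply/asboolP; exists 0; rewrite linear0.
move=> a x y /asboolP[u <-] /asboolP[v <-]; apply/asboolP.
by exists (a *: u + v); rewrite linearP.
Qed.

HB.instance Definition _ := GRing.isSubmodClosed.Build A N im_pred
  (GRing.submod_closed_semi im_submod_closed).

Variable S : submodClosed N.

Definition comap_pred : {pred M} := fun x => f x \in S.

Lemma comap_submod_closed : submod_closed comap_pred.
Proof.
split=> [|a x y Sx Sy]; rewrite -topredE /= /comap_pred.
  by rewrite linear0 rpred0.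
by rewrite linearP rpredD ?rpredZ.
Qed.

HB.instance Definition _ := GRing.isSubmodClosed.Build A M comap_pred
  (GRing.submod_closed_semi comap_submod_closed).

End SubmodulePredicates.

Section SubQuotient.
Variables (A : pzRingType) (M : lmodType A) (S : submodClosed M).

Definition submod : Type := {x : M | x \in S}.
HB.instance Definition _ := SubChoice.on submod.
HB.instance Definition _ := GRing.SubChoice_isSubLmodule.Build A M
  (fun x => x \in S) submod (submodClosedP S).

Definition submod_pred : {pred M} := fun x => x \in S.
HB.instance Definition _ := GRing.isZmodClosed.Build M submod_pred
  (GRing.submod_closedB (submodClosedP S)).

Definition quotmod : Type := Quotient.quot submod_pred.
HB.instance Definition _ := GRing.Zmodule.on quotmod.

Definition quotmod_pi (x : M) : quotmod := \pi x.

Lemma quotmod_pi_surj y : exists x, quotmod_pi x = y.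
Proof. by exists (repr y); rewrite /quotmod_pi reprK. Qed.

Lemma quotmod_piP x y : quotmod_pi x = quotmod_pi y <-> x - y \in S.
Proof. rewrite -[_ \in S]/(x - y \in submod_pred) Quotient.idealrBE; split=> [e|/eqP //]; exact/eqP. Qed.

Lemma quotmod_piD x y : quotmod_pi (x + y) = quotmod_pi x + quotmod_pi y.
Proof. exact: (Quotient.pi_add submod_pred). Qed.

Definition quotmod_scale (a : A) (y : quotmod) : quotmod :=
  quotmod_pi (a *: (repr y : M)).

Lemma quotmod_scaleE a x : quotmod_scale a (quotmod_pi x) = quotmod_pi (a *: x).
Proof.
apply/quotmod_piP; rewrite -scalerBr; apply: rpredZ.
by apply/quotmod_piP; rewrite /quotmod_pi reprK.
Qed.

Lemma quotmod_scaleA a b y :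
  quotmod_scale a (quotmod_scale b y) = quotmod_scale (a * b) y.
Proof.
by have [x <-] := quotmod_pi_surj y; rewrite !quotmod_scaleE scalerA.
Qed.

Lemma quotmod_scale1 : left_id 1 quotmod_scale.
Proof.
by move=> y; have [x <-] := quotmod_pi_surj y; rewrite quotmod_scaleE scale1r.
Qed.

Lemma quotmod_scaleDr : right_distributive quotmod_scale +%R.
Proof.
move=> a y z; have [u <-] := quotmod_pi_surj y; have [v <-] := quotmod_pi_surj z.
by rewrite -quotmod_piD !quotmod_scaleE scalerDr quotmod_piD.
Qed.

Lemma quotmod_scaleDl y : {morph quotmod_scale^~ y : a b / a + b}.
Proof.
move=> a b; have [x <-] := quotmod_pi_surj y.
by rewrite !quotmod_scaleE scalerDl quotmod_piD.
Qed.

HB.instance Definition _ := GRing.Zmodule_isLmodule.Build A quotmod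
  quotmod_scaleA quotmod_scale1 quotmod_scaleDr quotmod_scaleDl.

Lemma quotmod_pi_is_linear : linear quotmod_pi.
Proof.
by move=> a x y; rewrite quotmod_piD -quotmod_scaleE.
Qed.

HB.instance Definition _ :=
  GRing.isLinear.Build A M quotmod *:%R quotmod_pi quotmod_pi_is_linear.

End SubQuotient.

Section SubQuotientMap.
Variables (A : pzRingType).

Definition subquot (M : lmodType A) (Z B : submodClosed M) : lmodType A :=
  quotmod (comap_pred (\val : {linear submod Z -> M}) B).

Definition subquot_pi (M : lmodType A) (Z B : submodClosed M) :
  {linear submod Z -> subquot Z B} := @quotmod_pi _ _ _.

Variables (M N : lmodType A) (f : {linear M -> N}).
Variables (ZM BM : submodClosed M) (ZN BN : submodClosed N).
Hypothesis fZ : forall x, x \in ZM -> f x \in ZN.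
Hypothesis fB : forall x, x \in BM -> f x \in BN.

Definition submod_map (x : submod ZM) : submod ZN :=
  exist _ (f (\val x)) (fZ (valP x)).

Definition subquot_map (y : subquot ZM BM) : subquot ZN BN :=
  subquot_pi ZN BN (submod_map (repr y)).

Lemma subquot_piP (L : lmodType A) (Z B : submodClosed L) (x y : submod Z) :
  subquot_pi Z B x = subquot_pi Z B y <-> \val x - \val y \in B.
Proof. by rewrite quotmod_piP -topredE /= /comap_pred linearB. Qed.

Lemma subquot_pi0 (L : lmodType A) (Z B : submodClosed L) (x : submod Z) :
  subquot_pi Z B x = 0 <-> \val x \in B.
Proof. by rewrite -(linear0 (subquot_pi Z B)) subquot_piP /= subr0. Qed.

Lemma subquot_pi_surj (L : lmodType A) (Z B : submodClosed L) (y : subquot Z B) :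
  exists x, subquot_pi Z B x = y.
Proof. exact: quotmod_pi_surj. Qed.

Lemma subquot_mapE x :
  subquot_map (subquot_pi ZM BM x) = subquot_pi ZN BN (submod_map x).
Proof.
apply/subquot_piP; rewrite /= -linearB; apply: fB; apply/subquot_piP.
by rewrite /subquot_pi /= /quotmod_pi reprK.
Qed.

Lemma subquot_map_is_linear : linear subquot_map.
Proof.
move=> a y z; have [u <-] := subquot_pi_surj y; have [v <-] := subquot_pi_surj z.
rewrite -linearP !subquot_mapE -linearP; congr (subquot_pi _ _ _).
by apply: val_inj; rewrite /= linearP.
Qed.

#[local] HB.instance Definition _ :=
  GRing.isLinear.Build A (subquot ZM BM) (subquot ZN BN) *:%R subquot_map
    subquot_map_is_linear.

Definition subquot_linear : {linear subquot ZM BM -> subquot ZN BN} :=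
  subquot_map.

End SubQuotientMap.

(* Indexing the differential by n -> n + 1 makes shifts and cones
   definitionally well typed. *)
Record cochain (A : pzRingType) := Cochain {
  cterm :> int -> lmodType A;
  cdiff : forall n : int, {linear cterm n -> cterm (n + 1)};
  cdiffK : forall n x, cdiff (n + 1) (cdiff n x) = 0 }.

Record chain_map (A : pzRingType) (X Y : cochain A) := ChainMap {
  cmap :> forall n : int, {linear X n -> Y n};
  cmapP : forall n x, cmap (n + 1) (cdiff X n x) = cdiff Y n (cmap n x) }.

Section Complexes.
Variable A : pzRingType.
Implicit Types X Y Z : cochain A.

Definition cid X : chain_map X X.
Proof. by exists (fun n : int => idfun). Defined.

Definition ccomp X Y Z (g : chain_map Y Z) (f : chain_map X Y) : chain_map X Z.
Proof. by exists (fun n : int => g n \o f n) => n x /=; rewrite !cmapP. Defined.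

Definition bounded X :=
  exists a b : int, forall n, n < a \/ b < n -> forall x : X n, x = 0.

(* [coh X n] is the cohomology of X in degree n + 1. *)
Definition coh X (n : int) : lmodType A :=
  subquot (ker_pred (cdiff X (n + 1))) (im_pred (cdiff X n)).

Section CohMap.
Variables (X Y : cochain A) (f : chain_map X Y) (n : int).

Lemma cmap_cycle x : x \in ker_pred (cdiff X (n + 1)) ->
  f (n + 1) x \in ker_pred (cdiff Y (n + 1)).
Proof. by rewrite !unfold_in /ker_pred -cmapP => /eqP->; rewrite linear0. Qed.

Lemma cmap_boundary x : x \in im_pred (cdiff X n) ->
  f (n + 1) x \in im_pred (cdiff Y n).
Proof.
move=> /asboolP[y <-]; apply/asboolP; exists (f n y); exact/esym/cmapP.
Qed.

Definition coh_map : {linear coh X n -> coh Y n} :=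
  subquot_linear cmap_cycle cmap_boundary.

Lemma coh_mapE x :
  coh_map (subquot_pi _ _ x) = subquot_pi _ _ (submod_map cmap_cycle x).
Proof. exact: (subquot_mapE cmap_cycle cmap_boundary). Qed.

End CohMap.

Definition quasi_iso X Y (f : chain_map X Y) := forall n, bijective (coh_map f n).

(* The shift X[1] carries the differential -d. *)
Definition cshift X : cochain A.
Proof.
exists (fun n : int => X (n + 1)) (fun n : int => \- cdiff X (n + 1)) => n x /=.
by rewrite linearN cdiffK !oppr0.
Defined.

Definition cshift_map X Y (f : chain_map X Y) : chain_map (cshift X) (cshift Y).
Proof. by exists (fun n : int => f (n + 1)) => n x /=; rewrite linearN cmapP. Defined.

Section Cone.
Variables (X Y : cochain A) (f : chain_map X Y).

Definition cone_diff (n : int) (p : (X (n + 1)%R * Y n)%type) :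
    (X (n + 1 + 1)%R * Y (n + 1)%R)%type :=
  (- cdiff X (n + 1) p.1, f (n + 1) p.1 + cdiff Y n p.2).

Lemma cone_diff_is_linear n : linear (@cone_diff n).
Proof.
move=> a [x y] [x' y']; rewrite /cone_diff /= !linearP; congr pair.
by rewrite /= scalerDr addrACA.
Qed.

HB.instance Definition _ (n : int) := GRing.isLinear.Build A
  (X (n + 1)%R * Y n)%type (X (n + 1 + 1)%R * Y (n + 1)%R)%type *:%R (@cone_diff n)
  (@cone_diff_is_linear n).

Definition cone : cochain A.
Proof.
exists (fun n : int => (X (n + 1)%R * Y n)%type : lmodType A) (@cone_diff) => n [x y] /=.
rewrite /cone_diff /= linearN cdiffK !oppr0 linearD cdiffK addr0.
by rewrite linearN cmapP addNr.
Defined.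

Definition cone_inl (n : int) (y : Y n) : cone n := (0, y).

Lemma cone_inl_is_linear n : linear (@cone_inl n).
Proof.
by move=> a y y'; rewrite /cone_inl; congr pair; rewrite /= ?scaler0 ?addr0.
Qed.

HB.instance Definition _ (n : int) :=
  GRing.isLinear.Build A (Y n) (cone n) *:%R (@cone_inl n) (@cone_inl_is_linear n).

Definition cone_in : chain_map Y cone.
Proof.
exists (fun n : int => @cone_inl n) => n y /=.
by rewrite /cone_inl /cone_diff; congr pair; rewrite /= linear0 ?oppr0 ?add0r.
Defined.

Definition cone_fst (n : int) (p : cone n) : cshift X n := p.1.

Lemma cone_fst_is_linear n : linear (@cone_fst n).
Proof. by []. Qed.

HB.instance Definition _ (n : int) :=
  GRing.isLinear.Build A (cone n) (cshift X n) *:%R (@cone_fst n)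
    (@cone_fst_is_linear n).

Definition cone_out : chain_map cone (cshift X).
Proof. by exists (fun n : int => @cone_fst n) => n [x y]. Defined.

End Cone.
End Complexes.

(* Morphisms form setoids: [heq] is the equality of parallel morphisms. *)
Record category := Category {
  ob :> Type;
  hom : ob -> ob -> Type;
  heq : forall X Y, hom X Y -> hom X Y -> Prop;
  idm : forall X, hom X X;
  cmp : forall X Y Z, hom Y Z -> hom X Y -> hom X Z;
  heq_refl : forall X Y (f : hom X Y), heq f f;
  heq_sym : forall X Y (f g : hom X Y), heq f g -> heq g f;
  heq_trans : forall X Y (f g h : hom X Y), heq f g -> heq g h -> heq f h;
  cmp_heq : forall X Y Z (g g' : hom Y Z) (f f' : hom X Y),
    heq g g' -> heq f f' -> heq (cmp g f) (cmp g' f');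
  cmp1f : forall X Y (f : hom X Y), heq (cmp (idm Y) f) f;
  cmpf1 : forall X Y (f : hom X Y), heq (cmp f (idm X)) f;
  cmpA : forall X Y Z T (h : hom Z T) (g : hom Y Z) (f : hom X Y),
    heq (cmp h (cmp g f)) (cmp (cmp h g) f) }.

Arguments idm {c} X.
Notation "f =c g" := (heq f g) (at level 70, no associativity).
Notation "g \oc f" := (cmp g f) (at level 50, left associativity).

Record functor (C D : category) := Functor {
  fob :> C -> D;
  fmap : forall X Y, hom X Y -> hom (fob X) (fob Y);
  fmap_heq : forall X Y (f g : hom X Y), f =c g -> fmap f =c fmap g;
  fmap1 : forall X, fmap (idm X) =c idm (fob X);
  fmapM : forall X Y Z (g : hom Y Z) (f : hom X Y),
    fmap (g \oc f) =c fmap g \oc fmap f }.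

Definition fun_id (C : category) : functor C C.
Proof.
by exists id (fun X Y f => f) => *; first [assumption | exact: heq_refl].
Defined.

Definition fun_comp (C D E : category) (G : functor D E) (F : functor C D) :
  functor C E.
Proof.
exists (fun X => G (F X)) (fun X Y f => fmap G (fmap F f)) => [X Y f g fg|X|X Y Z g f].
- by do 2 apply: fmap_heq.
- exact: heq_trans (fmap_heq _ (fmap1 _ _)) (fmap1 _ _).
- exact: heq_trans (fmap_heq _ (fmapM _ _ _)) (fmapM _ _ _).
Defined.

Record iso (C : category) (X Y : C) := Iso {
  iso_hom :> hom X Y;
  iso_inv : hom Y X;
  iso_homK : iso_inv \oc iso_hom =c idm X;
  iso_invK : iso_hom \oc iso_inv =c idm Y }.

Record nat_iso (C D : category) (F G : functor C D) := NatIso {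
  nat_comp :> forall X, iso (F X) (G X);
  nat_square : forall X Y (f : hom X Y),
    nat_comp Y \oc fmap F f =c fmap G f \oc nat_comp X }.

Definition equivalence (C D : category) (F : functor C D) : Prop :=
  exists G : functor D C,
    inhabited (nat_iso (fun_comp G F) (fun_id C)) /\
    inhabited (nat_iso (fun_comp F G) (fun_id D)).

Definition full_subcategory (C : category) (P : C -> Prop) : category.
Proof.
exists {X : C | P X} (fun X Y => hom (sval X) (sval Y))
  (fun X Y f g => f =c g) (fun X => idm (sval X)) (fun X Y Z g f => g \oc f).
- by move=> *; apply: heq_refl.
- by move=> *; apply: heq_sym.
- by move=> X Y f g h; apply: heq_trans.
- by move=> *; apply: cmp_heq.
- by move=> *; apply: cmp1f.
- by move=> *; apply: cmpf1.
- by move=> *; apply: cmpA.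
Defined.

Definition fun_corestrict (C D : category) (F : functor C D) (P : D -> Prop)
    (FP : forall X, P (F X)) : functor C (full_subcategory P) :=
  @Functor C (full_subcategory P) (fun X => exist P (F X) (FP X))
    (fun X Y f => fmap F f) (fun X Y f g => @fmap_heq _ _ F X Y f g)
    (fun X => fmap1 F X) (fun X Y Z g f => fmapM F g f).

Definition mor_class (C : category) := forall X Y : C, hom X Y -> Prop.

Section Localization.
Variables (C : category) (W : mor_class C).

Inductive zigzag : C -> C -> Type :=
| ZZhom X Y : hom X Y -> zigzag X Y
| ZZinv X Y (s : hom X Y) : W s -> zigzag Y X
| ZZcmp X Y Z : zigzag Y Z -> zigzag X Y -> zigzag X Z.

(* The least congruence making [ZZhom] a functor and [ZZinv s _] a two-sided
   inverse of [ZZhom s]. *)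
Inductive zz_eq : forall X Y : C, zigzag X Y -> zigzag X Y -> Prop :=
| zz_refl X Y (z : zigzag X Y) : zz_eq z z
| zz_sym X Y (z t : zigzag X Y) : zz_eq z t -> zz_eq t z
| zz_trans X Y (z t u : zigzag X Y) : zz_eq z t -> zz_eq t u -> zz_eq z u
| zz_cmp X Y Z (z z' : zigzag Y Z) (t t' : zigzag X Y) :
    zz_eq z z' -> zz_eq t t' -> zz_eq (ZZcmp z t) (ZZcmp z' t')
| zz_1z X Y (z : zigzag X Y) : zz_eq (ZZcmp (ZZhom (idm Y)) z) z
| zz_z1 X Y (z : zigzag X Y) : zz_eq (ZZcmp z (ZZhom (idm X))) z
| zz_A X Y Z T (z : zigzag Z T) (t : zigzag Y Z) (u : zigzag X Y) :
    zz_eq (ZZcmp z (ZZcmp t u)) (ZZcmp (ZZcmp z t) u)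
| zz_heq X Y (f g : hom X Y) : f =c g -> zz_eq (ZZhom f) (ZZhom g)
| zz_homM X Y Z (g : hom Y Z) (f : hom X Y) :
    zz_eq (ZZhom (g \oc f)) (ZZcmp (ZZhom g) (ZZhom f))
| zz_invs X Y (s : hom X Y) (Ws : W s) :
    zz_eq (ZZcmp (ZZinv Ws) (ZZhom s)) (ZZhom (idm X))
| zz_sinv X Y (s : hom X Y) (Ws : W s) :
    zz_eq (ZZcmp (ZZhom s) (ZZinv Ws)) (ZZhom (idm Y)).

Definition localization : category :=
  @Category C zigzag zz_eq (fun X => ZZhom (idm X)) ZZcmp
    zz_refl zz_sym zz_trans zz_cmp zz_1z zz_z1 zz_A.

Definition loc_functor : functor C localization :=
  @Functor C localization id ZZhom zz_heq (fun X => zz_refl _) zz_homM.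

End Localization.

Section LocalizedFunctor.
Variables (C D : category) (WC : mor_class C) (WD : mor_class D).
Variable F : functor C D.
Hypothesis FW : forall (X Y : C) (s : hom X Y), WC s -> WD (fmap F s).

Fixpoint zz_map (X Y : C) (z : zigzag WC X Y) : zigzag WD (F X) (F Y) :=
  match z with
  | ZZhom _ _ f => ZZhom WD (fmap F f)
  | ZZinv _ _ s Ws => ZZinv (FW Ws)
  | ZZcmp _ _ _ z t => ZZcmp (zz_map z) (zz_map t)
  end.

Lemma zz_map_eq (X Y : C) (z t : zigzag WC X Y) :
  zz_eq z t -> zz_eq (zz_map z) (zz_map t).
Proof.
have map1 Z : zz_eq (ZZhom WD (fmap F (idm Z))) (ZZhom WD (idm (F Z))).
  exact/zz_heq/fmap1.
elim=> {X Y z t} /=.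
- by move=> *; apply: zz_refl.
- by move=> *; apply: zz_sym.
- by move=> X Y z t u _ zt _; apply: zz_trans.
- by move=> *; apply: zz_cmp.
- move=> X Y z.
  exact: zz_trans (zz_cmp (map1 _) (zz_refl _)) (zz_1z _).
- move=> X Y z.
  exact: zz_trans (zz_cmp (zz_refl _) (map1 _)) (zz_z1 _).
- by move=> *; apply: zz_A.
- by move=> *; apply/zz_heq/fmap_heq.
- move=> X Y Z g f.
  exact: zz_trans (zz_heq _ (fmapM _ _ _)) (zz_homM _ _ _).
- move=> X Y s Ws.
  exact: zz_trans (zz_invs (FW Ws)) (zz_sym (map1 _)).
- move=> X Y s Ws.
  exact: zz_trans (zz_sinv (FW Ws)) (zz_sym (map1 _)).
Qed.

Definition localized_functor :
  functor (localization WC) (localization WD) :=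
  @Functor (localization WC) (localization WD) (fun X => F X) zz_map
    zz_map_eq (fun X => zz_heq WD (fmap1 F X)) (fun _ _ _ _ _ => zz_refl _).

End LocalizedFunctor.

Record tri_category := TriCategory {
  tri_cat :> category;
  shift : functor tri_cat tri_cat;
  distinguished : forall X Y Z : tri_cat,
    hom X Y -> hom Y Z -> hom Z (shift X) -> Prop }.

Arguments shift {t}.

(* Exactness: F commutes with the shifts up to a natural isomorphism that
   turns distinguished triangles into distinguished triangles. *)
Definition triangulated (T U : tri_category) (F : functor T U) : Prop :=
  exists eta : nat_iso (fun_comp F shift) (fun_comp shift F),
    forall (X Y Z : T) (u : hom X Y) (v : hom Y Z) (w : hom Z (shift X)),
      distinguished u v w ->
      distinguished (fmap F u) (fmap F v)
        ((eta X : hom (F (shift X)) (shift (F X))) \oc fmap F w).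

Definition triangulated_equivalence (T U : tri_category) (F : functor T U) :=
  triangulated F /\ equivalence F.

Section TriFullSubcategory.
Variables (T : tri_category) (P : T -> Prop).
Hypothesis Pshift : forall X, P X -> P (shift X).

Definition full_shift : functor (full_subcategory P) (full_subcategory P) :=
  @Functor (full_subcategory P) (full_subcategory P)
    (fun X => exist P (shift (sval X)) (Pshift (svalP X)))
    (fun X Y f => fmap shift f) (fun X Y f g => @fmap_heq _ _ shift _ _ f g)
    (fun X => fmap1 shift _) (fun X Y Z g f => fmapM shift g f).

Definition tri_full_subcategory : tri_category :=
  @TriCategory (full_subcategory P) full_shift
    (fun X Y Z u v w => @distinguished T (sval X) (sval Y) (sval Z) u v w).

End TriFullSubcategory.

(* A class of modules closed under subquotients and finite direct sums: the
   full subcategory on it is abelian, with exact inclusion in all modules. *)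
Record module_class (A : pzRingType) := ModuleClass {
  in_class :> lmodType A -> Prop;
  in_class0 : forall M : lmodType A, (forall x : M, x = 0) -> in_class M;
  in_class_sub : forall (M N : lmodType A) (f : {linear N -> M}),
    injective f -> in_class M -> in_class N;
  in_class_quot : forall (M N : lmodType A) (f : {linear M -> N}),
    (forall y, exists x, f x = y) -> in_class M -> in_class N;
  in_class_sum : forall M N : lmodType A,
    in_class M -> in_class N -> in_class ((M * N)%type : lmodType A) }.

Definition all_modules (A : pzRingType) : module_class A.
Proof. by exists (fun _ => True). Defined.

Lemma coh_in_class (A : pzRingType) (P : module_class A) (X : cochain A) n :
  P (X (n + 1)) -> P (coh X n).
Proof.
move=> PX; apply: (in_class_quot (f := subquot_pi _ _)).
  exact: subquot_pi_surj.
pose ZX := ker_pred (cdiff X (n + 1)).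
exact: (in_class_sub (f := \val : {linear submod ZX -> X (n + 1)})) val_inj PX.
Qed.

Lemma cshift_coh_in_class (A : pzRingType) (P : module_class A) (X : cochain A) n :
  P (coh X (n + 1)) -> P (coh (cshift X) n).
Proof.
move=> PX.
have hZ x : x \in ker_pred (cdiff X (n + 1 + 1)) ->
    idfun x \in ker_pred (cdiff (cshift X) (n + 1)).
  by rewrite !unfold_in /ker_pred /= oppr_eq0.
have hB x : x \in im_pred (cdiff X (n + 1)) ->
    idfun x \in im_pred (cdiff (cshift X) n).
  move=> /asboolP[y <-]; apply/asboolP; exists (- y).
  by rewrite /= linearN opprK.
apply: (in_class_quot (f := subquot_linear hZ hB) _ PX) => y.
have [[x Zx] <-] := subquot_pi_surj y.
have Zx' : x \in ker_pred (cdiff X (n + 1 + 1)).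
  by move: Zx; rewrite !unfold_in /ker_pred /= oppr_eq0.
exists (subquot_pi _ _ (exist _ x Zx')).
apply: etrans (subquot_mapE hZ hB _) _; apply/subquot_piP.
by rewrite /= subrr rpred0.
Qed.

Lemma bijective_coh_mapP (A : pzRingType) (X Y : cochain A) (f : chain_map X Y) n :
  bijective (coh_map f n) <->
  (forall x, cdiff X (n + 1) x = 0 ->
     (exists y, cdiff Y n y = f (n + 1) x) -> exists x', cdiff X n x' = x) /\
  (forall y, cdiff Y (n + 1) y = 0 ->
     exists x, cdiff X (n + 1) x = 0 /\ exists y', cdiff Y n y' = y - f (n + 1) x).
Proof.
split=> [[g fK gK]|[inj surj]].
  split=> [x dx [y fxy]|y dy].
    have Zx : x \in ker_pred (cdiff X (n + 1)) by apply/eqP.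
    pose c : coh X n := subquot_pi _ _ (exist _ x Zx).
    have c0 : c = 0.
      apply: (can_inj fK); rewrite linear0 coh_mapE; apply/subquot_pi0.
      by apply/asboolP; exists y.
    by move/subquot_pi0/asboolP: c0.
  have Zy : y \in ker_pred (cdiff Y (n + 1)) by apply/eqP.
  pose c : coh Y n := subquot_pi _ _ (exist _ y Zy).
  have [[x Zx] gx] := subquot_pi_surj (g c).
  exists x; split; first exact/eqP.
  by have := gK c; rewrite -gx coh_mapE => /esym/subquot_piP/asboolP.
have injf : injective (coh_map f n).
  apply: raddf_inj => c; have [[x Zx] <-] := subquot_pi_surj c.
  move=> /(etrans (esym (coh_mapE f _)))/subquot_pi0/asboolP ex.
  by apply/subquot_pi0/asboolP; apply: inj ex; apply/eqP.
have surjf c : exists b, coh_map f n b == c.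
  have [[y Zy] <-] := subquot_pi_surj c.
  have [|x [dx y'P]] := surj y; first exact/eqP.
  have Zx : x \in ker_pred (cdiff X (n + 1)) by apply/eqP.
  exists (subquot_pi _ _ (exist _ x Zx)); apply/eqP.
  by rewrite coh_mapE; apply/esym/subquot_piP/asboolP.
exists (fun c => xchoose (surjf c)) => [b|c]; last exact/eqP/(xchooseP (surjf c)).
by apply: injf; apply/eqP/(xchooseP (surjf _)).
Qed.

Lemma quasi_iso_cshift (A : pzRingType) (X Y : cochain A) (f : chain_map X Y) :
  quasi_iso f -> quasi_iso (cshift_map f).
Proof.
move=> qf n; have /bijective_coh_mapP[inj surj] := qf (n + 1).
apply/bijective_coh_mapP; split=> [x /eqP|y /eqP]; rewrite /= oppr_eq0 => /eqP.
  move=> dx [y fxy]; have [|x' x'P] := inj x dx.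
    by exists (- y); rewrite linearN.
  by exists (- x'); rewrite linearN opprK.
move=> dy; have [x [dx [y' y'P]]] := surj y dy.
exists x; split; first by rewrite dx oppr0.
by exists (- y'); rewrite linearN opprK.
Qed.

Section DerivedCategory.
Variables (A : pzRingType) (P : module_class A).

Record bcomplex := BComplex {
  bcochain :> cochain A;
  bcochain_bounded : bounded bcochain;
  bcochain_in : forall n, P (bcochain n) }.

Definition bcomplex_cat : category.
Proof.
exists bcomplex (fun X Y : bcomplex => chain_map X Y)
  (fun (X Y : bcomplex) (f g : chain_map X Y) => forall n x, f n x = g n x)
  (fun X : bcomplex => cid X) (fun (X Y Z : bcomplex) g f => ccomp g f) => //.
- by move=> X Y f g h fg gh n x; rewrite fg.
- by move=> X Y Z g g' f f' gg' ff' n x /=; rewrite ff' gg'.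
Defined.

Lemma bounded_cshift (X : cochain A) : bounded X -> bounded (cshift X).
Proof.
move=> [a [b X0]]; exists (a - 1), b => n nab; apply: X0.
case: nab => h; [left; by rewrite -ltrBrDr | right].
by apply: lt_trans h _; rewrite ltrDl.
Qed.

Definition bshift (X : bcomplex) : bcomplex :=
  @BComplex (cshift X) (bounded_cshift (bcochain_bounded X))
    (fun n => bcochain_in X (n + 1)).

Definition bshift_functor : functor bcomplex_cat bcomplex_cat.
Proof.
by exists bshift (fun (X Y : bcomplex) f => cshift_map f) => // X Y f g fg n x; apply: fg.
Defined.

Lemma bounded_cone (X Y : cochain A) (f : chain_map X Y) :
  bounded X -> bounded Y -> bounded (cone f).
Proof.
move=> [a [b X0]] [a' [b' Y0]].
exists (Num.min (a - 1) a'), (Num.max b b') => n nab [x y]; congr pair.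
  apply: X0; case: nab => h; [left | right].
    by move: h; rewrite lt_min ltrBrDr => /andP[].
  by move: h; rewrite gt_max => /andP[h _]; apply: lt_trans h _; rewrite ltrDl.
apply: Y0; case: nab => h; [left | right].
  by move: h; rewrite lt_min => /andP[].
by move: h; rewrite gt_max => /andP[].
Qed.

Definition bcone (X Y : bcomplex) (f : chain_map X Y) : bcomplex :=
  @BComplex (cone f) (bounded_cone f (bcochain_bounded X) (bcochain_bounded Y))
    (fun n => in_class_sum (bcochain_in X (n + 1)) (bcochain_in Y n)).

Definition bqis : mor_class bcomplex_cat := fun X Y f => quasi_iso f.

Definition Dcat : category := localization bqis.

Definition Dmor (X Y : bcomplex) (f : chain_map X Y) : @hom Dcat X Y :=
  fmap (loc_functor bqis) (f : @hom bcomplex_cat X Y).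

Definition Dshift : functor Dcat Dcat :=
  @localized_functor _ _ bqis bqis bshift_functor
    (fun X Y f qf => quasi_iso_cshift qf).

(* The triangles isomorphic to X -> Y -> cone f -> X[1], f a chain map. *)
Definition Ddistinguished (X Y Z : Dcat) (u : hom X Y) (v : hom Y Z)
    (w : hom Z (Dshift X)) : Prop :=
  exists (X' Y' : bcomplex) (f : chain_map X' Y')
    (a : @iso Dcat X X') (b : @iso Dcat Y Y') (c : @iso Dcat Z (bcone f)),
  [/\ b \oc u =c Dmor f \oc a,
      c \oc v =c @Dmor Y' (bcone f) (cone_in f) \oc b &
      fmap Dshift a \oc w =c @Dmor (bcone f) (bshift X') (cone_out f) \oc c].

(* Cohomology computed inside the abelian category P agrees with cohomology of
   modules, so this is D^b(P): zigzags run through complexes with terms in P. *)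
Definition Db : tri_category := @TriCategory Dcat Dshift Ddistinguished.

End DerivedCategory.

Section DerivedSubcategory.
Variables (A : pzRingType) (P : module_class A).

Definition has_coh_in (X : Db (all_modules A)) : Prop :=
  forall n, P (coh (X : bcomplex (all_modules A)) n).

Lemma has_coh_in_shift X : has_coh_in X -> has_coh_in (shift X).
Proof. by move=> PX n; apply: cshift_coh_in_class. Qed.

Definition Db_coh : tri_category := tri_full_subcategory has_coh_in_shift.

Definition bincl (X : bcomplex P) : bcomplex (all_modules A) :=
  @BComplex A (all_modules A) X (bcochain_bounded X) (fun _ => I).

Definition bincl_functor :
  functor (bcomplex_cat P) (bcomplex_cat (all_modules A)).
Proof. by exists bincl (fun X Y f => f). Defined.

Definition Dincl : functor (Db P) (Db (all_modules A)) :=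
  @localized_functor _ _ (@bqis A P) (@bqis A (all_modules A)) bincl_functor
    (fun X Y f qf => qf).

Lemma Dincl_coh (X : Db P) : has_coh_in (Dincl X).
Proof. by move=> n; apply: coh_in_class; apply: (bcochain_in (X : bcomplex P)). Qed.

Definition Db_inclusion : functor (Db P) Db_coh :=
  fun_corestrict Dincl_coh.

End DerivedSubcategory.

Section Ideals.
Variable A : pzRingType.

Definition two_sided_ideal (I : set A) : Prop :=
  [/\ I 0, forall x y, I x -> I y -> I (x + y) &
      forall a x, I x -> I (a * x) /\ I (x * a)].

Definition ideal_gen (S : set A) : set A := smallest two_sided_ideal S.

Lemma ideal_gen_ideal (S : set A) : two_sided_ideal (ideal_gen S).
Proof.
split=> [I [[]]//|x y Ix Iy I IS|a x Ix].
  by have [[_ ID _] _] := IS; apply: ID; [apply: Ix | apply: Iy].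
by split=> I IS; have [[_ _ IM] _] := IS; have [] := IM a x (Ix I IS).
Qed.

Lemma ideal_gen_sub (S : set A) x : S x -> ideal_gen S x.
Proof. by move=> Sx I [_]; apply. Qed.

Fixpoint ideal_power (J : set A) (l : nat) : set A :=
  if l is l'.+1 then
    ideal_gen [set x * y | x in ideal_power J l' & y in J]%classic
  else setT.

End Ideals.

Section QuotientRing.
Variables (A : pzRingType) (S : set A).

Definition ideal_pred : {pred A} := fun x => `[< ideal_gen S x >].

Lemma ideal_pred_zmod : zmod_closed ideal_pred.
Proof.
have [I0 ID IM] := ideal_gen_ideal S; split; first exact/asboolP.
move=> x y /asboolP Ix /asboolP Iy; apply/asboolP; apply: ID => //.
by rewrite -mulN1r; case: (IM (-1) y Iy).
Qed.

HB.instance Definition _ := GRing.isZmodClosed.Build A ideal_pred ideal_pred_zmod.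

Lemma ideal_predMl a x : x \in ideal_pred -> a * x \in ideal_pred.
Proof.
by have [_ _ IM] := ideal_gen_ideal S; move=> /asboolP/(IM a)[? ?]; apply/asboolP.
Qed.

Lemma ideal_predMr a x : x \in ideal_pred -> x * a \in ideal_pred.
Proof.
by have [_ _ IM] := ideal_gen_ideal S; move=> /asboolP/(IM a)[? ?]; apply/asboolP.
Qed.

Definition quot_ring : Type := Quotient.quot ideal_pred.
HB.instance Definition _ := GRing.Zmodule.on quot_ring.

Definition quot_ring_pi (x : A) : quot_ring := \pi x.

Lemma quot_ring_pi_surj y : exists x, quot_ring_pi x = y.
Proof. by exists (repr y); rewrite /quot_ring_pi reprK. Qed.

Lemma quot_ring_piP x y : quot_ring_pi x = quot_ring_pi y <-> x - y \in ideal_pred.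
Proof. by rewrite Quotient.idealrBE; split=> [e|/eqP //]; apply/eqP. Qed.

Lemma quot_ring_piD x y : quot_ring_pi (x + y) = quot_ring_pi x + quot_ring_pi y.
Proof. exact: (Quotient.pi_add ideal_pred). Qed.

Definition quot_ring_mul (x y : quot_ring) : quot_ring :=
  quot_ring_pi ((repr x : A) * (repr y : A)).

Lemma quot_ring_mulE x y :
  quot_ring_mul (quot_ring_pi x) (quot_ring_pi y) = quot_ring_pi (x * y).
Proof.
apply/quot_ring_piP; set x' := repr _; set y' := repr _.
have Ix : x' - x \in ideal_pred by apply/quot_ring_piP; exact: reprK.
have Iy : y' - y \in ideal_pred by apply/quot_ring_piP; exact: reprK.
have -> : x' * y' - x * y = (x' - x) * y' + x * (y' - y).
  by rewrite mulrBl mulrBr addrA subrK.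
by apply: rpredD; [apply: ideal_predMr | apply: ideal_predMl].
Qed.

Lemma quot_ring_mulA : associative quot_ring_mul.
Proof.
move=> x y z; have [x' <-] := quot_ring_pi_surj x.
have [y' <-] := quot_ring_pi_surj y; have [z' <-] := quot_ring_pi_surj z.
by rewrite !quot_ring_mulE mulrA.
Qed.

Lemma quot_ring_mul1l : left_id (quot_ring_pi 1) quot_ring_mul.
Proof.
by move=> x; have [x' <-] := quot_ring_pi_surj x; rewrite quot_ring_mulE mul1r.
Qed.

Lemma quot_ring_mul1r : right_id (quot_ring_pi 1) quot_ring_mul.
Proof.
by move=> x; have [x' <-] := quot_ring_pi_surj x; rewrite quot_ring_mulE mulr1.
Qed.

Lemma quot_ring_mulDl : left_distributive quot_ring_mul +%R.
Proof.
move=> x y z; have [x' <-] := quot_ring_pi_surj x.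
have [y' <-] := quot_ring_pi_surj y; have [z' <-] := quot_ring_pi_surj z.
by rewrite -quot_ring_piD !quot_ring_mulE mulrDl quot_ring_piD.
Qed.

Lemma quot_ring_mulDr : right_distributive quot_ring_mul +%R.
Proof.
move=> x y z; have [x' <-] := quot_ring_pi_surj x.
have [y' <-] := quot_ring_pi_surj y; have [z' <-] := quot_ring_pi_surj z.
by rewrite -quot_ring_piD !quot_ring_mulE mulrDr quot_ring_piD.
Qed.

HB.instance Definition _ := GRing.Zmodule_isPzRing.Build quot_ring
  quot_ring_mulA quot_ring_mul1l quot_ring_mul1r quot_ring_mulDl quot_ring_mulDr.

End QuotientRing.

Record quiver := Quiver {
  qvertex : finType;
  qarrow : finType;
  qsource : qarrow -> qvertex;
  qtarget : qarrow -> qvertex }.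

Section PathAlgebra.
Variables (K : comNzRingType) (Q : quiver).

(* A path is its starting vertex together with its sequence of arrows, read
   from left to right; [(v, [::])] is the trivial path at v. *)
Definition qword : Type := (qvertex Q * seq (qarrow Q))%type.

Fixpoint composable (v : qvertex Q) (s : seq (qarrow Q)) : bool :=
  if s is a :: s' then (qsource a == v) && composable (qtarget a) s' else true.

Definition word_end (p : qword) : qvertex Q := last p.1 (map (@qtarget Q) p.2).

Definition is_qpath (p : qword) : bool := composable p.1 p.2.

(* Elements of the path algebra: finitely supported functions on paths. *)
Definition qsupport : {pred qword -> K^o} := fun f =>
  `[< (forall p, f p != 0 -> is_qpath p) /\
      exists s : seq qword, forall p, f p != 0 -> p \in s >].

Lemma qsupport_submod : submod_closed qsupport.
Proof.
split; first by apply/asboolP; split=> [p|]; [|exists [::] => p]; rewrite eqxx.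
move=> c f g /asboolP[fp [s fs]] /asboolP[gp [t gt]].
have fg p : (c *: f + g) p != 0 -> (f p != 0) || (g p != 0).
  apply: contraNT; rewrite negb_or !negbK => /andP[/eqP f0 /eqP g0].
  have -> : (c *: f + g) p = c * (f p : K) + (g p : K) by [].
  by rewrite f0 g0 mulr0 addr0.
apply/asboolP; split=> [p /fg/orP[/fp|/gp] //|].
by exists (s ++ t) => p /fg/orP[/fs|/gt] ps; rewrite mem_cat ps ?orbT.
Qed.

HB.instance Definition _ := GRing.isSubmodClosed.Build K (qword -> K^o) qsupport
  (GRing.submod_closed_semi qsupport_submod).

Definition path_alg : Type := {f : qword -> K^o | f \in qsupport}.
HB.instance Definition _ := SubChoice.on path_alg.
HB.instance Definition _ := GRing.SubChoice_isSubLmodule.Build K (qword -> K^o)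
  (fun f => f \in qsupport) path_alg
  (GRing.submod_closed_semi qsupport_submod).

Implicit Types f g h : path_alg.

Definition path_coef f (p : qword) : K := \val f p.

Lemma path_algP f g : (forall p, path_coef f p = path_coef g p) -> f = g.
Proof. by move=> fg; apply/val_inj/funext. Qed.

Lemma path_coefD f g p : path_coef (f + g) p = path_coef f p + path_coef g p.
Proof. by []. Qed.

Lemma path_coef_qpath f p : path_coef f p != 0 -> is_qpath p.
Proof. by have /asboolP[fp _] := valP f; apply: fp. Qed.

(* The basis element of a word, zero unless the word is a path. *)
Definition word_fun (p : qword) : qword -> K^o :=
  fun q => if is_qpath p && (q == p) then 1 else 0.

Lemma word_fun_supp p : word_fun p \in qsupport.
Proof.
have wP q : word_fun p q != 0 -> is_qpath p && (q == p).
  by rewrite /word_fun; case: ifP => //; rewrite eqxx.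
apply/asboolP; split=> [q /wP/andP[pp /eqP->] //|].
by exists [:: p] => q /wP/andP[_]; rewrite inE.
Qed.

Definition path_elt (p : qword) : path_alg := exist _ (word_fun p) (word_fun_supp p).

Definition path_one_fun : qword -> K^o := fun p => (nilp p.2)%:R.

Lemma path_one_supp : path_one_fun \in qsupport.
Proof.
have oP p : path_one_fun p != 0 -> p.2 = [::].
  by rewrite /path_one_fun; case: nilP => //; rewrite eqxx.
apply/asboolP; split=> [p /oP|]; first by rewrite /is_qpath => ->.
exists [seq (v, [::]) | v <- enum (qvertex Q)] => -[v s] /oP /= ->.
by apply: map_f; rewrite mem_enum.
Qed.

Definition path_one : path_alg := exist _ path_one_fun path_one_supp.

(* The bilinear extension of concatenation of paths (zero when the paths do
   not compose): the coefficient of p sums over all factorisations of p. *)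
Definition path_mul_fun f g : qword -> K^o := fun p =>
  \sum_(i < (size p.2).+1)
    path_coef f (p.1, take i p.2) *
    path_coef g (word_end (p.1, take i p.2), drop i p.2).

Lemma composable_cat v s t :
  composable v (s ++ t) = composable v s && composable (word_end (v, s)) t.
Proof. by elim: s v => [|a s IHs] v //=; rewrite IHs andbA. Qed.

Lemma path_mul_supp f g : path_mul_fun f g \in qsupport.
Proof.
have [_ [S fS]] := asboolP _ (valP f); have [_ [T gT]] := asboolP _ (valP g).
have mP p : path_mul_fun f g p != 0 ->
    exists i, path_coef f (p.1, take i p.2) != 0 /\
              path_coef g (word_end (p.1, take i p.2), drop i p.2) != 0.
  apply: contraPP => /forallNP nex; apply/negP; rewrite negbK; apply/eqP.
  apply: big1 => i _.
  have := nex (nat_of_ord i); case: eqVneq => [->|fn0]; first by rewrite mul0r.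
  by case: eqVneq => [->|gn0 []//]; rewrite mulr0.
apply/asboolP; split=> [p /mP[i [/path_coef_qpath fi /path_coef_qpath gi]]|].
  by rewrite /is_qpath -(cat_take_drop i p.2) composable_cat; apply/andP.
exists [seq (p.1, p.2 ++ q.2) | p <- S, q <- T] => -[v s] /mP[i [/fS fi /gT gi]].
by apply/allpairsP; exists ((v, take i s), (word_end (v, take i s), drop i s));
  rewrite /= cat_take_drop.
Qed.

Definition path_mul f g : path_alg := exist _ (path_mul_fun f g) (path_mul_supp f g).

Lemma path_mulA : associative path_mul.
Proof.
move=> f g h; apply: path_algP => -[v s]; rewrite /path_coef /= /path_mul_fun /=.
rewrite /path_coef /= /path_mul_fun /=.
pose E n := word_end (v, take n s).
pose G j i := path_coef f (v, take j s) *
  (path_coef g (E j, drop j (take i s)) * path_coef h (E i, drop i s)).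
have -> : \sum_(i < (size s).+1) path_coef f (v, take i s) *
    (\sum_(k < (size (drop i s)).+1)
       path_coef g (E i, take k (drop i s)) *
       path_coef h (word_end (E i, take k (drop i s)), drop k (drop i s))) =
    \sum_(j < (size s).+1) \sum_(i < (size s).+1 | (j <= i)%N) G j i.
  apply: eq_bigr => j _; rewrite mulr_sumr.
  have -> : \sum_(i < (size s).+1 | (j <= i)%N) G j i =
      \sum_(0 + j <= i < (size s).+1) G j i by rewrite add0n big_geq_mkord.
  rewrite big_addn.
  rewrite big_mkord size_drop subSn; last by rewrite -ltnS.
  apply: eq_bigr => k _; rewrite /G drop_drop take_drop /E.
  congr (_ * (_ * path_coef h (_, _))).
  rewrite /word_end /= -take_drop -[LHS]last_cat -map_cat -takeD.
  by rewrite addnC.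
have -> : \sum_(i < (size s).+1)
    (\sum_(k < (size (take i s)).+1) path_coef f (v, take k (take i s)) *
       path_coef g (word_end (v, take k (take i s)), drop k (take i s))) *
    path_coef h (E i, drop i s) =
    \sum_(i < (size s).+1) \sum_(j < (size s).+1 | (j <= i)%N) G j i.
  apply: eq_bigr => i _; rewrite mulr_suml size_takel; last by rewrite -ltnS.
  rewrite (big_ord_widen (size s).+1 (fun k : nat =>
    path_coef f (v, take k (take i s)) *
    path_coef g (word_end (v, take k (take i s)), drop k (take i s)) *
    path_coef h (E i, drop i s))) //.
  by apply: eq_big => // j; rewrite ltnS => ji; rewrite /G /E take_takel // mulrA.
by rewrite (exchange_big_dep xpredT).
Qed.

Lemma path_mul1l : left_id path_one path_mul.
Proof.
move=> f; apply: path_algP => -[v s]; rewrite {1}/path_coef /= /path_mul_fun /=.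
rewrite big_ord_recl /= take0 drop0 {1}/path_coef /= mul1r big1 ?addr0 // => i _.
by case: s i => [[]|a s i] //; rewrite {1}/path_coef /= mul0r.
Qed.

Lemma path_mul1r : right_id path_one path_mul.
Proof.
move=> f; apply: path_algP => -[v s]; rewrite {1}/path_coef /= /path_mul_fun /=.
rewrite big_ord_recr /= take_size drop_size {3}/path_coef /= mulr1.
rewrite big1 ?add0r // => i _.
rewrite {2}/path_coef /= /path_one_fun /nilp size_drop subn_eq0 leqNgt ltn_ord.
exact: mulr0.
Qed.

Lemma path_mulDl : left_distributive path_mul +%R.
Proof.
move=> f g h; apply: path_algP => p; rewrite path_coefD /path_coef /=.
rewrite /path_mul_fun -big_split; apply: eq_bigr => i _.
by rewrite path_coefD mulrDl.
Qed.

Lemma path_mulDr : right_distributive path_mul +%R.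
Proof.
move=> f g h; apply: path_algP => p; rewrite path_coefD /path_coef /=.
rewrite /path_mul_fun -big_split; apply: eq_bigr => i _.
by rewrite path_coefD mulrDr.
Qed.

HB.instance Definition _ := GRing.Zmodule_isPzRing.Build path_alg
  path_mulA path_mul1l path_mul1r path_mulDl path_mulDr.

Lemma path_scaleAl (c : K) f g : c *: (f * g) = (c *: f) * g.
Proof.
apply: path_algP => p; transitivity (c * path_mul_fun f g p : K) => //.
rewrite /path_mul_fun mulr_sumr [RHS]/path_coef /=.
by apply: eq_bigr => i _; rewrite mulrA.
Qed.

Lemma path_eltM p q : is_qpath p -> is_qpath q ->
  path_elt p * path_elt q =
    if word_end p == q.1 then path_elt (p.1, p.2 ++ q.2) else 0.
Proof.
case: p q => [v s] [w t] /= vs wt; apply: path_algP => -[u r].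
transitivity (path_mul_fun (path_elt (v, s)) (path_elt (w, t)) (u, r)) => //.
rewrite /path_mul_fun /path_coef /= /word_fun vs wt /=.
case: (eqVneq (word_end (v, s)) w) => [vsw|nvsw].
  have vst : is_qpath (v, s ++ t).
    by rewrite /is_qpath composable_cat vsw; apply/andP.
  rewrite /= /word_fun vst /=; case: eqP => [[-> ->]|nur].
    have sP : (size s < (size (s ++ t)).+1)%N by rewrite size_cat ltnS leq_addr.
    rewrite (bigD1 (Ordinal sP)) //= take_size_cat // drop_size_cat // vsw.
    rewrite !eqxx mulr1 big1 ?addr0 // => i ni; case: eqP; rewrite ?mul0r // => -[e].
    case/eqP: ni; apply: val_inj; rewrite /= -[in RHS]e size_takel //.
    by rewrite -ltnS.
  rewrite big1 // => i _; case: eqP; rewrite ?mul0r // => -[e0 e1].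
  case: eqP; rewrite ?mulr0 // => -[_ e2]; case: nur.
  by rewrite e0 -e1 -e2 cat_take_drop.
rewrite big1 // => i _; case: eqP; rewrite ?mul0r // => -[-> ->].
by case: eqP; rewrite ?mulr0 // => -[e]; rewrite e eqxx in nvsw.
Qed.

Definition arrow_elt (a : qarrow Q) : path_alg := path_elt (qsource a, [:: a]).

End PathAlgebra.

Section Nilpotent.
(* A K-algebra A, given by its ring of scalars K -> A, and a subset J. *)
Variables (K : fieldType) (A : pzRingType) (scal : {rmorphism K -> A}).
Variable J : set A.

(* Right A-modules are left modules over the converse ring. *)
Notation rmodType := (lmodType A^c).
Implicit Types M N : rmodType.

Definition ract M (x : A) (m : M) : M := (x : A^c) *: m.

Definition finite_dim M : Prop :=
  exists n (e : 'I_n -> M), forall m, exists c : 'I_n -> K,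
    m = \sum_i ract (scal (c i)) (e i).

Definition nilpotent_mod M : Prop :=
  exists l, forall (m : M) x, ideal_power J l x -> ract x m = 0.

Definition is_nilp M : Prop := finite_dim M /\ nilpotent_mod M.

Lemma ideal_gen_min (S I : set A) :
  two_sided_ideal I -> (forall x, S x -> I x) -> forall x, ideal_gen S x -> I x.
Proof. by move=> II SI x; apply. Qed.

Lemma ideal_power_ideal l : two_sided_ideal (ideal_power J l).
Proof. by case: l => [|l]; [split | apply: ideal_gen_ideal]. Qed.

Lemma ideal_power_le k l x :
  (k <= l)%N -> ideal_power J l x -> ideal_power J k x.
Proof.
elim: l x => [|l IHl] x; first by rewrite leqn0 => /eqP->.
rewrite leq_eqVlt ltnS => /orP[/eqP-> //|kl Jx]; apply: IHl => //.
apply: ideal_gen_min Jx; first exact: ideal_power_ideal.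
move=> _ [u Ju [v _ <-]]; have [_ _ IM] := ideal_power_ideal l.
by have [] := IM v u Ju.
Qed.

Section Combinations.
Variables (M : rmodType) (n : nat) (e : 'I_n -> M).

Definition lincomb (c : 'rV[K]_n) : M := \sum_i ract (scal (c 0 i)) (e i).

Lemma lincombD c d : lincomb (c + d) = lincomb c + lincomb d.
Proof.
rewrite -big_split; apply: eq_bigr => i _.
by rewrite mxE rmorphD /ract scalerDl.
Qed.

Lemma lincombZ a c : lincomb (a *: c) = ract (scal a) (lincomb c).
Proof.
rewrite /ract scaler_sumr; apply: eq_bigr => i _.
by rewrite mxE mulrC rmorphM /ract scalerA.
Qed.

Lemma lincomb0 : lincomb 0 = 0.
Proof. by apply: big1 => i _; rewrite mxE rmorph0 /ract scale0r. Qed.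

Lemma lincomb_mul k (w : 'rV[K]_k) (B : 'M[K]_(k, n)) :
  lincomb (w *m B) = \sum_i ract (scal (w 0 i)) (lincomb (row i B)).
Proof.
rewrite mulmx_sum_row (big_morph lincomb lincombD lincomb0).
by apply: eq_bigr => i _; apply: lincombZ.
Qed.

End Combinations.

Lemma nilp0 M : (forall x : M, x = 0) -> is_nilp M.
Proof.
move=> M0; split; last by exists 0%N => m x _; apply: M0.
by exists 0%N, (fun _ => 0) => m; exists (fun _ => 0); rewrite big_ord0.
Qed.

Lemma nilp_sub M N (f : {linear N -> M}) : injective f -> is_nilp M -> is_nilp N.
Proof.
move=> finj [[n [e eP]] [l lP]]; split; last first.
  by exists l => m x Jx; apply: finj; rewrite linear0 linearZ; apply: lP.
pose U (v : 'rV[K]_n) := exists x, f x = lincomb e v.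
have UD v w : U v -> U w -> U (v + w).
  by move=> [x fx] [y fy]; exists (x + y); rewrite linearD fx fy lincombD.
have UZ a v : U v -> U (a *: v).
  move=> [x fx]; exists (ract (scal a) x).
  by rewrite /ract linearZ fx lincombZ.
have U0 : U 0 by exists 0; rewrite linear0 lincomb0.
have Umul k (B : 'M[K]_(k, n)) (w : 'rV_k) :
    (forall i, U (row i B)) -> U (w *m B).
  move=> UB; rewrite mulmx_sum_row; elim/big_ind: _ => // i _; exact: UZ.
pose good (r : nat) := `[< exists B : 'M[K]_n, (forall i, U (row i B)) /\ \rank B = r >].
have exgood : exists r, good r.
  exists 0%N; apply/asboolP; exists 0; rewrite mxrank0; split=> // i.
  by rewrite row0.
have good_le r : good r -> (r <= n)%N.
  by move=> /asboolP[B [_ <-]]; apply: rank_leq_row.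
case: (ex_maxnP exgood good_le) => r /asboolP[B [UB rB]] rmax.
have UinB v : U v -> (v <= B)%MS.
  move=> Uv; pose B' : 'M[K]_n := (<<(B + v)%MS>>)%MS.
  have UB' i : U (row i B').
    have : (row i B' <= B + v)%MS by apply: submx_trans (row_sub _ _) _; rewrite genmxE.
    case/sub_addsmxP=> -[w a] -> /=; apply: UD; first exact: Umul.
    by apply: Umul => j; rewrite row_id.
  have : good (\rank B') by apply/asboolP; exists B'.
  move/rmax; rewrite -rB genmxE => rle.
  have := mxrank_leqif_sup (addsmxSl B v).
  move=> [_]; rewrite eqn_leq rle mxrankS ?addsmxSl //= => /esym.
  exact: submx_trans (addsmxSr _ _).
have [g gP] : exists g : 'I_n -> N, forall i, f (g i) = lincomb e (row i B).
  exists (fun i => xget 0 [set x | f x = lincomb e (row i B)]%classic) => i.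
  by have [x fx] := UB i; case: xgetP => // /(_ x).
exists n, g => m.
have [c cP] := eP (f m).
have /UinB/submxP[w wP] : U (\row_i c i).
  by exists m; rewrite cP; apply: eq_bigr => i _; rewrite mxE.
exists (fun i => w 0 i); apply: finj; rewrite cP linear_sum /=.
transitivity (lincomb e (\row_i c i)).
  by apply: eq_bigr => i _; rewrite mxE.
rewrite wP lincomb_mul; apply: eq_bigr => i _.
by rewrite /ract linearZ gP.
Qed.

Lemma nilp_quot M N (f : {linear M -> N}) :
  (forall y, exists x, f x = y) -> is_nilp M -> is_nilp N.
Proof.
move=> fsurj [[n [e eP]] [l lP]]; split.
  exists n, (fun i => f (e i)) => y; have [x <-] := fsurj y.
  have [c ->] := eP x; exists c; rewrite linear_sum; apply: eq_bigr => i _.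
  by rewrite /ract linearZ.
exists l => y x Jx; have [m <-] := fsurj y.
by rewrite /ract -linearZ; have := lP m x Jx; rewrite /ract => ->; rewrite linear0.
Qed.

Lemma nilp_sum M N :
  is_nilp M -> is_nilp N -> is_nilp ((M * N)%type : rmodType).
Proof.
move=> [[n [e eP]] [l lP]] [[n' [e' eP']] [l' lP']]; split.
  exists (n + n')%N, (fun i : 'I_(n + n') => match fintype.split i with
    inl j => (e j, 0) | inr j => (0, e' j) end) => -[x y].
  have [c xc] := eP x; have [c' yc'] := eP' y.
  exists (fun i : 'I_(n + n') => match fintype.split i with inl j => c j | inr j => c' j end).
  rewrite big_split_ord /=.
  under eq_bigr => i _ do rewrite -[lshift _ _]/(unsplit (inl i)) unsplitK.
  under [X in _ + X]eq_bigr => i _ do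
    rewrite -[rshift _ _]/(unsplit (inr i)) unsplitK.
  have -> : \sum_i ract (scal (c i)) ((e i, 0) : (M * N)%type) = (x, 0).
    rewrite xc; elim/big_ind2: _ => // [u u' v v' -> ->|i _].
      by congr pair; rewrite addr0.
    by congr pair; rewrite /= scaler0.
  have -> : \sum_i ract (scal (c' i)) ((0, e' i) : (M * N)%type) = (0, y).
    rewrite yc'; elim/big_ind2: _ => // [u u' v v' -> ->|i _].
      by congr pair; rewrite addr0.
    by congr pair; rewrite /= scaler0.
  by congr pair; rewrite /= ?addr0 ?add0r.
exists (maxn l l') => -[m m'] x Jx; congr pair.
  by apply: lP; apply: ideal_power_le Jx; apply: leq_maxl.
by apply: lP'; apply: ideal_power_le Jx; apply: leq_maxr.
Qed.

Definition nilp_class : module_class A^c :=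
  ModuleClass nilp0 nilp_sub nilp_quot nilp_sum.

End Nilpotent.

(* A finite graph, multiple edges allowed; [endpoint e false] and
   [endpoint e true] are the two ends of e, in an arbitrary order. *)
Record multigraph := Multigraph {
  vertex : finType;
  edge : finType;
  endpoint : edge -> bool -> vertex }.

Section Graph.
Variable G : multigraph.
Implicit Types u v : vertex G.

Definition loopless : Prop := forall e : edge G, endpoint e false != endpoint e true.

Definition joins (e : edge G) u v : bool :=
  [exists b, (endpoint e b == u) && (endpoint e (~~ b) == v)].

Definition adjacent : rel (vertex G) := fun u v => [exists e, joins e u v].

Definition connected : Prop :=
  (0 < #|vertex G|)%N /\ forall u v, connect adjacent u v.

Definition adjacency_mx (R : pzRingType) : 'M[R]_#|vertex G| :=
  \matrix_(i, j) #|[pred e | joins e (enum_val i) (enum_val j)]|%:R.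

Definition cartan_mx (R : pzRingType) : 'M[R]_#|vertex G| :=
  2%:R%:M - adjacency_mx R.

Definition positive_definite (R : numDomainType) n (C : 'M[R]_n) : Prop :=
  forall x : 'cV[R]_n, x != 0 -> 0 < (x^T *m C *m x) 0 0.

Definition finite_type (R : realType) : Prop := positive_definite (cartan_mx R).

(* The arrow (e, b) runs along e from [endpoint e b] to the other end. *)
Definition doubled_quiver : quiver :=
  @Quiver (vertex G) (edge G * bool)%type
    (fun a => endpoint a.1 a.2) (fun a => endpoint a.1 (~~ a.2)).

Definition dual_arrow (a : qarrow doubled_quiver) : qarrow doubled_quiver :=
  (a.1, ~~ a.2).

End Graph.

Section Preprojective.
Variables (K : fieldType) (G : multigraph).
Variable eps : qarrow (doubled_quiver G) -> bool.

(* The element \sum_a eps(a) a a^*, with the signs written (-1) ^+ eps a. *)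
Definition preproj_relation : path_alg K (doubled_quiver G) :=
  \sum_a (-1) ^+ eps a *: (arrow_elt K a * arrow_elt K (dual_arrow a)).

Definition preproj : pzRingType := quot_ring [set preproj_relation]%classic.

Definition preproj_pi (x : path_alg K (doubled_quiver G)) : preproj :=
  quot_ring_pi [set preproj_relation]%classic x.

Definition preproj_scal (c : K) : preproj := 
  preproj_pi (c *: (1 : path_alg K (doubled_quiver G))).

Lemma preproj_scal_zmod : zmod_morphism preproj_scal.
Proof.
move=> c d; rewrite /preproj_scal scalerBl; apply/esym/(canLR (addrK _)).
by apply: etrans (quot_ring_piD _ _ _); rewrite subrK.
Qed.

Lemma preproj_scal_monoid : monoid_morphism preproj_scal.
Proof.
split; first by rewrite /preproj_scal scale1r.
move=> c d; apply/esym/(etrans (quot_ring_mulE _ _ _)).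
by rewrite -path_scaleAl mul1r scalerA.
Qed.

HB.instance Definition _ :=
  GRing.isZmodMorphism.Build K preproj preproj_scal preproj_scal_zmod.
HB.instance Definition _ :=
  GRing.isMonoidMorphism.Build K preproj preproj_scal preproj_scal_monoid.

Definition arrow_ideal : set preproj :=
  ideal_gen [set preproj_pi (arrow_elt K a) | a in setT]%classic.

Definition Nilp : module_class preproj^c := nilp_class preproj_scal arrow_ideal.

End Preprojective.

(* Main.v *)
Require Import Defs.
From Stdlib Require Import Setoid Morphisms.
From HB Require Import structures.
From mathcomp Require Import all_boot all_order all_algebra.
From mathcomp Require Import complex.
From mathcomp Require Import boolp classical_sets reals.
From mathcomp Require Import zify ring.
Require Import Defs.

(** Every arrow of Db_Nilp is a zigzag of bounded complexes.  Call a
    complex approximable if every family of maps from its terms to nilpotent modules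
    factors through a surjective quasi-isomorphism onto a bounded complex over Nilp.  If
    every complex X with nilpotent cohomology receives a quasi-isomorphism from an
    approximable complex P with projective terms, then zigzags out of X become
    homotopy classes of maps out of P, these descend to a complex over Nilp, and the
    functor is full, faithful and essentially surjective.

    By devissage along the total dimension of the cohomology, P is built by
    extensions from resolutions of the simple modules.  For these one takes the Koszul
    complexes e_v Pi -> (+)_a e_t(a) Pi -> e_v Pi, a running over the arrows at v, and
    approximates them by their truncations modulo high degrees.

    Exactness of the Koszul complex on the left says that no nonzero x in Pi satisfies
    a x = 0 for all arrows a.  Suppose such an x exists, in Pi e_i, of minimal degree m.
    Sending e_i to x in degree m extends degree by degree to a partial endomorphism
    of Pi e_i, which forces Pi e_i to vanish in degree m + 1.  So Pi e_i is finite
    dimensional, and counting along the Koszul complex its dimension vector u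
    satisfies (2I - A) u >= delta_i, where A is the adjacency matrix.  As the graph is
    connected, u is then positive and superharmonic but not harmonic, whence
    2I - A is positive definite. *)

Set Implicit Arguments.
Unset Strict Implicit.
Unset Printing Implicit Defensive.

Import Order.TTheory GRing.Theory Num.Theory.
Local Open Scope ring_scope.

(** * Complexes up to homotopy *)

(** The obstacle is that the terms of a projective resolution need not be nilpotent, so a morphism
    represented through a resolution has to be brought back to the class. Approximability is an
    Artin-Rees condition made for this: the kernels of the models are cofinal among families of
    submodules with quotients in the class, so finitely many maps and homotopies descend to one
    common model.

    The partial endomorphism of [Pi e_i] is in fact built downwards. In the degree of the socle
    element it is a map of rank one with values in the socle. Exactness in the middle of the Koszul
    complex carries it from one degree to the degree below, and minimality of the degree makes this
    step unique, hence linear. In degree zero, where [Pi e_i] is spanned by [e_i], only scalars are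
    left; the scalar propagates back up, and a nonzero homothety whose values are killed by all
    arrows leaves nothing in the next degree.

    The term [delta_i] in the count is the idempotent [e_i], the only part of [Pi e_i] that left
    multiples of arrows do not reach. *)

Section LinearMaps.
Variable A : pzRingType.

Lemma ex_linear (M N : lmodType A) (f : M -> N) :
  linear f -> exists g : {linear M -> N}, forall x, g x = f x.
Proof.
by move=> lf; exists (HB.pack_for {linear M -> N} f (GRing.isLinear.Build A M N *:%R f lf)).
Qed.

Lemma linear_factor (M Q N : lmodType A) (q : {linear M -> Q}) (f : {linear M -> N}) :
  (forall y, exists x, q x = y) -> (forall x, q x = 0 -> f x = 0) ->
  exists g : {linear Q -> N}, forall x, g (q x) = f x.
Proof.
move=> /choice[r qr] qf.
have frE x : f (r (q x)) = f x.
  by apply/eqP; rewrite -subr_eq0 -linearB qf // linearB qr subrr.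
have [|g gE] := @ex_linear Q N (f \o r); last by exists g => x; rewrite gE /= frE.
move=> a x y; rewrite /= -[a *: x + y](_ : q (a *: r x + r y) = _).
  by rewrite frE linearP.
by rewrite linearP !qr.
Qed.

Definition projective (M : lmodType A) :=
  forall (N N' : lmodType A) (g : {linear N -> N'}) (f : {linear M -> N'}),
    (forall x, exists y, g y = f x) ->
    exists h : {linear M -> N}, forall x, g (h x) = f x.

Lemma projective0 (M : lmodType A) : (forall x : M, x = 0) -> projective M.
Proof.
move=> M0 N N' g f _; have [|h _] := @ex_linear M N (fun=> 0).
  by move=> a x y; rewrite scaler0 addr0.
by exists h => x; rewrite (M0 x) !linear0.
Qed.

Lemma projective_prod (M1 M2 : lmodType A) :
  projective M1 -> projective M2 -> projective (M1 * M2)%type.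
Proof.
move=> P1 P2 N N' g f gf.
have [|f1 f1E] := @ex_linear M1 N' (fun x => f (x, 0)).
  by move=> a x y; rewrite -linearP; congr (f (_, _)); rewrite /= scaler0 addr0.
have [|f2 f2E] := @ex_linear M2 N' (fun x => f (0, x)).
  by move=> a x y; rewrite -linearP; congr (f (_, _)); rewrite /= scaler0 addr0.
have [x|h1 h1E] := P1 _ _ g f1; first by rewrite f1E; apply: gf.
have [x|h2 h2E] := P2 _ _ g f2; first by rewrite f2E; apply: gf.
have [|h hE] := @ex_linear (M1 * M2)%type N (fun x => h1 x.1 + h2 x.2).
  by move=> a x y; rewrite /= !linearP scalerDr addrACA.
exists h => -[x y]; rewrite hE linearD h1E h2E f1E f2E -linearD /=.
by congr (f (_, _)); rewrite /= ?addr0 ?add0r.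
Qed.

End LinearMaps.

(** * Families indexed by the integers *)

Section IntegerFamilies.

Lemma int_succ (n : int) : exists m, n = m + 1.
Proof. by exists (n - 1); rewrite subrK. Qed.

(** No integer variable is convertible to a successor, yet homotopies and cohomology give data only
    in degrees [n + 1]. The datum is transported along [m - 1 + 1 = m], and uniqueness of equality
    proofs in [int] removes the transport in degree [n + 1]. *)
Lemma succ_family (T : int -> Type) (g : forall n, T (n + 1)) :
  exists t : forall n, T n, forall n, t (n + 1) = g n.
Proof.
exists (fun m => eq_rect _ T (g (m - 1)) m (subrK 1 m)) => n.
move: (subrK 1 (n + 1)) (addrK 1 n); move: (n + 1 - 1) => k e kn.
by subst k; rewrite (eq_irrelevance e erefl).
Qed.

(* Members are built from degree [c + 1] downwards; [Inv m] is what the member of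
   degree [m + 1] must satisfy for the next step to be possible. *)
Lemma down_family (T : int -> Type) (E : forall n, T n -> T (n + 1) -> Prop)
    (Inv : forall n, T (n + 1) -> Prop) (a c : int) (t0 : forall n, T n)
    (tc : T (c + 1)) :
  (forall n t t', n < a -> E n t t') -> (forall n t t', c + 1 < n -> E n t t') ->
  (forall t', E (c + 1) tc t') -> Inv c tc ->
  (forall m (t' : T (m + 1 + 1)), m + 1 <= c -> Inv (m + 1) t' ->
     exists t, E (m + 1) t t' /\ Inv m t) ->
  exists t : forall n, T n, t (c + 1) = tc /\ forall n, E n (t n) (t (n + 1)).
Proof.
move=> Elow Ehigh Etop Itop step.
(* After [k] steps the equations hold from degree [c + 1 - k] upwards, and the invariant permits one
   more step; the members below are still arbitrary. *)
have S k : exists t : forall n, T n, [/\ t (c + 1) = tc,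
    forall n, c + 1 - k%:Z <= n -> E n (t n) (t (n + 1)) &
    Inv (c - k%:Z) (t (c - k%:Z + 1))].
  elim: k => [|k [t [tE tP tI]]].
    have ex m : exists u : T (m + 1), forall e : c = m,
        u = eq_rect c (fun k => T (k + 1)) tc m e.
      case: (pselect (c = m)) => [e|ne]; last by exists (t0 (m + 1)) => e.
      by subst m; exists tc => e; rewrite (eq_irrelevance e erefl).
    have [t tE] := succ_family (fun m => sval (boolp.cid (ex m))).
    have tc1 : t (c + 1) = tc.
      rewrite tE; case: boolp.cid => u /= ue; exact: (ue erefl).
    exists t; split=> //; last by rewrite subr0 tc1.
    move=> n; rewrite subr0 le_eqVlt => /orP[/eqP<-|/Ehigh//].
    by rewrite tc1; apply: Etop.
  pose m1 := c - k%:Z - 1.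
  (* The new family differs from [t] in degree [m1 + 1] only, so the equations already obtained
     survive. *)
  have ex m : exists u : T (m + 1), (m != m1 -> u = t (m + 1)) /\
     (m = m1 -> E (m + 1) u (t (m + 1 + 1)) /\ Inv m u).
    case: (eqVneq m m1) => [e|ne]; last first.
      by exists (t (m + 1)); split=> // e; rewrite e eqxx in ne.
    have e1 : c - k%:Z = m + 1 by rewrite e subrK.
    rewrite e1 in tI; have [|u [Eu Iu]] := step _ _ _ tI.
      by rewrite -e1; lia.
    by exists u; split.
  have [t' t'E] := succ_family (fun m => sval (boolp.cid (ex m))).
  have t'ne m : m != m1 -> t' (m + 1) = t (m + 1).
    by move=> ne; rewrite t'E; case: boolp.cid => u /= [ut _]; apply: ut.
  have t'1 : E (m1 + 1) (t' (m1 + 1)) (t' (m1 + 1 + 1)) /\ Inv m1 (t' (m1 + 1)).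
    rewrite (t'ne (m1 + 1)); last by lia.
    by rewrite t'E; case: boolp.cid => u /= [_]; apply.
  exists t'; split.
  - by rewrite t'ne //; rewrite /m1; lia.
  - move=> n ln; have [m nE] := int_succ n; move: ln; rewrite {n}nE => ln.
    have [->|ne] := eqVneq m m1; first by case: t'1.
    by rewrite !t'ne //; [apply: tP; move: ne; rewrite /m1; lia | lia].
  - have -> : c - k.+1%:Z = m1 by rewrite /m1; lia.
    by case: t'1.
(* Enough steps to reach degree [a], below which every equation holds by assumption. *)
have [t [tE tP _]] := S (absz (c + 1 - a)%R).
exists t; split=> // n; have [na|an] := ltP n a; first exact: Elow.
by apply: tP; lia.
Qed.

End IntegerFamilies.

(** * Homotopies and lifting through quasi-isomorphisms *)

Section Homotopy.
Variable A : pzRingType.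
Implicit Types X Y Z P C : cochain A.

Definition homotopic X Y (f g : chain_map X Y) :=
  exists h : forall n, {linear X (n + 1) -> Y n}, forall n x,
    f (n + 1) x - g (n + 1) x =
      cdiff Y n (h n x) + h (n + 1) (cdiff X (n + 1) x).

Lemma homotopic_eq X Y (f g : chain_map X Y) :
  (forall n x, f n x = g n x) -> homotopic f g.
Proof.
move=> fg; exists (fun n => null_fun (Y n) : {linear _ -> _}) => n x.
by rewrite fg subrr /= linear0 addr0.
Qed.

Lemma homotopic_sym X Y (f g : chain_map X Y) : homotopic f g -> homotopic g f.
Proof.
move=> [h hP]; exists (fun n => \- h n : {linear _ -> _}) => n x /=.
by rewrite linearN -opprD -hP opprB.
Qed.

Lemma homotopic_trans X Y (f g k : chain_map X Y) :
  homotopic f g -> homotopic g k -> homotopic f k.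
Proof.
move=> [h hP] [h' hP']; exists (fun n => h n \+ h' n : {linear _ -> _}) => n x /=.
by rewrite linearD addrACA -hP -hP' addrA subrK.
Qed.

Lemma homotopic_compl X Y Z (k : chain_map Y Z) (f g : chain_map X Y) :
  homotopic f g -> homotopic (ccomp k f) (ccomp k g).
Proof.
move=> [h hP]; exists (fun n => k n \o h n : {linear _ -> _}) => n x /=.
by rewrite -linearB hP linearD cmapP.
Qed.

Definition acyclic X :=
  forall n (x : X (n + 1)), cdiff X (n + 1) x = 0 -> exists y, cdiff X n y = x.

Lemma cone_acyclic X Y (s : chain_map X Y) : quasi_iso s -> acyclic (cone s).
Proof.
move=> qs n [x y] [/eqP]; rewrite oppr_eq0 => /eqP dx sx.
have [inj _] := (bijective_coh_mapP s (n + 1)).1 (qs _).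
have [_ surj] := (bijective_coh_mapP s n).1 (qs _).
have [|x0 x0E] := inj x dx.
  by exists (- y); rewrite linearN; apply/esym/eqP; rewrite -addr_eq0; apply/eqP.
have [|x1 [dx1 [y1 y1E]]] := surj (y + s (n + 1) x0).
  by rewrite linearD -cmapP x0E [LHS]addrC.
exists (x1 - x0, y1); congr pair => /=.
  by rewrite linearB dx1 x0E sub0r opprK.
by rewrite y1E linearB [LHS]addrC addrA subrK addrK.
Qed.

Section Projective.
Variable P : cochain A.
Hypotheses (Pb : bounded P) (Pproj : forall n, projective (P n)).

(** The homotopy is built downwards from above the top degree of [P]. Once it exists in higher
    degrees, [f - h d] takes values in cycles of [C], hence in boundaries, and projectivity lifts it
    through the differential. *)
Lemma null_homotopy C (f : chain_map P C) : acyclic C ->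
  exists h : forall n, {linear P (n + 1) -> C n}, forall n x,
    f (n + 1) x = cdiff C n (h n x) + h (n + 1) (cdiff P (n + 1) x).
Proof.
move=> Cac; have [a [b P0]] := Pb.
pose z n : {linear P (n + 1) -> C n} := null_fun (C n).
pose E n (h : {linear P (n + 1) -> C n}) (h' : {linear P (n + 1 + 1) -> C (n + 1)}) :=
  forall x, f (n + 1) x = cdiff C n (h x) + h' (cdiff P (n + 1) x).
pose Inv m (h : {linear P (m + 1 + 1) -> C (m + 1)}) :=
  forall x, exists u, cdiff C m u = f (m + 1) x - h (cdiff P (m + 1) x).
have E0 n h h' : (forall x : P (n + 1), x = 0) -> E n h h'.
  by move=> Pn0 x; rewrite (Pn0 x) !linear0 addr0.
have [] := @down_family _ E Inv (a - 1) b z (z (b + 1)).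
- by move=> n h h' na; apply: E0; apply: P0; left; lia.
- by move=> n h h' bn; apply: E0; apply: P0; right; lia.
- by move=> h'; apply: E0; apply: P0; right; lia.
- move=> x; exists 0; rewrite (_ : x = 0) ?linear0 ?add0r //.
  by apply: P0; right; lia.
- move=> m h' _ hI.
  have [h hE] := @Pproj _ _ _ (cdiff C (m + 1)) (f (m + 1 + 1) \- (h' \o cdiff P _)) hI.
  have Eh : E (m + 1) h h' by move=> x; rewrite hE /= subrK.
  exists h; split=> // x; apply: Cac.
  by rewrite linearB -cmapP Eh cdiffK linear0 addr0 subrr.
by move=> h [_ hE]; exists h.
Qed.

(** Composed with the inclusion into the acyclic cone of [s], the map [f] becomes null homotopic.
    The first component of the null homotopy is the lift, and the second, up to sign, is the
    homotopy from [s g] to [f]. *)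
Lemma lift_quasi_iso X Y (s : chain_map Y X) (f : chain_map P X) :
  quasi_iso s -> exists g : chain_map P Y, homotopic (ccomp s g) f.
Proof.
move=> /cone_acyclic/(null_homotopy (ccomp (cone_in s) f))[h hP].
have h1 n : exists g : {linear P (n + 1) -> Y (n + 1)}, forall x, g x = (h n x).1.
  by apply: ex_linear => a x y; rewrite linearP.
have h2 n : exists g : {linear P (n + 1) -> X n}, forall x, g x = (h n x).2.
  by apply: ex_linear => a x y; rewrite linearP.
have [g0 g0E] := @succ_family (fun m => {linear P m -> Y m}) (fun n => sval (boolp.cid (h1 n))).
have gE n x : g0 (n + 1) x = (h n x).1 by rewrite g0E; case: boolp.cid.
have gP n x : g0 (n + 1) (cdiff P n x) = cdiff Y n (g0 n x).
  have [m nE] := int_succ n; subst n; rewrite !gE.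
  have /(congr1 fst)/= := hP m x; move/esym/eqP.
  by rewrite [X in X == _]addrC subr_eq0 => /eqP.
exists (ChainMap gP); exists (fun n => \- sval (boolp.cid (h2 n)) : {linear _ -> _}) => n x /=.
case: boolp.cid => k /= ->; case: boolp.cid => k' /= ->.
have /(congr1 snd)/= -> := hP n x; rewrite gE linearN.
by rewrite -addrA opprD addrA subrr sub0r opprD.
Qed.

End Projective.

(** A homotopy [k] between [s g] and [s g'] makes [(g - g', - k)] a chain map from the shift of [P]
    to the acyclic cone of [s]. The first component of a null homotopy of it is, up to sign, a
    homotopy between [g] and [g']. *)
Lemma lift_unique P X Y (s : chain_map Y X) (g g' : chain_map P Y) :
  bounded P -> (forall n, projective (P n)) ->
  quasi_iso s -> homotopic (ccomp s g) (ccomp s g') -> homotopic g g'.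
Proof.
move=> Pb Pproj /cone_acyclic sac [k kP].
have F0 n : exists F : {linear cshift P n -> cone s n}, forall x,
    F x = (g (n + 1) x - g' (n + 1) x, - k n x).
  apply: ex_linear => a x y; congr pair; rewrite !linearP //=.
  by rewrite scalerDr addrACA.
pose F n := sval (boolp.cid (F0 n)).
have FE n x : F n x = (g (n + 1) x - g' (n + 1) x, - k n x).
  by rewrite /F; case: boolp.cid.
have FP n x : F (n + 1) (cdiff (cshift P) n x) = cdiff (cone s) n (F n x).
  rewrite !FE /= /cone_diff /= !linearN /= !cmapP !linearB; congr pair.
  by have /= -> := kP n x; rewrite opprK [RHS]addrAC subrr add0r.

have [] := null_homotopy (bounded_cshift Pb) _ (ChainMap FP) sac.
  by move=> n; apply: Pproj.
move=> h hP.
have h1 n : exists u : {linear P (n + 1 + 1) -> Y (n + 1)}, forall x, u x = - (h n x).1.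
  by apply: ex_linear => a x y; rewrite linearP scalerN /= opprD.
have [u0 u0E] := @succ_family (fun m => {linear P (m + 1) -> Y m}) (fun n => sval (boolp.cid (h1 n))).
have uE n x : u0 (n + 1) x = - (h n x).1 by rewrite u0E; case: boolp.cid.
exists u0 => m x; have [n mE] := int_succ m; subst m.
have /(congr1 fst) := hP n x; rewrite /= FE /= => ->.
by rewrite !uE !linearN.
Qed.

End Homotopy.

#[export] Instance heq_equiv (C : category) (X Y : C) : Equivalence (@heq C X Y).
Proof.
split; [exact: heq_refl | exact: heq_sym | exact: heq_trans].
Qed.

#[export] Instance cmp_proper (C : category) (X Y Z : C) :
  Proper (@heq C Y Z ==> @heq C X Y ==> @heq C X Z) (@cmp C X Y Z).
Proof. by move=> g g' gg f f' ff; apply: cmp_heq. Qed.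

Section Categories.
Variables (C D : category) (F : functor C D).

Lemma equivalence_fully_faithful :
  (forall X Y (g : hom (F X) (F Y)), exists f, fmap F f =c g) ->
  (forall X Y (f f' : hom X Y), fmap F f =c fmap F f' -> f =c f') ->
  (forall Y, exists X, inhabited (iso (F X) Y)) -> equivalence F.
Proof.
move=> full faith surj.
pose G0 Y := sval (boolp.cid (surj Y)).
have e0 Y : inhabited (iso (F (G0 Y)) Y) by rewrite /G0; case: boolp.cid.
pose e Y : iso (F (G0 Y)) Y := sval (boolp.cid (let: inhabits i := e0 Y in ex_intro (fun=> True) i I)).
pose lift X Y (g : hom (F X) (F Y)) := sval (boolp.cid (full X Y g)).
have liftE X Y g : fmap F (@lift X Y g) =c g by rewrite /lift; case: boolp.cid.
pose G1 Y Y' (h : hom Y Y') := lift _ _ (iso_inv (e Y') \oc (h \oc e Y)).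
have GH Y Y' (g h : hom Y Y') : g =c h -> G1 _ _ g =c G1 _ _ h.
  by move=> gh; apply: faith; rewrite !liftE gh; reflexivity.
have G11 Y : G1 _ _ (idm Y) =c idm (G0 Y).
  by apply: faith; rewrite liftE fmap1 cmp1f iso_homK; reflexivity.
have G1M X Y Z (g : hom Y Z) (f : hom X Y) : G1 _ _ (g \oc f) =c G1 _ _ g \oc G1 _ _ f.
  apply: faith; rewrite fmapM !liftE -!cmpA.
  by rewrite (cmpA (e Y)) iso_invK cmp1f; reflexivity.
pose G := Functor GH G11 G1M; exists G; split; constructor.
- have iK X : lift _ _ (iso_inv (e (F X))) \oc lift _ _ (e (F X) : hom (F (G0 (F X))) (F X)) =c idm (G0 (F X)).
    by apply: faith; rewrite fmapM !liftE iso_homK fmap1; reflexivity.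
  have Ki X : lift _ _ (e (F X) : hom (F (G0 (F X))) (F X)) \oc lift _ _ (iso_inv (e (F X))) =c idm X.
    by apply: faith; rewrite fmapM !liftE iso_invK fmap1; reflexivity.
  apply: (@NatIso C C (fun_comp G F) (fun_id C) (fun X => Iso (iK X) (Ki X))) => X Y f.
  apply: faith; rewrite /= !fmapM !liftE cmpA iso_invK cmp1f; reflexivity.
- apply: (@NatIso D D (fun_comp F G) (fun_id D) e) => X Y f /=.
  by rewrite liftE cmpA iso_invK cmp1f; reflexivity.
Qed.

End Categories.

(** * Homotopic maps agree in the derived category *)

Section HomotopyLocalization.
Variables (A : pzRingType) (P : module_class A).

Section Cylinder.
Variable X : cochain A.

(** The cylinder of [X]: a chain map out of it amounts to two chain maps and a homotopy between
    them. It uses only finite sums of terms of [X], so it stays within a module class. *)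
Definition cyl_term (n : int) : lmodType A := (X (n + 1)%R * (X n * X n))%type.

Definition cyl_diff_fun (n : int) (p : cyl_term n) : cyl_term (n + 1) :=
  (- cdiff X (n + 1) p.1, (p.1 + cdiff X n p.2.1, cdiff X n p.2.2 - p.1)).

Lemma cyl_diff_is_linear n : linear (@cyl_diff_fun n).
Proof.
move=> a [x [y z]] [x' [y' z']]; rewrite /cyl_diff_fun /= !(linearP (cdiff X _)).
have sE m (u v : cyl_term m) : a *: u + v =
  (a *: u.1 + v.1, (a *: u.2.1 + v.2.1, a *: u.2.2 + v.2.2)) by [].
rewrite [RHS]sE /=; congr (_, (_, _)).
- by rewrite opprD scalerN.
- by rewrite [LHS]addrACA -scalerDr.
- by rewrite opprD -scalerN [LHS]addrACA -scalerDr.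
Qed.

HB.instance Definition _ n := GRing.isLinear.Build A
  (cyl_term n) (cyl_term (n + 1)) *:%R (@cyl_diff_fun n) (@cyl_diff_is_linear n).

Definition cylinder : cochain A.
Proof.
exists cyl_term (fun n => @cyl_diff_fun n) => n [x [y z]].
congr (_, (_, _)); rewrite /=.
- by rewrite linearN cdiffK !oppr0.
- by rewrite linearD cdiffK addr0 addNr.
- by rewrite linearB cdiffK sub0r opprK addNr.
Defined.

Lemma ex_cyl_in0 n : exists f : {linear X n -> cyl_term n}, forall x, f x = (0, (x, 0)).
Proof. by apply: ex_linear => a x y; congr (_, (_, _)); rewrite /= scaler0 addr0. Qed.

Lemma ex_cyl_in1 n : exists f : {linear X n -> cyl_term n}, forall x, f x = (0, (0, x)).
Proof. by apply: ex_linear => a x y; congr (_, (_, _)); rewrite /= scaler0 addr0. Qed.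

Lemma ex_cyl_proj n : exists f : {linear cyl_term n -> X n}, forall x, f x = x.2.1 + x.2.2.
Proof. by apply: ex_linear => a x y; rewrite scalerDr [LHS]addrACA. Qed.

Definition cyl_in0 : chain_map X cylinder.
Proof.
exists (fun n => sval (boolp.cid (ex_cyl_in0 n))) => n x.
case: boolp.cid => f /= ->; case: boolp.cid => g /= ->.
by congr (_, (_, _)); rewrite /= ?linear0 ?oppr0 ?add0r ?addr0.
Defined.

Definition cyl_in1 : chain_map X cylinder.
Proof.
exists (fun n => sval (boolp.cid (ex_cyl_in1 n))) => n x.
case: boolp.cid => f /= ->; case: boolp.cid => g /= ->.
by congr (_, (_, _)); rewrite /= ?linear0 ?oppr0 ?add0r ?addr0.
Defined.

Definition cyl_proj : chain_map cylinder X.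
Proof.
exists (fun n => sval (boolp.cid (ex_cyl_proj n))) => n x.
case: boolp.cid => f /= ->; case: boolp.cid => g /= ->.
by rewrite /= linearD [LHS]addrC addrA subrK addrC.
Defined.

Lemma cyl_in0E n x : cyl_in0 n x = (0, (x, 0)).
Proof. by rewrite /=; case: boolp.cid. Qed.

Lemma cyl_in1E n x : cyl_in1 n x = (0, (0, x)).
Proof. by rewrite /=; case: boolp.cid. Qed.

Lemma cyl_projE n x : cyl_proj n x = x.2.1 + x.2.2.
Proof. by rewrite /=; case: boolp.cid. Qed.

Lemma cyl_proj_quasi_iso : quasi_iso cyl_proj.
Proof.
move=> n; apply/bijective_coh_mapP; split=> [[x [y z]] [_ dy dz] [u]|y dy].
  rewrite cyl_projE /= => uE; exists (y, (0, u)).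
  move/eqP: dy; rewrite addr_eq0 => /eqP dy.
  congr (_, (_, _)); rewrite /=.
  - by rewrite dy.
  - by rewrite linear0 addr0.
  - by rewrite uE [y + z]addrC addrK.
exists (0, (y, 0)); split.
  by congr (_, (_, _)); rewrite /= ?linear0 ?dy ?oppr0 ?add0r ?subr0.
by exists 0; rewrite cyl_projE /= addr0 subrr linear0.
Qed.

Lemma bounded_cylinder : bounded X -> bounded cylinder.
Proof.
move=> [a [b X0]]; exists (a - 1), b => n nab [x [y z]].
have X1 (u : X (n + 1)) : u = 0 by apply: X0; case: nab; [left | right]; lia.
have X2 (u : X n) : u = 0 by apply: X0; case: nab; [left | right]; lia.
by congr (_, (_, _)); rewrite ?[LHS]X1 ?[LHS]X2.
Qed.

End Cylinder.

Definition bcylinder (X : bcomplex P) : bcomplex P :=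
  @BComplex _ P (cylinder X) (bounded_cylinder (bcochain_bounded X))
    (fun n => in_class_sum (bcochain_in X (n + 1))
      (in_class_sum (bcochain_in X n) (bcochain_in X n))).

Lemma DmorM (X Y Z : bcomplex P) (g : chain_map Y Z) (f : chain_map X Y) :
  @Dmor _ P X Z (ccomp g f) =c Dmor g \oc Dmor f.
Proof. exact: zz_homM. Qed.

Lemma Dmor_eq (X Y : bcomplex P) (f g : chain_map X Y) :
  (forall n x, f n x = g n x) -> Dmor f =c Dmor g.
Proof. by move=> fg; apply: (@zz_heq (bcomplex_cat P) (@bqis A P) X Y f g). Qed.

Lemma Dmor_mono (X Y Z : bcomplex P) (s : chain_map Y Z) (f g : @hom (Dcat P) X Y) :
  quasi_iso s -> Dmor s \oc f =c Dmor s \oc g -> f =c g.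
Proof.
move=> qs sfg.
have sK : (ZZinv (qs : bqis s) : @hom (Dcat P) Z Y) \oc Dmor s =c @idm (Dcat P) Y by apply: zz_invs.
by rewrite -(cmp1f f) -(cmp1f g) -sK -!cmpA sfg; reflexivity.
Qed.

Lemma Dmor_epi (X Y Z : bcomplex P) (s : chain_map X Y) (f g : @hom (Dcat P) Y Z) :
  quasi_iso s -> f \oc Dmor s =c g \oc Dmor s -> f =c g.
Proof.
move=> qs sfg.
have sK : Dmor s \oc (ZZinv (qs : bqis s) : @hom (Dcat P) Y X) =c @idm (Dcat P) Y by apply: zz_sinv.
by rewrite -(cmpf1 f) -(cmpf1 g) -sK !cmpA sfg; reflexivity.
Qed.

(** The localization starts from strict chain maps, so homotopy invariance has to be proved. A
    homotopy is a chain map on the cylinder; both end inclusions are sections of the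
    quasi-isomorphism [cyl_proj], hence equal after localization. *)
Lemma Dmor_homotopic (X Y : bcomplex P) (f g : chain_map X Y) :
  homotopic f g -> Dmor f =c Dmor g.
Proof.
move=> [h hP].
have k0 n : exists k : {linear cylinder X n -> Y n}, forall x,
    k x = h n x.1 + (f n x.2.1 + g n x.2.2).
  apply: ex_linear => a x y; rewrite !linearP /= !scalerDr.
  by rewrite [RHS]addrACA; congr (_ + _); rewrite [RHS]addrACA.
pose k n := sval (boolp.cid (k0 n)).
have kE n x : k n x = h n x.1 + (f n x.2.1 + g n x.2.2) by rewrite /k; case: boolp.cid.
have kP n x : k (n + 1) (cdiff (cylinder X) n x) = cdiff Y n (k n x).
  rewrite !kE /= !linearD !linearN /= !cmapP.
  have /(canRL (subrK _)) -> := hP n x.1.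
  have cancel (V : zmodType) (u v w p q : V) :
      - v + (u + v + w + p + (q - w)) = u + (p + q).
    rewrite -!addrA addrCA addKr; congr (_ + _).
    by rewrite addrC addrA subrK.
  exact: cancel.
pose K : chain_map (bcylinder X) Y := ChainMap kP.
have in01 : @Dmor _ P X (bcylinder X) (cyl_in0 X) =c Dmor (cyl_in1 X : chain_map X (bcylinder X)).
  apply: (@Dmor_mono X (bcylinder X) X (cyl_proj X)); first exact: cyl_proj_quasi_iso.
  rewrite -!DmorM; apply: Dmor_eq => n x.
  by rewrite /ccomp; cbn -[cyl_proj cyl_in0 cyl_in1]; rewrite !cyl_projE cyl_in0E cyl_in1E /= addr0 add0r.
transitivity (Dmor K \oc Dmor (cyl_in0 X : chain_map X (bcylinder X))).
  rewrite -DmorM; apply: Dmor_eq => n x; cbn -[cyl_in0].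
  by rewrite cyl_in0E kE /= !linear0 add0r addr0.
rewrite in01 -DmorM; apply: Dmor_eq => n x; cbn -[cyl_in1].
by rewrite cyl_in1E kE /= !linear0 !add0r.
Qed.

End HomotopyLocalization.

Lemma chain_factor (A : pzRingType) (P Q X : cochain A) (q : chain_map P Q) (f : chain_map P X) :
  (forall n y, exists x, q n x = y) -> (forall n x, q n x = 0 -> f n x = 0) ->
  exists g : chain_map Q X, forall n x, g n (q n x) = f n x.
Proof.
move=> qs qf; have g0 n := linear_factor (qs n) (qf n).
have gE n x : sval (boolp.cid (g0 n)) (q n x) = f n x by case: boolp.cid.
suff gP n y : sval (boolp.cid (g0 (n + 1))) (cdiff Q n y) =
    cdiff X n (sval (boolp.cid (g0 n)) y) by exists (ChainMap gP) => n x; apply: gE.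
by have [x <-] := qs n y; rewrite -cmapP !gE cmapP.
Qed.

Lemma quasi_iso_cancelr (A : pzRingType) (X Y Z : cochain A) (g : chain_map Y Z)
    (f : chain_map X Y) (h : chain_map X Z) : (forall n x, h n x = g n (f n x)) ->
  quasi_iso f -> quasi_iso h -> quasi_iso g.
Proof.
move=> hE qf qh n; have [f' fK f'K] := qf n.
apply: (eq_bij (bij_comp (qh n) (Bijective f'K fK))) => c /=.
rewrite -[in RHS](f'K c); have [x <-] := subquot_pi_surj (f' c).
apply: etrans (coh_mapE h x) _; apply/esym.
apply: (etrans (congr1 (coh_map g n) (coh_mapE f x))).
apply: etrans (coh_mapE g _) _.
by congr (subquot_pi _ _ _); apply: val_inj; apply/esym/hE.
Qed.

(** * Approximation of complexes *)

Section Action.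
Variables (A : pzRingType) (P : cochain A).
Hypotheses (Pb : bounded P) (Pproj : forall n, projective (P n)).

Notation C := (bcomplex_cat (all_modules A)).
Notation W := (@bqis A (all_modules A)).

(* [zz_act z f g] means that z carries the homotopy class of f to that of g; inverse
   quasi-isomorphisms act by lifting, which is why P has to be projective. *)
Fixpoint zz_act (X Y : C) (z : zigzag W X Y) :
    chain_map P (X : bcomplex (all_modules A)) ->
    chain_map P (Y : bcomplex (all_modules A)) -> Prop :=
  match z in zigzag _ X Y return
    chain_map P (X : bcomplex (all_modules A)) ->
    chain_map P (Y : bcomplex (all_modules A)) -> Prop with
  | ZZhom _ _ k => fun f g => homotopic g (ccomp k f)
  | ZZinv _ _ s _ => fun f g => homotopic (ccomp s g) f
  | ZZcmp _ _ _ z t => fun f g => exists2 h, zz_act t f h & zz_act z h g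
  end.

Lemma zz_act_total X Y (z : zigzag W X Y) f : exists g, zz_act z f g.
Proof.
elim: z f => {X Y} [X Y k|X Y s Ws|X Y Z z IHz t IHt] f /=.
- by exists (ccomp k f); apply: homotopic_eq.
- exact: lift_quasi_iso.
- by have [h fh] := IHt f; have [g hg] := IHz h; exists g, h.
Qed.

Lemma zz_act_homotopic X Y (z : zigzag W X Y) f f' g g' :
  homotopic f f' -> homotopic g g' -> zz_act z f g -> zz_act z f' g'.
Proof.
elim: z f f' g g' => {X Y} [X Y k|X Y s Ws|X Y Z z IHz t IHt] f f' g g' ff' gg' /=.
- move=> gkf; apply: homotopic_trans (homotopic_sym gg') _.
  exact: homotopic_trans gkf (homotopic_compl _ _).
- move=> sgf; apply: homotopic_trans (homotopic_trans _ sgf) ff'.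
  exact/homotopic_compl/homotopic_sym.
- move=> [h fh hg]; have hh : homotopic h h by apply: homotopic_eq.
  by exists h; [apply: IHt fh | apply: IHz hg].
Qed.

Lemma homotopic_refl X (f : chain_map P X) : homotopic f f.
Proof. exact: homotopic_eq. Qed.

(** Makes the action well defined on morphisms of the derived category. The two relations for formal
    inverses are where uniqueness and existence of lifts through quasi-isomorphisms enter. *)
Lemma zz_act_eq X Y (z t : zigzag W X Y) f g :
  zz_eq z t -> zz_act z f g <-> zz_act t f g.
Proof.
move=> zt; elim: zt f g => {X Y z t}.
- by [].
- by move=> X Y z t _ IH f g; rewrite IH.
- by move=> X Y z t u _ IH1 _ IH2 f g; rewrite IH1.
- move=> X Y Z z z' t t' _ IHz _ IHt f g /=.
  by split=> -[h /IHt fh /IHz hg]; exists h.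
- move=> X Y z f g /=; split=> [[h fh gh]|fg].
    apply: zz_act_homotopic fh; first exact: homotopic_refl.
    apply/homotopic_sym/(homotopic_trans gh); exact: homotopic_eq.
  by exists g => //; apply: homotopic_eq.
- move=> X Y z f g /=; split=> [[h fh gh]|fg].
    apply: zz_act_homotopic gh; last exact: homotopic_refl.
    apply/(homotopic_trans fh); exact: homotopic_eq.
  by exists f => //; apply: homotopic_eq.
- move=> X Y Z T z t u f g /=; split=> [[h [k ? ?] ?]|[k ? [h ? ?]]].
    by exists k => //; exists h.
  by exists h => //; exists k.
- move=> X Y k k' kk' f g /=; have kf : homotopic (ccomp k f) (ccomp k' f).
    by apply: homotopic_eq => n x; apply: kk'.
  by split=> /homotopic_trans; apply=> //; apply: homotopic_sym.
- move=> X Y Z g f u v /=; split=> [vE|[h hE vE]].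
    by exists (ccomp f u); [apply: homotopic_refl | apply: homotopic_trans vE _; apply: homotopic_eq].
  apply: homotopic_trans vE _; apply: homotopic_trans (homotopic_compl g hE) _.
  exact: homotopic_eq.
- move=> X Y s Ws f g /=; split=> [[h hE gE]|gf].
    have gf : homotopic g f by apply: lift_unique Ws (homotopic_trans gE hE).
    by apply: homotopic_trans gf _; apply: homotopic_eq.
  exists (ccomp s f); first exact: homotopic_refl.
  apply: homotopic_compl; apply: homotopic_trans gf _; exact: homotopic_eq.
- move=> X Y s Ws f g /=; split=> [[h hE gE]|gf].
    by apply: homotopic_trans gE _; apply: homotopic_trans hE _; apply: homotopic_eq.
  have [h hE] := lift_quasi_iso Pb Pproj f Ws.
  exists h => //; apply: homotopic_trans gf _; apply: homotopic_sym.
  by apply: homotopic_trans hE _; apply: homotopic_eq.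
Qed.

End Action.

(** Links the action with composition: when [f] is a quasi-isomorphism, it rewrites an arbitrary
    zigzag [z] as the fraction of chain maps [g] over [f]. *)
Lemma zz_act_Dmor (A : pzRingType) (P X Y : bcomplex (all_modules A))
    (z : @hom (Dcat (all_modules A)) X Y) (f : chain_map P X) (g : chain_map P Y) :
  zz_act z f g -> z \oc Dmor f =c Dmor g.
Proof.
elim: z f g => {X Y} [X Y k|X Y s Ws|X Y Z z IHz t IHt] f g /=.
- by move=> /Dmor_homotopic gE; apply: zz_trans (zz_sym (DmorM _ _)) (zz_sym gE).
- move=> /Dmor_homotopic sgE; apply: zz_trans (zz_cmp (zz_refl _) (zz_sym sgE)) _.
  apply: zz_trans (zz_cmp (zz_refl _) (DmorM _ _)) _.
  apply: zz_trans (zz_A _ _ _) _.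
  by apply: zz_trans (zz_cmp (zz_invs _) (zz_refl _)) (zz_1z _).
- move=> [h /IHt th /IHz zh]; apply: zz_trans (zz_sym (zz_A _ _ _)) _.
  exact: zz_trans (zz_cmp (zz_refl _) th) zh.
Qed.

Section Approximation.
Variables (A : pzRingType) (P : module_class A).

Record model (X : cochain A) := Model {
  mob : bcomplex P;
  mmap :> chain_map X mob;
  mmap_quasi_iso : quasi_iso mmap;
  mmap_surj : forall n y, exists x, mmap n x = y }.

Definition approximable (X : cochain A) :=
  forall (N : int -> lmodType A) (phi : forall n, {linear X n -> N n}),
    (forall n, P (N n)) ->
    exists m : model X, forall n x, m n x = 0 -> phi n x = 0.

Definition finer X (m m' : model X) := forall n x, m n x = 0 -> m' n x = 0.

Section Models.
Variable X : cochain A.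
Hypothesis Xa : approximable X.

(** The second family accommodates homotopies, whose components start in degree [n + 1] and end in
    degree [n]. Both targets in degree [n + 1] are combined into one module, and [succ_family]
    supplies every degree. *)
Lemma approximable2 (N M : int -> lmodType A) (phi : forall n, {linear X n -> N n})
    (psi : forall n, {linear X (n + 1) -> M n}) :
  (forall n, P (N n)) -> (forall n, P (M n)) ->
  exists m : model X, (forall n x, m n x = 0 -> phi n x = 0) /\
    (forall n x, m (n + 1) x = 0 -> psi n x = 0).
Proof.
move=> PN PM.
pose T m := {L : lmodType A & P L * {linear X m -> L}}%type.
have g0 n : exists g : {linear X (n + 1) -> (N (n + 1)%R * M n)%type},
    forall x, g x = (phi (n + 1) x, psi n x).
  by apply: ex_linear => a x y; rewrite !linearP.
pose g n : T (n + 1) := existT _ (N (n + 1)%R * M n : lmodType A)%type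
  (in_class_sum (PN (n + 1)) (PM n), sval (boolp.cid (g0 n))).
have [t tE] := succ_family g.
have [m mP] := @Xa (fun n => projT1 (t n)) (fun n => (projT2 (t n)).2) (fun n => (projT2 (t n)).1).
have mE n x : m (n + 1) x = 0 -> phi (n + 1) x = 0 /\ psi n x = 0.
  move=> /mP; rewrite tE /=; case: boolp.cid => k /= -> e.
  by split; [have := congr1 fst e | have := congr1 snd e].
exists m; split=> n x; last by move=> /mE[].
by have [k nE] := int_succ n; subst n => /mE[].
Qed.

Lemma finer_common (m1 m2 : model X) : exists m, finer m m1 /\ finer m m2.
Proof.
have k0 n : exists k : {linear X n -> (mob m1 n * mob m2 n)%type},
    forall x, k x = (m1 n x, m2 n x).
  by apply: ex_linear => a x y; rewrite !linearP.
have [n|m mP] := Xa (fun n => sval (boolp.cid (k0 n))).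
  by apply: in_class_sum; apply: bcochain_in.
have mE n x : m n x = 0 -> m1 n x = 0 /\ m2 n x = 0.
  move=> /mP; case: boolp.cid => k /= -> e.
  by split; [have := congr1 fst e | have := congr1 snd e].
by exists m; split=> n x /mE[].
Qed.

Lemma finer_trans (m1 m2 m3 : model X) : finer m1 m2 -> finer m2 m3 -> finer m1 m3.
Proof. by move=> h h' n x /h/h'. Qed.

Lemma model_factor (m : model X) (Y : cochain A) (f : chain_map X Y) :
  (forall n x, m n x = 0 -> f n x = 0) ->
  exists g : chain_map (mob m) Y, forall n x, g n (m n x) = f n x.
Proof. exact: chain_factor (@mmap_surj _ m). Qed.

(** A homotopy consists of linear maps into terms of [Y], so it factors through a fine enough model.
    Quantifying over all finer [m'] lets several such requirements be met by a single model. *)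
Lemma model_homotopic (Y : bcomplex P) (f g : chain_map X Y) : homotopic f g ->
  exists m : model X, forall m', finer m' m -> exists f' g' : chain_map (mob m') Y,
    [/\ forall n x, f' n (m' n x) = f n x, forall n x, g' n (m' n x) = g n x &
        homotopic f' g'].
Proof.
move=> [h hP].
have k0 n : exists k : {linear X n -> (Y n * Y n)%type}, forall x, k x = (f n x, g n x).
  by apply: ex_linear => a x y; rewrite !linearP.
have [||m [mfg mh]] := @approximable2 _ _ (fun n => sval (boolp.cid (k0 n))) h.
- by move=> n; apply: in_class_sum; apply: bcochain_in.
- by move=> n; apply: bcochain_in.
exists m => m' fin.
have mE n x : m' n x = 0 -> f n x = 0 /\ g n x = 0.
  move=> /fin/mfg; case: boolp.cid => k /= -> e.
  by split; [have := congr1 fst e | have := congr1 snd e].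
have [n x /mE[]//|f' f'E] := @model_factor m' Y f.
have [n x /mE[]//|g' g'E] := @model_factor m' Y g.
exists f', g'; split=> //.
have h0 n := linear_factor (@mmap_surj _ m' (n + 1)) (fun x e => mh n x (fin _ _ e)).
exists (fun n => sval (boolp.cid (h0 n))) => n y.
have [x <-] := @mmap_surj _ m' (n + 1) y.
rewrite -cmapP f'E g'E hP.
by congr (cdiff _ _ _ + _); case: boolp.cid => k /= ->.
Qed.

End Models.
End Approximation.

Lemma Dmor_inv (A : pzRingType) (P : module_class A) (X Y : bcomplex P) (s : chain_map X Y) (qs : quasi_iso s) :
  (ZZinv (qs : bqis s) : @hom (Dcat P) Y X) \oc Dmor s =c @idm (Dcat P) X /\
  Dmor s \oc (ZZinv (qs : bqis s) : @hom (Dcat P) Y X) =c @idm (Dcat P) Y.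
Proof. by split; [apply: zz_invs | apply: zz_sinv]. Qed.

(** * The criterion for the equivalence *)

Section Criterion.
Variables (A : pzRingType) (P : module_class A).

Section Resolution.
Variable R : bcomplex (all_modules A).
Hypotheses (Rproj : forall n, projective (R n)) (Ra : approximable P R).

(** All complexes along the zigzag lie over [P], so every homotopy that occurs in the action
    descends to a fine model. There the action becomes an identity between morphisms of [Db P]
    itself, not only of the larger category. *)
Lemma model_action (X Y : Db P) (z : hom X Y)
    (f : chain_map R (X : bcomplex P)) (g : chain_map R (Y : bcomplex P)) :
  @zz_act A R (bincl X) (bincl Y) (fmap (Dincl P) z) f g ->
  exists m : model P R, forall m', finer m' m ->
    exists (f' : chain_map (mob m') (X : bcomplex P)) (g' : chain_map (mob m') (Y : bcomplex P)),
      [/\ forall n x, f' n (m' n x) = f n x, forall n x, g' n (m' n x) = g n x &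
          z \oc (Dmor f' : @hom (Db P) (mob m') X) =c (Dmor g' : @hom (Db P) (mob m') Y)].
Proof.
elim: z f g => {X Y} [X Y k|X Y s Ws|X Y Z z IHz t IHt] f g.
- move=> /= gE; have [m1 m1P] := model_homotopic Ra gE.
  (* The trivial homotopy serves to obtain a model through which [f] itself factors. *)
  have [m2 m2P] := model_homotopic Ra (homotopic_refl f).
  have [m [mm1 mm2]] := finer_common Ra m1 m2.
  exists m => m' m'm.
  have [g' [kf' [g'E kf'E g'kf']]] := m1P _ (finer_trans m'm mm1).
  have [f' [_ [f'E _ _]]] := m2P _ (finer_trans m'm mm2).
  exists f', g'; split=> //.
  apply: zz_trans (zz_sym (DmorM (k : chain_map X Y) f')) _.
  apply: zz_trans (zz_sym (Dmor_homotopic g'kf')); apply: Dmor_eq => n y.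
  by have [x <-] := mmap_surj y; rewrite kf'E /= f'E.
- move=> /= gE; have [m1 m1P] := model_homotopic Ra gE.
  have [m2 m2P] := model_homotopic Ra (homotopic_refl g).
  have [m [mm1 mm2]] := finer_common Ra m1 m2.
  exists m => m' m'm.
  have [sg' [f' [sg'E f'E sg'f']]] := m1P _ (finer_trans m'm mm1).
  have [g' [_ [g'E _ _]]] := m2P _ (finer_trans m'm mm2).
  exists f', g'; split=> //.
  apply: (Dmor_mono (s := (s : chain_map X Y)) Ws).
  rewrite cmpA (Dmor_inv Ws).2 cmp1f -DmorM -(Dmor_homotopic sg'f').
  apply: Dmor_eq => n y.
  by have [x <-] := mmap_surj y; rewrite sg'E /= g'E.
- move=> [h /IHt[m1 m1P] /IHz[m2 m2P]].
  have [m [mm1 mm2]] := finer_common Ra m1 m2.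
  exists m => m' m'm.
  have [f' [h' [f'E h'E tE]]] := m1P _ (finer_trans m'm mm1).
  have [h'' [g' [h''E g'E zE]]] := m2P _ (finer_trans m'm mm2).
  exists f', g'; split=> //.
  apply: zz_trans (zz_sym (zz_A _ _ _)) _; apply: zz_trans zE.
  apply: zz_cmp (zz_refl _) (zz_trans tE _); apply: Dmor_eq => n y.
  by have [x <-] := mmap_surj y; rewrite h'E h''E.
Qed.

End Resolution.

Hypothesis resolution : forall X : bcomplex (all_modules A), (forall n, P (coh X n)) ->
  exists (R : bcomplex (all_modules A)) (p : chain_map R X),
    [/\ quasi_iso p, forall n, projective (R n) & approximable P R].

(** Equal images carry [p] to the same homotopy class, so on a fine model both arrows have the same
    composite with the quasi-isomorphism [p'] induced by [p], which is invertible in [Db P]. *)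
Lemma Db_inclusion_faithful (X Y : Db P) (z t : hom X Y) :
  fmap (Db_inclusion P) z =c fmap (Db_inclusion P) t -> z =c t.
Proof.
move=> zt; have [R [p [qp Rproj Ra]]] := resolution (Dincl_coh X).
have Rb := bcochain_bounded R.
have [g zg] := zz_act_total Rb Rproj (fmap (Dincl P) z) p.
have tg : zz_act (fmap (Dincl P) t) p g by apply/(zz_act_eq Rb Rproj _ _ zt).
have [m1 m1P] := model_action Ra zg; have [m2 m2P] := model_action Ra tg.
have [m [mm1 mm2]] := finer_common Ra m1 m2.
have [p' [g' [p'E g'E zE]]] := m1P _ mm1.
have [p'' [g'' [p''E g''E tE]]] := m2P _ mm2.
have qp' : quasi_iso p'.
  by apply: quasi_iso_cancelr (mmap_quasi_iso m) qp => n x; rewrite p'E.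
apply: (Dmor_epi (s := p') qp'); apply: (heq_trans zE).
have gg : Dmor g' =c Dmor g''.
  by apply: Dmor_eq => n y; have [x <-] := mmap_surj y; rewrite g'E g''E.
have pp : Dmor p'' =c Dmor p'.
  by apply: Dmor_eq => n y; have [x <-] := mmap_surj y; rewrite p'E p''E.
apply: (heq_trans gg); apply: (heq_trans (heq_sym tE)).
by apply: cmp_heq; [apply: heq_refl | exact: pp].
Qed.

(** The action turns [h] into a fraction [g] over [p] with source [R]. A model on which both [p] and
    [g] factor replaces [R], and the resulting fraction lies over [P]. *)
Lemma Db_inclusion_full (X Y : Db P) (h : hom (Db_inclusion P X) (Db_inclusion P Y)) :
  exists z, fmap (Db_inclusion P) z =c h.
Proof.
have [R [p [qp Rproj Ra]]] := resolution (Dincl_coh X).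
have Rb := bcochain_bounded R.
have [g hg] := @zz_act_total A R Rb Rproj (bincl X) (bincl Y) h p.
have k0 n : exists k : {linear R n -> ((X : bcomplex P) n * (Y : bcomplex P) n)%type},
    forall x, k x = (p n x, g n x).
  by apply: ex_linear => a x y; rewrite !linearP.
have [n|m mP] := Ra _ (fun n => sval (boolp.cid (k0 n))).
  by apply: in_class_sum; apply: bcochain_in.
have mE n x : m n x = 0 -> p n x = 0 /\ g n x = 0.
  move=> /mP; case: boolp.cid => k /= -> e.
  by split; [have := congr1 fst e | have := congr1 snd e].
have [n x /mE[]//|p' p'E] := @model_factor A P R m (X : bcomplex P) p.
have [n x /mE[]//|g' g'E] := @model_factor A P R m (Y : bcomplex P) g.
have qp' : quasi_iso p'.
  by apply: quasi_iso_cancelr (mmap_quasi_iso m) qp => n x; rewrite p'E.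
exists (ZZcmp (Dmor g') (ZZinv (qp' : bqis (p' : @hom (bcomplex_cat P) (mob m) X)))).
have hp := zz_act_Dmor hg.
apply: (@Dmor_epi _ (all_modules A) R (bincl X) (bincl Y) p) => //.
apply: heq_trans (heq_sym hp).
pose qp'1 : @quasi_iso A (bincl (mob m)) (bincl X) p' := qp'.
have pE : @Dmor _ (all_modules A) R (bincl X) p =c
    @Dmor _ (all_modules A) (bincl (mob m)) (bincl X) p' \oc
    @Dmor _ (all_modules A) R (bincl (mob m)) m.
  by rewrite -DmorM; apply: Dmor_eq => n x; rewrite /= p'E.
have gE : @Dmor _ (all_modules A) R (bincl Y) g =c
    @Dmor _ (all_modules A) (bincl (mob m)) (bincl Y) g' \oc
    @Dmor _ (all_modules A) R (bincl (mob m)) m.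
  by rewrite -DmorM; apply: Dmor_eq => n x; rewrite /= g'E.
transitivity ((@Dmor _ (all_modules A) (bincl (mob m)) (bincl Y) g' \oc
  (ZZinv (qp'1 : bqis _) : @hom (Dcat (all_modules A)) (bincl X) (bincl (mob m)))) \oc
  @Dmor _ (all_modules A) R (bincl X) p).
  exact: heq_refl.
rewrite pE gE -cmpA; apply: cmp_heq; first exact: heq_refl.
apply: heq_trans (cmpA _ _ _) _.
exact: heq_trans (cmp_heq (Dmor_inv qp'1).1 (heq_refl _)) (cmp1f _).
Qed.

Lemma Db_inclusion_surj (Y : Db_coh P) :
  exists X : Db P, inhabited (iso (Db_inclusion P X) Y).
Proof.
case: Y => X PX; have [R [p [qp Rproj Ra]]] := resolution PX.
(* Any model will do; zero maps to the cohomology modules are a family with targets in [P]. *)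
have [m _] := Ra (fun n => coh X n) (fun n => null_fun _) PX.
pose D := Dcat (all_modules A).
have qm : @quasi_iso A R (bincl (mob m)) m by apply: mmap_quasi_iso.
pose u : @hom D (bincl (mob m)) X := Dmor p \oc (ZZinv (qm : bqis _) : @hom D (bincl (mob m)) R).
pose v : @hom D X (bincl (mob m)) := @Dmor _ (all_modules A) R (bincl (mob m)) m \oc (ZZinv (qp : bqis _) : @hom D X R).
have vu : v \oc u =c @idm D (bincl (mob m)).
  transitivity (@Dmor _ (all_modules A) R (bincl (mob m)) m \oc
    (ZZinv (qm : bqis _) : @hom D (bincl (mob m)) R)); last exact: (Dmor_inv qm).2.
  rewrite /u /v -cmpA; apply: cmp_heq; first exact: heq_refl.
  apply: heq_trans (cmpA _ _ _) _.
  exact: heq_trans (cmp_heq (Dmor_inv qp).1 (heq_refl _)) (cmp1f _).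
have uv : u \oc v =c @idm D X.
  transitivity (Dmor p \oc (ZZinv (qp : bqis _) : @hom D X R)); last exact: (Dmor_inv qp).2.
  rewrite /u /v -cmpA; apply: cmp_heq; first exact: heq_refl.
  apply: heq_trans (cmpA _ _ _) _.
  exact: heq_trans (cmp_heq (Dmor_inv qm).1 (heq_refl _)) (cmp1f _).
exists (mob m); constructor.
exact: (@Iso (Db_coh P) (Db_inclusion P (mob m)) (exist _ X PX) u v vu uv).
Qed.

(** Shifts and cones are the same on both sides, so the comparison isomorphism has identity
    components. Its naturality still takes an induction over zigzags. *)
Lemma Db_inclusion_triangulated : triangulated (Db_inclusion P).
Proof.
pose D := Dcat (all_modules A).
have e1 (X : Db P) : @idm D (bincl (bshift X)) \oc @idm D (bincl (bshift X)) =c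
  @idm D (bincl (bshift X)) by apply: cmp1f.
pose eta0 (X : Db P) := @Iso (Db_coh P) (fun_comp (Db_inclusion P) shift X)
  (fun_comp shift (Db_inclusion P) X) (@idm D (bincl (bshift X)))
  (@idm D (bincl (bshift X))) (e1 X) (e1 X).
have Fshift (X Y : Db P) (f : hom X Y) :
    fmap (Dincl P) (fmap (@Dshift A P) f) =c fmap (@Dshift A _) (fmap (Dincl P) f).
  elim: f => {X Y} [X Y k|X Y s Ws|X Y Z z IHz t IHt].
  - exact: heq_refl.
  - exact: heq_refl.
  - exact: cmp_heq IHz IHt.
have sq (X Y : Db P) (f : hom X Y) : eta0 Y \oc fmap (fun_comp (Db_inclusion P) shift) f =c
    fmap (fun_comp shift (Db_inclusion P)) f \oc eta0 X.
  apply: heq_trans (cmp1f _) _; apply: heq_trans _ (heq_sym (cmpf1 _)).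
  exact: Fshift.
exists (NatIso sq) => X Y Z u v w [X' [Y' [f [a [b [c [ub vc wa]]]]]]].
pose F := Dincl P.
pose Fiso (V W : Db P) (i : @iso (Dcat P) V W) : @iso D (F V) (F W) :=
  Iso (heq_trans (heq_sym (fmapM F _ _)) (heq_trans (fmap_heq F (iso_homK i)) (fmap1 F _)))
   (heq_trans (heq_sym (fmapM F _ _)) (heq_trans (fmap_heq F (iso_invK i)) (fmap1 F _))).
exists (bincl X'), (bincl Y'), f, (Fiso _ _ a), (Fiso _ _ b), (Fiso _ _ c); split.
- exact: (fmap_heq F ub).
- exact: (fmap_heq F vc).
- apply: heq_trans (fmap_heq F wa).
  apply: heq_trans (cmp_heq _ (cmp1f _)) _; first exact: heq_refl.
  apply: heq_trans _ (heq_sym (fmapM F _ _)).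
  apply: cmp_heq; last exact: heq_refl.
  exact/heq_sym/Fshift.
Qed.

Theorem Db_inclusion_equivalence : triangulated_equivalence (Db_inclusion P).
Proof.
split; first exact: Db_inclusion_triangulated.
apply: equivalence_fully_faithful.
- exact: Db_inclusion_full.
- exact: Db_inclusion_faithful.
- exact: Db_inclusion_surj.
Qed.

End Criterion.

(** * Resolutions by devissage *)

Section Extension.
Variables (A : pzRingType) (X Y : cochain A) (u : forall n, {linear X n -> Y (n + 1)}).
Hypothesis uP : forall n x, u (n + 1) (cdiff X n x) = - cdiff Y (n + 1) (u n x).

Definition ext_term (n : int) : lmodType A := (X n * Y n)%type.

(** Up to sign conventions this is the cone of a map to [Y] from [X] shifted by minus one. Taking
    [u] of degree one avoids the negative shift and the transports it would bring. *)
Definition ext_diff (n : int) (p : ext_term n) : ext_term (n + 1) :=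
  (cdiff X n p.1, u n p.1 + cdiff Y n p.2).

Lemma ext_diff_is_linear n : linear (@ext_diff n).
Proof.
move=> a p q; rewrite /ext_diff /= !linearP; congr pair => /=.
by rewrite scalerDr [LHS]addrACA.
Qed.

HB.instance Definition _ n := GRing.isLinear.Build A
  (ext_term n) (ext_term (n + 1)) *:%R (@ext_diff n) (@ext_diff_is_linear n).

Definition extension : cochain A.
Proof.
exists ext_term (fun n => @ext_diff n) => n [x y]; congr pair; rewrite /= ?cdiffK //.
by rewrite linearD cdiffK addr0 uP addNr.
Defined.

Lemma bounded_extension : bounded X -> bounded Y -> bounded extension.
Proof.
move=> [a [b X0]] [a' [b' Y0]].
exists (Num.min a a'), (Num.max b b') => n nab [x y]; congr pair.
  apply: X0; case: nab; rewrite ?lt_min ?gt_max => /andP[h _]; by [left | right].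
by apply: Y0; case: nab; rewrite ?lt_min ?gt_max => /andP[_ h]; [left | right].
Qed.

End Extension.

Section ExtensionMap.
Variables (A : pzRingType) (X Y X' Y' : cochain A).
Variables (u : forall n, {linear X n -> Y (n + 1)}) (u' : forall n, {linear X' n -> Y' (n + 1)}).
Hypothesis uP : forall n x, u (n + 1) (cdiff X n x) = - cdiff Y (n + 1) (u n x).
Hypothesis u'P : forall n x, u' (n + 1) (cdiff X' n x) = - cdiff Y' (n + 1) (u' n x).
Variables (f : chain_map X X') (g : chain_map Y Y').
Hypothesis fgP : forall n x, u' n (f n x) = g (n + 1) (u n x).

Lemma ex_extension_map : exists h : chain_map (extension uP) (extension u'P),
  forall n x, h n x = (f n x.1, g n x.2).
Proof.
have k0 n : exists k : {linear extension uP n -> extension u'P n},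
    forall x, k x = (f n x.1, g n x.2).
  by apply: ex_linear => a x y; rewrite !linearP.
pose k n := sval (boolp.cid (k0 n)).
have kE n x : k n x = (f n x.1, g n x.2) by rewrite /k; case: boolp.cid.
have kP n x : k (n + 1) (cdiff (extension uP) n x) = cdiff (extension u'P) n (k n x).
  by rewrite !kE; congr pair; rewrite /= ?cmapP // linearD cmapP fgP.
by exists (ChainMap kP).
Qed.

End ExtensionMap.

Definition kernel_acyclic (A : pzRingType) (X Y : cochain A) (q : chain_map X Y) :=
  forall n (x : X (n + 1)), q (n + 1) x = 0 -> cdiff X (n + 1) x = 0 ->
    exists2 y, q n y = 0 & cdiff X n y = x.

Lemma quasi_iso_surj (A : pzRingType) (X Y : cochain A) (q : chain_map X Y) :
  (forall n y, exists x, q n x = y) -> quasi_iso q <-> kernel_acyclic q.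
Proof.
move=> qs; split=> [qq n x qx dx|qk n].
  have [inj _] := (bijective_coh_mapP q n).1 (qq n).
  have [|y1 y1E] := inj x dx; first by exists 0; rewrite linear0 qx.
  have [m nE] := int_succ n; subst n.
  have [_ surj] := (bijective_coh_mapP q m).1 (qq m).
  have [|y2 [dy2 [z zE]]] := surj (q _ y1); first by rewrite -cmapP y1E qx.
  have [w wE] := qs _ z; exists (y1 - y2 - cdiff X m w).
    by rewrite !linearB /= cmapP wE zE subrr.
  by rewrite !linearB /= y1E dy2 cdiffK !subr0.
apply/bijective_coh_mapP; split=> [x dx [z zE]|y dy].
  have [w wE] := qs _ z; have [||v _ vE] := qk n (x - cdiff X n w).
  - by rewrite linearB cmapP wE zE subrr.
  - by rewrite linearB cdiffK dx subrr.
  by exists (v + w); rewrite linearD vE subrK.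
have [w wE] := qs _ y; have [||v qv vE] := qk (n + 1) (cdiff X (n + 1) w).
- by rewrite cmapP wE dy.
- exact: cdiffK.
exists (w - v); split; first by rewrite linearB vE subrr.
by exists 0; rewrite linear0 linearB qv subr0 wE subrr.
Qed.

Section Approximable.
Variables (A : pzRingType) (P : module_class A).

(** First [Y] is approximated, then [X] so finely that the composite of [u] with the model of [Y]
    also factors. Then [u] descends, and the extension of the two models is a model. *)
Lemma approximable_extension (X Y : cochain A) (u : forall n, {linear X n -> Y (n + 1)})
    (uP : forall n x, u (n + 1) (cdiff X n x) = - cdiff Y (n + 1) (u n x)) :
  approximable P X -> approximable P Y -> approximable P (extension uP).
Proof.
move=> Xa Ya N phi PN.
have phi1 n : exists k : {linear X n -> N n}, forall x, k x = phi n (x, 0).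
  by apply: ex_linear => a x y; rewrite -linearP; congr (phi n (_, _)); rewrite /= scaler0 addr0.
have phi2 n : exists k : {linear Y n -> N n}, forall x, k x = phi n (0, x).
  by apply: ex_linear => a x y; rewrite -linearP; congr (phi n (_, _)); rewrite /= scaler0 addr0.
have [mY mYP] := Ya _ (fun n => sval (boolp.cid (phi2 n))) PN.
have psi0 n : exists k : {linear X n -> (N n * mob mY (n + 1)%R)%type},
    forall x, k x = (phi n (x, 0), mY (n + 1) (u n x)).
  apply: ex_linear => a x y; rewrite !linearP /=; congr pair => /=.
  by rewrite -linearP; congr (phi n (_, _)); rewrite /= scaler0 addr0.
have [n|mX mXP] := Xa _ (fun n => sval (boolp.cid (psi0 n))).
  by apply: in_class_sum; [apply: PN | apply: bcochain_in].
have mXE n x : mX n x = 0 -> phi n (x, 0) = 0 /\ mY (n + 1) (u n x) = 0.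
  move=> /mXP; case: boolp.cid => k /= -> e.
  by split; [have := congr1 fst e | have := congr1 snd e].
have u0 n := @linear_factor _ _ _ _ (mX n) (mY (n + 1) \o u n) (@mmap_surj _ _ _ mX n)
  (fun x e => (mXE n x e).2).
pose u' n := sval (boolp.cid (u0 n)).
have u'E n x : u' n (mX n x) = mY (n + 1) (u n x) by rewrite /u'; case: boolp.cid.
have u'P n x : u' (n + 1) (cdiff (mob mX) n x) = - cdiff (mob mY) (n + 1) (u' n x).
  by have [y <-] := mmap_surj x; rewrite -cmapP !u'E uP linearN cmapP.
pose Q : bcomplex P := @BComplex _ P (extension u'P)
  (bounded_extension u'P (bcochain_bounded _) (bcochain_bounded _))
  (fun n => in_class_sum (bcochain_in (mob mX) n) (bcochain_in (mob mY) n)).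
have [q qE] := ex_extension_map uP u'P u'E.
have qs n y : exists x, q n x = y.
  case: y => y1 y2; have [x1 <-] := mmap_surj y1; have [x2 <-] := mmap_surj y2.
  by exists (x1, x2); rewrite qE.
have kX := (quasi_iso_surj (@mmap_surj _ _ _ mX)).1 (mmap_quasi_iso mX).
have kY := (quasi_iso_surj (@mmap_surj _ _ _ mY)).1 (mmap_quasi_iso mY).
have qq : quasi_iso q.
  apply/(quasi_iso_surj qs) => n [x y]; rewrite qE => -[/= mx my] [dx dy].
  have [x0 mx0 x0E] := kX n x mx dx.
  have [||y0 my0 y0E] := kY n (y - u n x0).
  - by rewrite linearB my -u'E mx0 linear0 subrr.
  - by rewrite linearB -[X in _ - X]opprK -uP x0E opprK [LHS]addrC.
  exists (x0, y0); first by rewrite qE /= mx0 my0.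
  by congr pair => //=; rewrite y0E [LHS]addrC subrK.
exists (@Model _ P _ Q q qq qs) => n [x y]; rewrite [mmap _]/= qE => -[/= mx my].
have -> : (x, y) = ((x, 0) : extension uP n) + (0, y).
  by congr pair; rewrite /= ?addr0 ?add0r.
rewrite linearD (mXE n x mx).1 add0r.
by have := mYP n y my; case: boolp.cid => k /= ->.
Qed.

End Approximable.

Section Cohomology.
Variable A : pzRingType.
Implicit Types X Y S : cochain A.

Lemma coh0P X n : (forall c : coh X n, c = 0) <->
  (forall x, cdiff X (n + 1) x = 0 -> exists y, cdiff X n y = x).
Proof.
split=> [c0 x dx|ac c].
  have Zx : x \in ker_pred (cdiff X (n + 1)) by apply/eqP.
  by have /subquot_pi0/asboolP := c0 (subquot_pi _ _ (exist _ x Zx)).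
have [[x Zx] <-] := subquot_pi_surj c; apply/subquot_pi0/asboolP.
by apply: ac; apply/eqP.
Qed.

Section LiftAugmentation.
Variables (S X : cochain A) (c : int) (eps : {linear S (c + 1) -> coh X c}).
Hypotheses (Sb : bounded S) (Sproj : forall n, projective (S n)).
Hypothesis Stop : forall n, c + 1 < n -> forall x : S n, x = 0.
Hypothesis epsd : forall y, eps (cdiff S c y) = 0.
Hypothesis Xlow : forall n, n < c -> forall h : coh X n, h = 0.

(** The comparison theorem for projective resolutions: [eps] lifts to cycles in the top degree
    [c + 1], and the vanishing of the lower cohomology of [X] lets the lift continue downwards. *)
Lemma lift_augmentation : exists g : chain_map S X, forall s,
  exists2 w, subquot_pi _ _ w = eps s & \val w = g (c + 1) s.
Proof.
have [a [b S0]] := Sb.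
have [w wE] := @Sproj _ _ _ (subquot_pi (ker_pred (cdiff X (c + 1))) (im_pred (cdiff X c)))
  eps (fun s => subquot_pi_surj (eps s)).
pose E n (t : {linear S n -> X n}) (t' : {linear S (n + 1) -> X (n + 1)}) :=
  forall x, t' (cdiff S n x) = cdiff X n (t x).
pose Inv m (t : {linear S (m + 1) -> X (m + 1)}) :=
  forall y, exists u, cdiff X m u = t (cdiff S m y).
have E0 n t t' : (forall x : S n, x = 0) -> E n t t'.
  by move=> Sn0 x; rewrite (Sn0 x) !linear0.
pose z n : {linear S n -> X n} := null_fun (X n).
have [] := @down_family _ E Inv a c z (\val \o w : {linear _ -> _}).
- by move=> n t t' na; apply: E0; apply: S0; left.
- by move=> n t t' cn; apply: E0; apply: Stop.
- move=> t' x; rewrite (_ : cdiff S (c + 1) x = 0); last by apply: Stop; lia.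
  by rewrite linear0; apply/esym/eqP; exact: valP (w x).
- move=> y; have : subquot_pi (ker_pred (cdiff X (c + 1))) (im_pred (cdiff X c)) (w (cdiff S c y)) = 0.
    by rewrite wE epsd.
  by move=> /subquot_pi0/asboolP.
- move=> m t' mc tI.
  have [t tE] := @Sproj _ _ _ (cdiff X (m + 1)) (t' \o cdiff S (m + 1)) tI.
  exists t; split=> [x|y]; first by rewrite tE.
  have mc' : m < c by lia.
  have /coh0P := Xlow mc'; apply.
  by rewrite tE /= cdiffK linear0.
move=> g [gc gE]; exists (ChainMap gE) => s; exists (w s); first exact: wE.
by rewrite /= gc.
Qed.

End LiftAugmentation.

End Cohomology.

Section Devissage.
Variables (A : pzRingType) (P : module_class A) (mu : lmodType A -> nat).
Hypothesis mu_le : forall (M N : lmodType A) (f : {linear M -> N}),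
  P M -> (forall y, exists x, f x = y) -> (mu N <= mu M)%N.
Hypothesis mu_lt : forall (M N : lmodType A) (f : {linear M -> N}) x,
  P M -> (forall y, exists x, f x = y) -> x != 0 -> f x = 0 -> (mu N < mu M)%N.
(** The complex [S] resolves the image of [eps], a nonzero submodule of [M]. Its top degree is
    [c + 1] because [coh X c] is the cohomology in that degree. *)
Hypothesis simple_resolution : forall (M : lmodType A) (x : M) (c : int),
  P M -> x != 0 -> exists (S : bcomplex (all_modules A)) (eps : {linear S (c + 1) -> M}),
    [/\ (forall n, projective (S n)) /\ approximable P S,
        forall n, c + 1 < n -> forall s : S n, s = 0,
        forall n (s : S (n + 1)), n < c -> cdiff S (n + 1) s = 0 -> exists t, cdiff S n t = s,
        forall s, eps s = 0 <-> exists t, cdiff S c t = s &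
        exists s, eps s != 0].

Definition resolvable (X : bcomplex (all_modules A)) :=
  exists (R : bcomplex (all_modules A)) (p : chain_map R X),
    [/\ quasi_iso p, forall n, projective (R n) & approximable P R].

(** The zero complex resolves [X]; the vanishing modules [coh X n] serve as its terms, since they
    are known to lie in [P]. *)
Lemma resolvable_acyclic (X : bcomplex (all_modules A)) :
  (forall n, P (coh X n)) -> (forall n (h : coh X n), h = 0) -> resolvable X.
Proof.
move=> PX X0.
have dK n (x : coh X n) : (null_fun (coh X (n + 1 + 1)) : {linear coh X (n + 1) -> _})
  ((null_fun (coh X (n + 1)) : {linear coh X n -> _}) x) = 0 by [].
pose Z := @Cochain A (fun n => coh X n) _ dK.
have Zb : bounded Z by exists 0, 0 => n _ x; apply: X0.
pose R : bcomplex (all_modules A) := @BComplex _ (all_modules A) Z Zb (fun n => I).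
pose R' : bcomplex P := @BComplex _ P Z Zb PX.
have pP n (x : R n) : (null_fun (X (n + 1)) : {linear R (n + 1) -> _}) (cdiff R n x) =
    cdiff X n ((null_fun (X n) : {linear R n -> _}) x) by rewrite /= linear0.
exists R, (ChainMap pP); split.
- move=> n; apply/bijective_coh_mapP; split=> [x _ _|y /(coh0P X n).1[|u uE]].
  + by exists 0; rewrite [LHS]X0 [RHS]X0.
  + exact: X0.
  + by exists 0; split=> //; exists u; rewrite uE subr0.
- by move=> n; apply: projective0 => x; apply: X0.
- move=> N phi PN.
  have qq : @quasi_iso A R R' (Defs.cid Z).
    apply/(@quasi_iso_surj A R R' (Defs.cid Z)); first by move=> n y; exists y.
    by move=> n x _ _; exists 0; rewrite ?linear0 // [LHS]X0 [RHS]X0.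
  exists (@Model _ P R R' (Defs.cid Z) qq (fun n y => ex_intro _ y erefl)) => n x _.
  by rewrite [x]X0 linear0.
Qed.

Section Step.
Variables (X S : bcomplex (all_modules A)) (c : int) (g : chain_map S X).

(** Following [p] by the projection of the cone to the shift of [S] gives a twisting [u]. The
    extension of [R1] by [S] along [u] maps to [X] by the second component of [p] minus [g], which
    realises the rotated triangle. *)
Lemma resolvable_cone :
  (forall n, projective (S n)) -> approximable P S ->
  resolvable (bcone g) -> resolvable X.
Proof.
move=> Sproj Sa [R1 [p [qp R1proj R1a]]].
have u0 n : exists u : {linear R1 n -> S (n + 1)}, forall x, u x = (p n x).1.
  by apply: ex_linear => a x y; rewrite linearP.
pose u n := sval (boolp.cid (u0 n)).
have uE n x : u n x = (p n x).1 by rewrite /u; case: boolp.cid.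
have uP n x : u (n + 1) (cdiff R1 n x) = - cdiff S (n + 1) (u n x).
  by rewrite !uE cmapP.
have hP n x : (p (n + 1) (cdiff R1 n x)).2 = g (n + 1) (u n x) + cdiff X n (p n x).2.
  by rewrite cmapP /= uE.
pose R : bcomplex (all_modules A) := @BComplex _ (all_modules A) (extension uP)
  (bounded_extension uP (bcochain_bounded R1) (bcochain_bounded S)) (fun n => I).
have f0 n : exists f : {linear R n -> X n}, forall x, f x = (p n x.1).2 - g n x.2.
  by apply: ex_linear => a x y; rewrite !linearP /= scalerDr [LHS]addrACA.
pose f n := sval (boolp.cid (f0 n)).
have fE n x : f n x = (p n x.1).2 - g n x.2 by rewrite /f; case: boolp.cid.
have fP n x : f (n + 1) (cdiff R n x) = cdiff X n (f n x).
  by rewrite !fE /= hP linearD linearB cmapP opprD addrA [X in X - _]addrAC subrr add0r.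
exists R, (ChainMap fP); split.
- move=> n; apply/bijective_coh_mapP.
  have [inj surj] := (bijective_coh_mapP p n).1 (qp n).
  split=> [[y s] [/= dy ds] [z]|x dx].
    rewrite fE /= => zE.
    have [|y0 y0E] := inj y dy.
      exists (s, z); rewrite [p _ y]surjective_pairing; congr pair => /=.
        by rewrite -uE; apply/esym/eqP; rewrite -addr_eq0 ds.
      by rewrite zE [LHS]addrC subrK.
    have [m nE] := int_succ n; subst n.
    have [_ surj1] := (bijective_coh_mapP p m).1 (qp m).
    (* The preimage [y0] of [y] matches [(s, z)] only up to a cycle of the cone; surjectivity one
       degree lower corrects it by a cycle [y2]. *)
    have [|y2 [dy2 [[s3 z3] e]]] := surj1 ((s, z) - p _ y0).
      rewrite linearB -cmapP y0E [p _ y]surjective_pairing; congr pair => /=.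
        rewrite -uE; apply/eqP; rewrite subr_eq0 eq_sym -addr_eq0 ds //.
      by rewrite zE addrCA subrr addr0 subrr.
    have := congr1 fst e; rewrite /= -!uE => {}e.
    exists (y0 + y2, - s3); congr pair => /=.
      by rewrite linearD y0E dy2 addr0.
    rewrite linearN e linearD.
    by rewrite -[X in _ + X = _]addrA -opprD [LHS]addrC subrK.
  have [|y [dy [[s z] e]]] := surj (0, x).
    by congr pair; rewrite /= ?linear0 ?oppr0 ?add0r.
  have := congr1 fst e; have := congr1 snd e; rewrite /= -uE sub0r => ze se.
  exists (y, - s); split.
    by congr pair => //=; rewrite linearN se subrr.
  exists z; rewrite fE /= linearN opprK opprD addrA -ze.
  by rewrite [RHS]addrAC subrr add0r.
- by move=> n; apply: projective_prod.
- exact: approximable_extension.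
Qed.

Variable eps : {linear S (c + 1) -> coh X c}.
Hypothesis Stop : forall n, c + 1 < n -> forall s : S n, s = 0.
Hypothesis Sac : forall n (s : S (n + 1)), n < c -> cdiff S (n + 1) s = 0 ->
  exists t, cdiff S n t = s.
Hypothesis epsP : forall s, eps s = 0 <-> exists t, cdiff S c t = s.
Hypothesis geps : forall s, exists2 w, subquot_pi _ _ w = eps s & \val w = g (c + 1) s.

(** By the long exact sequence of the cone, this amounts to injectivity from the cohomology of [S]
    to that of [X]. The former sits in degree [c + 1], where the map is induced by [eps], whose
    kernel consists of boundaries. *)
Lemma coh_cone_in_surj n (h : coh (bcone g) n) :
  exists h', coh_map (cone_in g : chain_map X (bcone g)) n h' = h.
Proof.
have [[[s y] Zsy] <-] := subquot_pi_surj h.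
have [ds gs] : cdiff S (n + 1 + 1) s = 0 /\ g (n + 1 + 1) s + cdiff X (n + 1) y = 0.
  have /eqP := Zsy; rewrite /= => -[/eqP]; rewrite oppr_eq0 => /eqP ds gs.
  by split.
have [t tE] : exists t, cdiff S (n + 1) t = s.
  have [lt|gt|e] := ltgtP (n + 1) c.
  - exact: Sac.
  - by exists 0; rewrite linear0; apply/esym/Stop; lia.
  - subst c; apply/epsP; have [w <- wE] := geps s; apply/subquot_pi0/asboolP.
    by exists (- y); rewrite linearN wE; apply/eqP; rewrite eq_sym -addr_eq0 gs.
have Zy : y + g (n + 1) t \in ker_pred (cdiff X (n + 1)).
  by apply/eqP; rewrite linearD -cmapP tE [LHS]addrC gs.
pose w : submod (ker_pred (cdiff X (n + 1))) := exist _ (y + g (n + 1) t) Zy.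
exists (subquot_pi _ (im_pred (cdiff X n)) w); apply: etrans (coh_mapE _ _) _.
apply/subquot_piP/asboolP; exists (t, 0).
by congr pair; rewrite /= ?linear0 ?addr0 ?tE ?sub0r // [RHS]addrAC subrr add0r.
Qed.

(** In the cone [g s] bounds, namely as the differential of [(s, 0)], so the class [eps s] dies and
    the length in degree [c + 1] drops strictly. *)
Lemma coh_cone_in_kernel s : eps s != 0 ->
  exists2 h, h != 0 & coh_map (cone_in g : chain_map X (bcone g)) c h = 0.
Proof.
move=> es; exists (eps s) => //; have [w <- wE] := geps s.
apply: etrans (coh_mapE _ _) _; apply/subquot_pi0/asboolP; exists (s, 0).
congr pair; rewrite /= ?linear0 ?addr0 ?wE //.
by rewrite (_ : cdiff S _ s = 0) ?oppr0 //; apply: Stop; lia.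
Qed.

End Step.

(** Induction on a bound for the total length of the cohomology. A resolution is coned off at the
    lowest nonzero cohomology, as required by [lift_augmentation]; the cohomology of the cone is a
    quotient, so it stays in the window of length [k]. *)
Lemma resolvable_length N k (X : bcomplex (all_modules A)) (a : int) :
  (forall n, P (coh X n)) ->
  (forall n (h : coh X n), n < a \/ a + k%:Z <= n -> h = 0) ->
  (\sum_(i < k) mu (coh X (a + i%:Z)) < N)%N -> resolvable X.
Proof.
elim: N X => [|N IHN] X PX Xak //= XN.
have [X0|/existsNP[n /existsNP[h /eqP h0]]] := pselect (forall n (h : coh X n), h = 0).
  exact: resolvable_acyclic.
have exi : exists i : nat, `[< exists h : coh X (a + i%:Z), h != 0 >].
  have an : a <= n by rewrite leNgt; apply: contra h0 => na; apply/eqP/Xak; left.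
  have [j nE] : exists j : nat, n = a + j%:Z by exists (absz (n - a)%R); lia.
  by subst n; exists j; apply/asboolP; exists h.
case: (ex_minnP exi) => i /asboolP[{h0}h h0] imin.
set c := a + i%:Z in h h0.
have Xlow m : m < c -> forall h : coh X m, h = 0.
  move=> mc h'; have [ma|am] := ltP m a; first by apply: Xak; left.
  have [j mE] : exists j : nat, m = a + j%:Z by exists (absz (m - a)%R); lia.
  subst m; apply/eqP/negPn/negP => h'0.
  have := imin j (asboolT (ex_intro _ h' h'0)).
  by move: mc; rewrite /c; lia.
have [S [eps [[Sproj Sa] Stop Sac epsP [s es]]]] := simple_resolution c (PX c) h0.
have epsd y : eps (cdiff S c y) = 0 by apply/epsP; exists y.
have [g gP] := lift_augmentation (bcochain_bounded S) Sproj Stop epsd Xlow.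
have surj n' h' := coh_cone_in_surj Stop Sac epsP gP (n := n') h'.
apply: (resolvable_cone Sproj Sa (g := g)); apply: IHN.
- by move=> m; apply: (in_class_quot (surj m)).
- move=> m h' /Xak mak; have [h'' <-] := surj m h'.
  by rewrite (mak h'') linear0.
- have [h1 h10 h1K] := coh_cone_in_kernel Stop gP es.
  have ik : (i < k)%N.
    by rewrite ltnNge; apply: contra h0 => ki; apply/eqP/Xak; right; rewrite /c; lia.
  rewrite ltnS in XN; apply: leq_trans XN.
  rewrite (bigD1 (Ordinal ik)) //= [X in (_ < X)%N](bigD1 (Ordinal ik)) //= -addSn.
  apply: leq_add; first exact: mu_lt (PX c) (surj c) h10 h1K.
  by apply: leq_sum => j _; apply: mu_le (PX _) (surj _).
Qed.

Lemma resolvable_coh (X : bcomplex (all_modules A)) :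
  (forall n, P (coh X n)) -> resolvable X.
Proof.
move=> PX; have [a [b X0]] := bcochain_bounded X.
(* Cohomology of index [n] sits in degree [n + 1], whence the start [a - 1]; the length is enough to
   pass degree [b]. *)
apply: (@resolvable_length _ (absz (b - a + 2)%R) X (a - 1) PX _ (ltnSn _)) => n h nab.
apply: (coh0P X n).2 => x _; exists 0; rewrite linear0; apply/esym/X0.
by case: nab => h'; [left | right]; lia.
Qed.

End Devissage.

(** * Dimension of modules *)

Section LinearAlgebra.
Variables (K : fieldType) (A : pzRingType) (scal : {rmorphism K -> A}) (M : lmodType A^c).
Implicit Types (m : M) (U : M -> Prop).

Definition kscale (c : K) m : M := ract (scal c) m.

Lemma kscaleDl c d m : kscale (c + d) m = kscale c m + kscale d m.
Proof. by rewrite /kscale /ract rmorphD; apply: scalerDl. Qed.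

Lemma kscaleDr c m m' : kscale c (m + m') = kscale c m + kscale c m'.
Proof. by rewrite /kscale /ract scalerDr. Qed.

Lemma kscaleA c d m : kscale c (kscale d m) = kscale (c * d) m.
Proof. by rewrite mulrC /kscale /ract rmorphM scalerA. Qed.

Lemma kscale1 m : kscale 1 m = m.
Proof. by rewrite /kscale /ract rmorph1; apply: scale1r. Qed.

Lemma kscale0l m : kscale 0 m = 0.
Proof. by rewrite /kscale /ract rmorph0; apply: scale0r. Qed.

Lemma kscale0r c : kscale c 0 = 0.
Proof. by rewrite /kscale /ract scaler0. Qed.

Lemma kscaleNl c m : kscale (- c) m = - kscale c m.
Proof. by apply/eqP; rewrite -addr_eq0 -kscaleDl addNr kscale0l. Qed.

Lemma kscale_sum (I : finType) (c : K) (F : I -> M) :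
  kscale c (\sum_i F i) = \sum_i kscale c (F i).
Proof. exact: (big_morph (kscale c) (kscaleDr c) (kscale0r c)). Qed.

Lemma kscale_suml (I : finType) (c : I -> K) m :
  kscale (\sum_i c i) m = \sum_i kscale (c i) m.
Proof. exact: (big_morph (kscale^~ m) (fun a b => kscaleDl a b m) (kscale0l m)). Qed.

Definition comb (I : finType) (e : I -> M) (c : I -> K) : M := \sum_i kscale (c i) (e i).

Definition kfree (I : finType) (e : I -> M) := forall c, comb e c = 0 -> forall i, c i = 0.

Definition kspan (I : finType) (e : I -> M) m := exists c, m = comb e c.

Lemma combD (I : finType) (e : I -> M) c d : comb e c + comb e d = comb e (fun i => c i + d i).
Proof. by rewrite -big_split; apply: eq_bigr => i _; rewrite kscaleDl. Qed.

Lemma combZ (I : finType) (e : I -> M) a c : kscale a (comb e c) = comb e (fun i => a * c i).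
Proof. by rewrite kscale_sum; apply: eq_bigr => i _; rewrite kscaleA. Qed.

(** A vector in the left kernel of the coefficient matrix of [e] over [g] is a relation among the
    [e i]. Freeness makes the matrix row free, and its rank is at most the number of columns. *)
Lemma steinitz (I J : finType) (e : I -> M) (g : J -> M) :
  kfree e -> (forall i, kspan g (e i)) -> (#|I| <= #|J|)%N.
Proof.
move=> ef /choice[c cE].
pose B : 'M[K]_(#|I|, #|J|) := \matrix_(i, j) c (enum_val i) (enum_val j).
suff : row_free B by rewrite /row_free => /eqP <-; apply: rank_leq_col.
rewrite -kermx_eq0; apply/rowV0P => w /sub_kermxP wB.
have w0 : comb e (fun i => w 0 (enum_rank i)) = 0.
  transitivity (comb g (fun j => \sum_i w 0 (enum_rank i) * c i j)).
    transitivity (\sum_i \sum_j kscale (w 0 (enum_rank i) * c i j) (g j)).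
      apply: eq_bigr => i _; rewrite [e i]cE kscale_sum.
      by apply: eq_bigr => j _; rewrite kscaleA.
    by rewrite exchange_big /comb; apply: eq_bigr => j _; rewrite kscale_suml.
  apply: big1 => j _; rewrite (_ : \sum_i _ = 0) ?kscale0l //.
  have /rowP/(_ (enum_rank j)) := wB; rewrite !mxE => wj; rewrite -[RHS]wj.
  rewrite [RHS](reindex _ (onW_bij _ (enum_rank_bij I))) /=; apply: eq_bigr => i _.
  by rewrite mxE !enum_rankK.
apply/rowP => i; rewrite mxE.
by have := ef _ w0 (enum_val i); rewrite enum_valK.
Qed.

Definition spanned U n := exists e : 'I_n -> M,
  (forall i, U (e i)) /\ (forall m, U m -> kspan e m).

Lemma spanned_drop U n (e : 'I_n.+1 -> M) c k :
  (forall i, U (e i)) -> (forall m, U m -> kspan e m) ->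
  comb e c = 0 -> c k != 0 -> spanned U n.
Proof.
move=> eU eS e0 ck; exists (fun i => e (lift k i)); split=> // m /eS[d ->].
exists (fun i => d (lift k i) - d k / c k * c (lift k i)).
rewrite -[LHS]addr0 -[X in _ + X](kscale0r (- (d k / c k))) -e0 combZ combD.
rewrite /comb (bigD1_ord k) //= mulNr divfK // subrr kscale0l add0r.
by apply: eq_bigr => i _; rewrite mulNr.
Qed.

Lemma spanned_basis U n : spanned U n ->
  exists k (e : 'I_k -> M), [/\ forall i, U (e i), forall m, U m -> kspan e m & kfree e].
Proof.
elim: n => [|n IHn] [e [eU eS]].
  by exists 0%N, e; split=> // c _ [].
have [ef|/existsNP[c /not_implyP[c0 /existsNP[k /eqP ck]]]] := pselect (kfree e).
  by exists n.+1, e.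
exact/IHn/(spanned_drop eU eS c0 ck).
Qed.

Lemma spanned_fin U (I : finType) (e : I -> M) :
  (forall i, U (e i)) -> (forall m, U m -> kspan e m) -> spanned U #|I|.
Proof.
move=> eU eS; exists (fun i => e (enum_val i)); split=> // m /eS[c ->].
exists (fun i => c (enum_val i)).
by rewrite /comb (reindex _ (onW_bij _ (enum_val_bij I))).
Qed.

End LinearAlgebra.

Section Dimension.
Variables (K : fieldType) (A : pzRingType) (scal : {rmorphism K -> A}).

Lemma finite_dimP (M : lmodType A^c) :
  finite_dim scal M <-> exists n, spanned scal (fun _ : M => True) n.
Proof.
split=> [[n [e eP]]|[n [e [_ eP]]]].
  by exists n, e; split=> // m _; have [c] := eP m; exists c.
by exists n, e => m; have [c] := eP m I; exists c.
Qed.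

(** The least size of a generating family, with default value 0 in infinite dimension. It is the
    length function used in the devissage. *)
Definition kdim (M : lmodType A^c) : nat :=
  if pselect (exists n, `[< spanned scal (fun _ : M => True) n >]) is left ex
  then ex_minn ex else 0%N.

Lemma kdimP (M : lmodType A^c) : finite_dim scal M ->
  spanned scal (fun _ : M => True) (kdim M) /\
  forall n, spanned scal (fun _ : M => True) n -> (kdim M <= n)%N.
Proof.
move=> /finite_dimP[n Mn]; rewrite /kdim; case: pselect => [ex|[]].
  by case: ex_minnP => k /asboolP ? kmin; split=> // j ?; apply/kmin/asboolP.
by exists n; apply/asboolP.
Qed.

Lemma spanned_surj (M N : lmodType A^c) (f : {linear M -> N}) n :
  (forall y, exists x, f x = y) -> spanned scal (fun _ : M => True) n ->
  spanned scal (fun _ : N => True) n.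
Proof.
move=> fs [e [_ eS]]; exists (fun i => f (e i)); split=> // y _.
have [x <-] := fs y; have [c ->] := eS x I; exists c.
by rewrite linear_sum; apply: eq_bigr => i _; rewrite /kscale /ract linearZ.
Qed.

Lemma kdim_le (M N : lmodType A^c) (f : {linear M -> N}) :
  finite_dim scal M -> (forall y, exists x, f x = y) -> (kdim N <= kdim M)%N.
Proof.
move=> /kdimP[Ms _] fs; have Ns := spanned_surj fs Ms.
have /kdimP[_] : finite_dim scal N by apply/finite_dimP; exists (kdim M).
exact.
Qed.

Lemma kdim_lt (M N : lmodType A^c) (f : {linear M -> N}) x :
  finite_dim scal M -> (forall y, exists x, f x = y) -> x != 0 -> f x = 0 ->
  (kdim N < kdim M)%N.
Proof.
move=> /kdimP[[e [_ eS]] _] fs x0 fx0; have [c xE] := eS x I.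
case: (kdim M) e eS c xE => [|n] e eS c xE.
  by case/eqP: x0; rewrite xE /comb big_ord0.
have [k ck] : exists k, c k != 0.
  apply: contrapT => nc; case/eqP: x0; rewrite xE; apply: big1 => i _.
  by have [->|ci] := eqVneq (c i) 0; [rewrite kscale0l | case: nc; exists i].
have fe0 : comb scal (fun i => f (e i)) c = 0.
  rewrite -fx0 xE linear_sum; apply: eq_bigr => i _.
  by rewrite /kscale /ract linearZ.
have Ns : spanned scal (fun _ : N => True) n.
  apply: (@spanned_drop _ _ scal N (fun=> True) n (fun i => f (e i)) c k) => // y _.
  have [z <-] := fs y; have [d ->] := eS z I; exists d.
  by rewrite linear_sum; apply: eq_bigr => i _; rewrite /kscale /ract linearZ.
have /kdimP[_] : finite_dim scal N by apply/finite_dimP; exists n.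
exact.
Qed.

End Dimension.

(** * Path algebras and preprojective algebras *)

Section PathAlgebra.
Variables (K : comNzRingType) (Q : quiver).
Local Notation kQ := (path_alg K Q).
Implicit Types (f g h : kQ) (p : qword Q) (a b : qarrow Q) (v w : qvertex Q).

Definition vertex_elt v : kQ := path_elt K (v, [::]).

Lemma path_coefZ c f p : path_coef (c *: f) p = c * path_coef f p.
Proof. by []. Qed.

Lemma path_coefM f g p : path_coef (f * g) p = path_mul_fun f g p.
Proof. by []. Qed.

Lemma path_scaleAr c f g : f * (c *: g) = c *: (f * g).
Proof.
apply: path_algP => p; rewrite path_coefZ !path_coefM /path_mul_fun mulr_sumr.
by apply: eq_bigr => i _; rewrite path_coefZ mulrCA.
Qed.

Lemma path_coef_elt p q : path_coef (path_elt K p) q = (is_qpath p && (q == p))%:R.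
Proof. by rewrite /path_coef /= /word_fun; case: ifP. Qed.

Lemma path_coef_sum (I : Type) (r : seq I) (P : pred I) (F : I -> kQ) p :
  path_coef (\sum_(i <- r | P i) F i) p = \sum_(i <- r | P i) path_coef (F i) p.
Proof. by elim/big_rec2: _ => // i y1 y2 _ <-. Qed.

Lemma path_coef0_nqpath f p : ~~ is_qpath p -> path_coef f p = 0.
Proof. by apply: contraNeq; apply: path_coef_qpath. Qed.

Definition pconst f v : K := path_coef f (v, [::]).

Lemma arrow_derivative_supp a f :
  ((fun p => if p.1 == qtarget a then path_coef f (qsource a, a :: p.2) else 0)
    : qword Q -> K^o) \in @qsupport K Q.
Proof.
have [_ [S fS]] := asboolP _ (valP f).
apply/asboolP; split=> [[w s] /=|].
  case: (eqVneq w) => [-> /path_coef_qpath|_]; last by rewrite eqxx.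
  by rewrite /is_qpath /= => /andP[].
exists [seq (qtarget a, behead p.2) | p <- S] => -[w s] /=.
case: (eqVneq w) => [-> /fS fs|_]; last by rewrite eqxx.
by apply/mapP; exists (qsource a, a :: s).
Qed.

(** Strips the initial arrow [a], like a Fox derivative. Constants and derivatives together
    determine an element, and most identities in the path algebra below are proved by comparing
    them. *)
Definition arrow_derivative a f : kQ := exist (fun u : qword Q -> K^o => u \in @qsupport K Q) _ (arrow_derivative_supp a f).
Local Notation "''d_' a" := (arrow_derivative a) (at level 8, a at level 2).

Lemma arrow_derivativeE a f p : path_coef ('d_a f) p =
  if p.1 == qtarget a then path_coef f (qsource a, a :: p.2) else 0.
Proof. by []. Qed.

Lemma path_ext f g : (forall v, pconst f v = pconst g v) ->
  (forall a, 'd_a f = 'd_a g) -> f = g.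
Proof.
move=> fg0 fgd; apply: path_algP => -[v [|a s]]; first exact: fg0.
have [<-|nav] := eqVneq (qsource a) v.
  by have := congr1 (fun h => path_coef h (qtarget a, s)) (fgd a); rewrite !arrow_derivativeE eqxx.
by rewrite !path_coef0_nqpath // /is_qpath /= (negPf nav).
Qed.

Lemma arrow_derivative_is_linear a : linear (arrow_derivative a).
Proof.
move=> c f g; apply: path_algP => p.
rewrite path_coefD path_coefZ !arrow_derivativeE path_coefD path_coefZ.
by case: eqP; rewrite ?mulr0 ?addr0.
Qed.

HB.instance Definition _ a :=
  GRing.isLinear.Build K kQ kQ *:%R (arrow_derivative a) (arrow_derivative_is_linear a).

Lemma pconstD f g v : pconst (f + g) v = pconst f v + pconst g v.
Proof. by []. Qed.

Lemma pconstZ c f v : pconst (c *: f) v = c * pconst f v.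
Proof. by []. Qed.

Lemma pconst_sum (I : Type) (r : seq I) (P : pred I) (F : I -> kQ) v :
  pconst (\sum_(i <- r | P i) F i) v = \sum_(i <- r | P i) pconst (F i) v.
Proof. exact: path_coef_sum. Qed.

Lemma pconstM f g v : pconst (f * g) v = pconst f v * pconst g v.
Proof. by rewrite [LHS]big_ord1. Qed.

Lemma derivativeM a f g :
  'd_a (f * g) = 'd_a f * g + pconst f (qsource a) *: 'd_a g.
Proof.
apply: path_algP => -[w s].
rewrite path_coefD path_coefZ path_coefM !arrow_derivativeE path_coefM /path_mul_fun /=.
case: eqVneq => [->|nw]; last first.
  rewrite mulr0 addr0 big1 // => i _.
  by rewrite arrow_derivativeE /= (negPf nw) mul0r.
rewrite big_ord_recl /= addrC; congr (_ + _).
by apply: eq_bigr => i _; rewrite arrow_derivativeE /= eqxx.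
Qed.

Lemma pconst_elt p v : pconst (path_elt K p) v = (p == (v, [::]))%:R.
Proof.
rewrite /pconst path_coef_elt eq_sym; case: eqP => [->|_] //.
by rewrite andbF.
Qed.

Lemma derivative_vertex a v : 'd_a (vertex_elt v) = 0.
Proof.
apply: path_algP => -[w s]; rewrite arrow_derivativeE path_coef_elt.
by rewrite xpair_eqE !andbF if_same.
Qed.

Lemma derivative_arrow a b : 'd_a (arrow_elt K b) = if a == b then vertex_elt (qtarget a) else 0.
Proof.
apply: path_algP => -[w s]; rewrite arrow_derivativeE path_coef_elt /= /is_qpath /= eqxx /=.
rewrite [(qsource a, _) == _]xpair_eqE eqseq_cons /=.
case: (eqVneq a b) => [->|nab]; last by rewrite andbF if_same.
rewrite eqxx /= path_coef_elt /= xpair_eqE.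
by case: (w == _).
Qed.

Lemma pconst_vertex v w : pconst (vertex_elt v) w = (v == w)%:R.
Proof. by rewrite pconst_elt xpair_eqE andbT. Qed.

Lemma pconst_arrow a w : pconst (arrow_elt K a) w = 0.
Proof. by rewrite pconst_elt xpair_eqE andbF. Qed.

Lemma derivative1 a : 'd_a 1 = 0.
Proof. by apply: path_algP => -[w s]; rewrite arrow_derivativeE; case: ifP. Qed.

Lemma sum_vertex : \sum_v vertex_elt v = 1 :> kQ.
Proof.
apply: path_ext => [w|a].
  rewrite pconst_sum (bigD1 w) //= pconst_vertex eqxx big1 ?addr0 // => v vw.
  by rewrite pconst_vertex (negPf vw).
by rewrite linear_sum derivative1 big1 // => v _; apply: derivative_vertex.
Qed.

Lemma vertexM v w : vertex_elt v * vertex_elt w = if v == w then vertex_elt v else 0.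
Proof.
apply: path_ext => [u|a].
  rewrite pconstM !pconst_vertex; case: (eqVneq v w) => [->|vw].
    by rewrite pconst_vertex -natrM mulnb andbb.
  rewrite -natrM mulnb [RHS](_ : _ = 0) //.
  by case: (eqVneq v u) => // vu; rewrite -vu eq_sym (negPf vw).
rewrite derivativeM !derivative_vertex mul0r scaler0 addr0.
by case: ifP; rewrite ?derivative_vertex ?linear0.
Qed.

Lemma vertex_arrow v a :
  vertex_elt v * arrow_elt K a = if qsource a == v then arrow_elt K a else 0.
Proof.
rewrite path_eltM ?/is_qpath //=; last by rewrite eqxx.
by rewrite /word_end /= eq_sym; case: eqP => [<-|].
Qed.

Lemma arrow_vertex v a :
  arrow_elt K a * vertex_elt v = if qtarget a == v then arrow_elt K a else 0.
Proof. by rewrite path_eltM ?/is_qpath //= eqxx. Qed.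

Lemma path_decomposition f :
  f = \sum_v pconst f v *: vertex_elt v + \sum_a arrow_elt K a * 'd_a f.
Proof.
apply: path_ext => [w|a].
  rewrite pconstD !pconst_sum (bigD1 w) //= pconstZ pconst_vertex eqxx mulr1.
  rewrite !big1 ?addr0 // => [a _|v vw]; first by rewrite pconstM pconst_arrow mul0r.
  by rewrite pconstZ pconst_vertex (negPf vw) mulr0.
rewrite linearD !linear_sum big1 ?add0r => [|v _]; last first.
  by rewrite linearZ /= derivative_vertex scaler0.
rewrite (bigD1 a) //= derivativeM derivative_arrow eqxx pconst_arrow scale0r addr0.
rewrite big1 ?addr0 => [|b ba]; last first.
  by rewrite derivativeM derivative_arrow eq_sym (negPf ba) mul0r pconst_arrow scale0r addr0.
apply: path_ext => [v|b].
  rewrite pconstM pconst_vertex; case: eqVneq => [|nv]; first by rewrite mul1r.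
  by rewrite mul0r /pconst arrow_derivativeE /= eq_sym (negPf nv).
apply: path_algP => -[v s]; rewrite derivativeM derivative_vertex mul0r add0r.
rewrite path_coefZ pconst_vertex; case: eqVneq => [|nb]; first by rewrite mul1r.
by rewrite eq_sym in nb; rewrite mul0r !arrow_derivativeE /= (negPf nb) if_same.
Qed.

Lemma degree_part_supp d f :
  ((fun p => if size p.2 == d then path_coef f p else 0) : qword Q -> K^o)
    \in @qsupport K Q.
Proof.
have [fq [S fS]] := asboolP _ (valP f).
apply/asboolP; split=> [p|]; first by case: ifP => _; [apply: fq | rewrite eqxx].
by exists S => p; case: ifP => _; [apply: fS | rewrite eqxx].
Qed.

Definition degree_part d f : kQ := exist (fun u : qword Q -> K^o => u \in @qsupport K Q) _ (degree_part_supp d f).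

Lemma degree_partE d f p :
  path_coef (degree_part d f) p = if size p.2 == d then path_coef f p else 0.
Proof. by []. Qed.

Lemma degree_part_is_linear d : linear (degree_part d).
Proof.
move=> c f g; apply: path_algP => p.
rewrite path_coefD path_coefZ !degree_partE path_coefD path_coefZ.
by case: eqP; rewrite ?mulr0 ?addr0.
Qed.

HB.instance Definition _ d :=
  GRing.isLinear.Build K kQ kQ *:%R (degree_part d) (degree_part_is_linear d).

Lemma pconst_degree_part d f v : pconst (degree_part d f) v = if d is 0 then pconst f v else 0.
Proof. by rewrite /pconst degree_partE /=; case: d. Qed.

Lemma derivative_degree_part0 a f : 'd_a (degree_part 0 f) = 0.
Proof. by apply: path_algP => -[v s]; rewrite arrow_derivativeE degree_partE /= if_same. Qed.

Lemma derivative_degree_partS a d f : 'd_a (degree_part d.+1 f) = degree_part d ('d_a f).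
Proof.
apply: path_algP => -[v s]; rewrite arrow_derivativeE !degree_partE arrow_derivativeE /= eqSS.
by case: ifP; rewrite ?if_same.
Qed.

(** Induction on the degree, comparing constants and derivatives: a derivative lowers the degree by
    one. *)
Lemma degree_partM d f g :
  degree_part d (f * g) = \sum_(i < d.+1) degree_part i f * degree_part (d - i)%N g.
Proof.
elim: d f g => [|d IHd] f g.
  rewrite big_ord1; apply: path_ext => [v|a]; first by rewrite pconstM !pconst_degree_part pconstM.
  by rewrite derivativeM !derivative_degree_part0 mul0r scaler0 addr0.
apply: path_ext => [v|a].
  rewrite pconst_degree_part pconst_sum big1 // => i _.
  by rewrite pconstM !pconst_degree_part; case: i => -[|j] ij; rewrite /= ?mul0r // mulr0.
rewrite derivative_degree_partS derivativeM linearD linearZ /= IHd linear_sum /=.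
rewrite [RHS]big_ord_recl derivativeM derivative_degree_part0 mul0r add0r.
rewrite pconst_degree_part subn0 derivative_degree_partS [LHS]addrC; congr (_ + _).
apply: eq_bigr => i _; rewrite derivativeM derivative_degree_partS pconst_degree_part /=.
by rewrite scale0r addr0 subSS.
Qed.

Lemma degree_part_elt d p : degree_part d (path_elt K p) = if size p.2 == d then path_elt K p else 0.
Proof.
apply: path_algP => q; rewrite degree_partE path_coef_elt.
have [->|nqp] := eqVneq q p; first by case: eqP; rewrite ?path_coef_elt ?eqxx.
by rewrite andbF if_same; case: eqP; rewrite ?path_coef_elt ?(negPf nqp) ?andbF.
Qed.

Lemma degree_partK d e f : degree_part d (degree_part e f) = if d == e then degree_part d f else 0.
Proof.
apply: path_algP => p; rewrite !degree_partE; case: (eqVneq d e) => [->|de].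
  by rewrite degree_partE; case: eqP.
by case: eqP => [->|]; rewrite ?(negPf de).
Qed.

Lemma degree_part_sum f : exists N, f = \sum_(d < N) degree_part d f /\
  forall d, (N <= d)%N -> degree_part d f = 0.
Proof.
have [_ [S fS]] := asboolP _ (valP f).
pose N := (\max_(p <- S) size p.2).+1.
have ltN p : path_coef f p != 0 -> (size p.2 < N)%N.
  by move=> /fS pS; rewrite ltnS (big_rem _ pS) /= leq_maxl.
exists N; split=> [|d Nd]; apply: path_algP => p.
  rewrite path_coef_sum; have [fp0|/ltN pN] := eqVneq (path_coef f p) 0.
    by rewrite fp0 big1 // => d _; rewrite degree_partE fp0 if_same.
  rewrite (bigD1 (Ordinal pN)) //= degree_partE eqxx big1 ?addr0 // => d dp.
  by rewrite degree_partE; case: eqP => // e; case/eqP: dp; apply: val_inj; rewrite /= e.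
rewrite degree_partE; case: eqP => // pd; apply/eqP/contraT => /ltN.
by rewrite pd ltnNge Nd.
Qed.

End PathAlgebra.

Section Preprojective.
Variables (K : fieldType) (G : multigraph) (eps : qarrow (doubled_quiver G) -> bool).
Local Notation Q := (doubled_quiver G).
Local Notation kQ := (path_alg K Q).
Local Notation Pi := (preproj K eps).
Local Notation rho := (preproj_relation K eps).
Local Notation pi := (@preproj_pi K G eps).
Local Notation scal := (@preproj_scal K G eps).
Implicit Types (f g : kQ) (x y : Pi) (a b : qarrow Q) (v w : qvertex Q).

Local Notation I := (ideal_gen [set rho]%classic).

Lemma preproj_piD f g : pi (f + g) = pi f + pi g.
Proof. exact: quot_ring_piD. Qed.

Lemma preproj_pi0 : pi 0 = 0.
Proof. by apply: (addrI (pi 0)); rewrite -preproj_piD !addr0. Qed.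

Lemma preproj_piN f : pi (- f) = - pi f.
Proof. by apply/eqP; rewrite -addr_eq0 -preproj_piD addNr preproj_pi0. Qed.

Lemma preproj_piM f g : pi (f * g) = pi f * pi g.
Proof. exact/esym/quot_ring_mulE. Qed.

Lemma preproj_pi_sum (J : Type) (r : seq J) (P : pred J) (F : J -> kQ) :
  pi (\sum_(i <- r | P i) F i) = \sum_(i <- r | P i) pi (F i).
Proof. exact: (big_morph pi preproj_piD preproj_pi0). Qed.

Lemma preproj_pi_eq0 f : pi f = 0 <-> I f.
Proof.
rewrite -preproj_pi0; split=> [/quot_ring_piP|If].
  by rewrite subr0 => /asboolP.
by apply/quot_ring_piP; rewrite subr0; apply/asboolP.
Qed.

Lemma preproj_pi_surj x : exists f, pi f = x.
Proof. exact: quot_ring_pi_surj. Qed.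

Lemma preproj_scalC c x : scal c * x = x * scal c.
Proof.
have [f <-] := preproj_pi_surj x; rewrite /preproj_scal -!preproj_piM; congr pi.
by rewrite -path_scaleAl mul1r path_scaleAr mulr1.
Qed.

Definition vtx v : Pi := pi (vertex_elt K v).
Definition arr a : Pi := pi (arrow_elt K a).
Definition sgn a : Pi := scal ((-1) ^+ eps a).

Lemma preproj_piZ c f : pi (c *: f) = scal c * pi f.
Proof. by rewrite /preproj_scal -preproj_piM -path_scaleAl mul1r. Qed.

Lemma sgnK a x : sgn a * (sgn a * x) = x.
Proof. by rewrite mulrA -rmorphM -expr2 sqrr_sign rmorph1 mul1r. Qed.

Lemma vtxM v w : vtx v * vtx w = if v == w then vtx v else 0.
Proof. by rewrite -preproj_piM vertexM; case: eqP; rewrite ?preproj_pi0. Qed.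

Lemma vtxx v x : vtx v * (vtx v * x) = vtx v * x.
Proof. by rewrite mulrA vtxM eqxx. Qed.

Lemma sum_vtx : \sum_v vtx v = 1.
Proof. by rewrite -preproj_pi_sum sum_vertex. Qed.

Lemma vtx_arr v a : vtx v * arr a = if qsource a == v then arr a else 0.
Proof. by rewrite -preproj_piM vertex_arrow; case: eqP; rewrite ?preproj_pi0. Qed.

Lemma arr_vtx v a : arr a * vtx v = if qtarget a == v then arr a else 0.
Proof. by rewrite -preproj_piM arrow_vertex; case: eqP; rewrite ?preproj_pi0. Qed.

Lemma arr_source a x : vtx (qsource a) * (arr a * x) = arr a * x.
Proof. by rewrite mulrA vtx_arr eqxx. Qed.

Lemma arr_target a x : arr a * (vtx (qtarget a) * x) = arr a * x.
Proof. by rewrite mulrA arr_vtx eqxx. Qed.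

Lemma dual_arrowK a : dual_arrow (dual_arrow a) = a.
Proof. by case: a => e b; rewrite /dual_arrow /= negbK. Qed.

Lemma source_dual a : qsource (dual_arrow a) = qtarget a. Proof. by []. Qed.

Lemma target_dual a : qtarget (dual_arrow a) = qsource a.
Proof. by case: a => e b; rewrite /= negbK. Qed.

Lemma arr_dual_source a x :
  arr (dual_arrow a) * (vtx (qsource a) * x) = arr (dual_arrow a) * x.
Proof. by rewrite -target_dual arr_target. Qed.

Lemma arr_vtxl v a x : arr a * (vtx v * x) = if qtarget a == v then arr a * x else 0.
Proof. by rewrite mulrA arr_vtx; case: eqP; rewrite ?mul0r. Qed.

Lemma arr_dual_target a x :
  vtx (qtarget a) * (arr (dual_arrow a) * x) = arr (dual_arrow a) * x.
Proof. exact: (arr_source (dual_arrow a)). Qed.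

Lemma preproj_decomposition x : exists (c : qvertex Q -> K) (y : qarrow Q -> Pi),
  x = \sum_v scal (c v) * vtx v + \sum_a arr a * y a.
Proof.
have [f <-] := preproj_pi_surj x.
exists (pconst f), (fun a => pi (arrow_derivative a f)).
rewrite [in LHS](path_decomposition f) preproj_piD !preproj_pi_sum; congr (_ + _).
  by apply: eq_bigr => v _; apply: preproj_piZ.
by apply: eq_bigr => a _; apply: preproj_piM.
Qed.

Lemma preproj_relation0 x : \sum_a sgn a * (arr a * (arr (dual_arrow a) * x)) = 0.
Proof.
transitivity (pi rho * x); last first.
  have -> : pi rho = 0 by apply/preproj_pi_eq0; apply: ideal_gen_sub.
  exact: mul0r.
rewrite preproj_pi_sum mulr_suml; apply: eq_bigr => a _.
by rewrite preproj_piZ preproj_piM -!mulrA.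
Qed.

Lemma derivative_relation a :
  arrow_derivative a rho = (-1) ^+ eps a *: arrow_elt K (dual_arrow a).
Proof.
rewrite linear_sum (bigD1 a) //= linearZ /= derivativeM derivative_arrow eqxx.
rewrite pconst_arrow scale0r addr0 vertex_arrow source_dual eqxx big1 ?addr0 // => b ba.
rewrite linearZ /= derivativeM derivative_arrow eq_sym (negPf ba) mul0r add0r.
by rewrite pconst_arrow scale0r scaler0.
Qed.

(* The relations, written on initial arrows, generate all linear relations between
   the arrows: the elements satisfying the conclusion form an ideal containing rho. *)
Lemma ideal_derivative f : I f -> (forall v, pconst f v = 0) /\
  exists g, forall a, pi (arrow_derivative a f) = sgn a * (arr (dual_arrow a) * pi g).
Proof.
(* Carrying [pi f = 0] along makes the term of the Leibniz rule that differentiates the left factor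
   vanish for [h * f]. *)
pose J : set kQ := fun f => [/\ pi f = 0, forall v, pconst f v = 0 & exists g,
  forall a, pi (arrow_derivative a f) = sgn a * (arr (dual_arrow a) * pi g)].
suff JI : forall f, I f -> J f by move=> /JI[].
apply: ideal_gen_min => {f} [|f -> /=]; last first.
  split; first by apply/preproj_pi_eq0; apply: ideal_gen_sub.
    move=> v; rewrite pconst_sum big1 // => a _.
    by rewrite pconstZ pconstM pconst_arrow mul0r mulr0.
  exists 1 => a; rewrite derivative_relation preproj_piZ.
  by rewrite -[arr _ * _]preproj_piM mulr1.
split.
- split; rewrite ?preproj_pi0 //; exists 0 => a.
  by rewrite linear0 preproj_pi0 !mulr0.
- move=> f f' [f0 fc [g fg]] [f'0 f'c [g' fg']]; split.
  + by rewrite preproj_piD f0 f'0 addr0.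
  + by move=> v; rewrite pconstD fc f'c addr0.
  + by exists (g + g') => a; rewrite linearD !preproj_piD fg fg' !mulrDr.
- move=> h f [f0 fc [g fg]]; split; split.
  + by rewrite preproj_piM f0 mulr0.
  + by move=> v; rewrite pconstM fc mulr0.
  (* Only the constant part of [h] survives in the Leibniz rule, and the dual of [a] selects from it
     the coefficient at the source of [a]. *)
  + exists ((\sum_v pconst h v *: vertex_elt K v) * g) => a.
    rewrite derivativeM preproj_piD preproj_piM f0 mulr0 add0r preproj_piZ fg.
    have arrE v : arr (dual_arrow a) * pi (pconst h v *: vertex_elt K v * g) =
        scal (pconst h v) * (arr (dual_arrow a) * (vtx v * pi g)).
      by rewrite preproj_piM preproj_piZ !mulrA preproj_scalC.
    rewrite [X in pi (X * g)](bigD1 (qsource a)) // mulrDl preproj_piD mulrDr.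
    rewrite mulr_suml preproj_pi_sum mulr_sumr big1 ?addr0 => [|v va]; last first.
      by rewrite arrE (mulrA (arr _)) arr_vtx target_dual eq_sym (negPf va) mul0r mulr0.
    by rewrite arrE arr_dual_source !mulrA preproj_scalC.
  + by rewrite preproj_piM f0 mul0r.
  + by move=> v; rewrite pconstM fc mul0r.
  + exists (g * h) => a; rewrite derivativeM fc scale0r addr0 !preproj_piM fg.
    by rewrite !mulrA.
Qed.

(** Exactness at the middle of the Koszul complex. A relation between arrows lifts to an element of
    the ideal, whose derivatives are the given coefficients and have the required form by
    [ideal_derivative]. *)
Lemma koszul_exact (x : qarrow Q -> Pi) :
  (forall a, vtx (qtarget a) * x a = x a) -> \sum_a arr a * x a = 0 ->
  exists y, forall a, x a = sgn a * (arr (dual_arrow a) * y).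
Proof.
move=> xt; have [f fx] := choice (fun a => preproj_pi_surj (x a)).
have -> : \sum_a arr a * x a = pi (\sum_a arrow_elt K a * f a).
  by rewrite preproj_pi_sum; apply: eq_bigr => a _; rewrite -fx -preproj_piM.
move=> /preproj_pi_eq0/ideal_derivative[_ [g gP]]; exists (pi g) => a.
rewrite -gP linear_sum preproj_pi_sum (bigD1 a) //= big1 ?addr0 => [|b ba].
  rewrite derivativeM derivative_arrow eqxx pconst_arrow scale0r addr0.
  by rewrite preproj_piM fx; apply/esym/xt.
rewrite derivativeM derivative_arrow eq_sym (negPf ba) mul0r pconst_arrow.
by rewrite scale0r addr0 preproj_pi0.
Qed.

Lemma degree_part_relation d : degree_part d rho = if d == 2%N then rho else 0.
Proof.
have aaE a : arrow_elt K a * arrow_elt K (dual_arrow a) =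
    path_elt K (qsource a, [:: a; dual_arrow a]).
  by rewrite path_eltM /is_qpath /= ?eqxx //.
rewrite linear_sum; case: (eqVneq d 2%N) => [->|nd].
  by apply: eq_bigr => a _; rewrite linearZ /= aaE degree_part_elt.
by apply: big1 => a _; rewrite linearZ /= aaE degree_part_elt /= eq_sym (negPf nd) scaler0.
Qed.

Lemma ideal_degree_part d f : I f -> I (degree_part d f).
Proof.
pose J : set kQ := fun f => forall d, pi (degree_part d f) = 0.
suff JI : forall f, I f -> J f by move=> /JI Jf; apply/preproj_pi_eq0/Jf.
have rho0 : pi rho = 0 by apply/preproj_pi_eq0; apply: ideal_gen_sub.
apply: ideal_gen_min => {d f} [|f -> d /=]; last first.
  by rewrite degree_part_relation; case: ifP; rewrite ?preproj_pi0.
split=> [d|f g Jf Jg d|h f Jf]; first by rewrite linear0 preproj_pi0.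
  by rewrite linearD preproj_piD Jf Jg addr0.
split=> d; rewrite degree_partM preproj_pi_sum big1 // => i _.
  by rewrite preproj_piM Jf mulr0.
by rewrite preproj_piM Jf mul0r.
Qed.

(** The lift is arbitrary. As the relation is homogeneous of degree two, the ideal is graded and the
    result does not depend on the choice; see [hdeg_pi]. *)
Definition hdeg d x : Pi := pi (degree_part d (sval (boolp.cid (preproj_pi_surj x)))).

Lemma hdeg_pi d f : hdeg d (pi f) = pi (degree_part d f).
Proof.
rewrite /hdeg; case: boolp.cid => g /= gf.
have : pi (g - f) = 0 by rewrite preproj_piD preproj_piN gf subrr.
move=> /preproj_pi_eq0/(ideal_degree_part d)/preproj_pi_eq0.
by rewrite linearB preproj_piD preproj_piN => /eqP; rewrite subr_eq0 => /eqP.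
Qed.

Lemma hdegD d x y : hdeg d (x + y) = hdeg d x + hdeg d y.
Proof.
have [f <-] := preproj_pi_surj x; have [g <-] := preproj_pi_surj y.
by rewrite -preproj_piD !hdeg_pi linearD preproj_piD.
Qed.

Lemma hdeg0 d : hdeg d 0 = 0.
Proof. by rewrite -preproj_pi0 hdeg_pi linear0. Qed.

Lemma hdegN d x : hdeg d (- x) = - hdeg d x.
Proof. by apply/eqP; rewrite -addr_eq0 -hdegD addNr hdeg0. Qed.

Lemma hdeg_sum d (J : Type) (r : seq J) (P : pred J) (F : J -> Pi) :
  hdeg d (\sum_(i <- r | P i) F i) = \sum_(i <- r | P i) hdeg d (F i).
Proof. exact: (big_morph (hdeg d) (hdegD d) (hdeg0 d)). Qed.

Lemma hdegM d x y : hdeg d (x * y) = \sum_(i < d.+1) hdeg i x * hdeg (d - i)%N y.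
Proof.
have [f <-] := preproj_pi_surj x; have [g <-] := preproj_pi_surj y.
rewrite -preproj_piM hdeg_pi degree_partM preproj_pi_sum.
by apply: eq_bigr => i _; rewrite preproj_piM !hdeg_pi.
Qed.

Lemma hdegK d e x : hdeg d (hdeg e x) = if d == e then hdeg d x else 0.
Proof.
have [f <-] := preproj_pi_surj x; rewrite !hdeg_pi degree_partK.
by case: eqP; rewrite ?preproj_pi0.
Qed.

Lemma hdeg_sum_all x : exists N, x = \sum_(d < N) hdeg d x /\
  forall d, (N <= d)%N -> hdeg d x = 0.
Proof.
have [f <-] := preproj_pi_surj x; have [N [fE f0]] := degree_part_sum f.
exists N; split=> [|d Nd]; last by rewrite hdeg_pi f0 // preproj_pi0.
rewrite {1}fE preproj_pi_sum; by apply: eq_bigr => d _; rewrite hdeg_pi.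
Qed.

Lemma hdeg_ext x y : (forall d, hdeg d x = hdeg d y) -> x = y.
Proof.
move=> xy; apply/eqP; rewrite -subr_eq0; apply/eqP.
have [N [-> _]] := hdeg_sum_all (x - y).
by apply: big1 => d _; rewrite hdegD hdegN xy subrr.
Qed.

Lemma hdeg_vtx d v : hdeg d (vtx v) = if d == 0%N then vtx v else 0.
Proof. by rewrite hdeg_pi degree_part_elt /= eq_sym; case: eqP; rewrite ?preproj_pi0. Qed.

Lemma hdeg_arr d a : hdeg d (arr a) = if d == 1%N then arr a else 0.
Proof. by rewrite hdeg_pi degree_part_elt /= eq_sym; case: eqP; rewrite ?preproj_pi0. Qed.

Lemma hdeg_vtxl d v x : hdeg d (vtx v * x) = vtx v * hdeg d x.
Proof.
rewrite hdegM big_ord_recl hdeg_vtx eqxx subn0 big1 ?addr0 // => i _.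
by rewrite hdeg_vtx mul0r.
Qed.

Lemma hdeg_vtxr d v x : hdeg d (x * vtx v) = hdeg d x * vtx v.
Proof.
rewrite hdegM big_ord_recr /= subnn hdeg_vtx eqxx big1 ?add0r // => i _.
by rewrite hdeg_vtx subn_eq0 leqNgt ltn_ord mulr0.
Qed.

Lemma hdeg_arrS d a x : hdeg d.+1 (arr a * x) = arr a * hdeg d x.
Proof.
rewrite hdegM !big_ord_recl hdeg_arr mul0r add0r hdeg_arr eqxx big1 ?addr0.
  by rewrite /= subSS subn0.
by move=> i _; rewrite hdeg_arr mul0r.
Qed.

Lemma hdeg_arr0 a x : hdeg 0 (arr a * x) = 0.
Proof. by rewrite hdegM big_ord1 hdeg_arr mul0r. Qed.

Lemma hdeg_scal d c x : hdeg d (scal c * x) = scal c * hdeg d x.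
Proof.
have [f <-] := preproj_pi_surj x.
by rewrite -preproj_piZ !hdeg_pi linearZ /= preproj_piZ.
Qed.

End Preprojective.

(** * The left socle *)

Section Socle.
Variables (K : fieldType) (G : multigraph) (eps : qarrow (doubled_quiver G) -> bool).
Local Notation Q := (doubled_quiver G).
Local Notation Pi := (preproj K eps).
Local Notation scal := (@preproj_scal K G eps).
Local Notation vtx := (@vtx K G eps).
Local Notation arr := (@arr K G eps).
Local Notation sgn := (@sgn K G eps).
Local Notation reg := ((Pi^c)^o : lmodType Pi^c).
Implicit Types (x y z : Pi) (a b : qarrow Q) (v : qvertex Q).

Lemma kscale_reg c x : kscale scal c (x : reg) = scal c * x.
Proof. exact: (esym (preproj_scalC c x)). Qed.

Lemma scal_eq0 c x : scal c * x = 0 -> x != 0 -> c = 0.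
Proof.
move=> cx0 x0; apply/eqP/contraT => c0; case/eqP: x0.
by rewrite -[x]mul1r -(rmorph1 scal) -(mulVf c0) rmorphM -mulrA cx0 mulr0.
Qed.

Lemma comb_additive (I : finType) (f : Pi -> Pi) (e : I -> reg) c :
  (forall x y, f (x + y) = f x + f y) -> (forall d x, f (scal d * x) = scal d * f x) ->
  f (comb scal e c) = comb scal (fun i => f (e i) : reg) c.
Proof.
move=> fD fZ; have f0 : f 0 = 0 by apply: (addrI (f 0)); rewrite -fD !addr0.
rewrite /comb (big_morph f fD f0); apply: eq_bigr => i _.
by rewrite !kscale_reg fZ.
Qed.

(** Degree 0 is spanned by the vertices, and degree [d + 1] by products of an arrow with a spanning
    family of degree [d]. *)
Lemma hdeg_spanned d : exists n, spanned scal (fun x : reg => hdeg d x = x) n.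
Proof.
elim: d => [|d [n [e [eU eS]]]].
  exists #|qvertex Q|; apply: (spanned_fin (e := vtx : _ -> reg)) => [v|x <-].
    by rewrite hdeg_vtx.
  have [c [y ->]] := preproj_decomposition x; exists c.
  rewrite hdegD !hdeg_sum [X in _ + X]big1 ?addr0 => [|a _]; last by rewrite hdeg_arr0.
  by apply: eq_bigr => v _; rewrite hdeg_scal hdeg_vtx kscale_reg.
exists #|{: qarrow Q * 'I_n}|.
apply: (spanned_fin (e := fun p : qarrow Q * 'I_n => arr p.1 * e p.2 : reg)) => [[a i]|x <-].
  by rewrite hdeg_arrS eU.
have [c [y ->]] := preproj_decomposition x.
have /choice[k kE] a : kspan scal e (hdeg d (y a)) by apply: eS; rewrite hdegK eqxx.
exists (fun p => k p.1 p.2).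
rewrite hdegD !hdeg_sum big1 ?add0r => [|v _]; last by rewrite hdeg_scal hdeg_vtx mulr0.
rewrite /comb -(pair_bigA _ (fun a i => kscale scal (k a i) (arr a * e i : reg))) /=.
apply: eq_bigr => a _; rewrite hdeg_arrS kE [LHS]mulr_sumr; apply: eq_bigr => i _.
by rewrite !kscale_reg !mulrA preproj_scalC.
Qed.

Section Column.
Variable i : qvertex Q.

(** Projects onto the degree [d] part of [Pi e_i]; that part is encoded throughout as the set of
    fixed points of [cproj d]. *)
Definition cproj d x : Pi := hdeg d x * vtx i.

Lemma cprojD d x y : cproj d (x + y) = cproj d x + cproj d y.
Proof. by rewrite /cproj hdegD mulrDl. Qed.

Lemma cproj0 d : cproj d 0 = 0. Proof. by rewrite /cproj hdeg0 mul0r. Qed.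

Lemma cprojN d x : cproj d (- x) = - cproj d x.
Proof. by rewrite /cproj hdegN mulNr. Qed.

Lemma cproj_scal d c x : cproj d (scal c * x) = scal c * cproj d x.
Proof. by rewrite /cproj hdeg_scal mulrA. Qed.

Lemma cproj_vtx d v x : cproj d (vtx v * x) = vtx v * cproj d x.
Proof. by rewrite /cproj hdeg_vtxl mulrA. Qed.

Lemma cproj_arr d a x : cproj d.+1 (arr a * x) = arr a * cproj d x.
Proof. by rewrite /cproj hdeg_arrS mulrA. Qed.

Lemma cproj_sum d (J : finType) (F : J -> Pi) : cproj d (\sum_j F j) = \sum_j cproj d (F j).
Proof. exact: (big_morph (cproj d) (cprojD d) (cproj0 d)). Qed.

Lemma cprojK d x : cproj d (cproj d x) = cproj d x.
Proof. by rewrite /cproj hdeg_vtxr hdegK eqxx -mulrA vtxM eqxx. Qed.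

Lemma cproj_decomposition d x :
  exists y : qarrow Q -> Pi, cproj d.+1 x = \sum_a arr a * cproj d (y a).
Proof.
have [c [y ->]] := preproj_decomposition x; exists y.
rewrite cprojD !cproj_sum big1 ?add0r => [|v _]; last first.
  by rewrite cproj_scal /cproj hdeg_vtx mul0r mulr0.
by apply: eq_bigr => a _; apply: cproj_arr.
Qed.

Lemma cproj_spanned d : exists n, spanned scal (fun x : reg => cproj d x = x) n.
Proof.
have [n [e [eU eS]]] := hdeg_spanned d; exists n, (fun k => cproj d (e k) : reg).
split=> [k|x xE]; first exact: cprojK.
have /eS[c cE] : hdeg d (hdeg d x) = hdeg d x by rewrite hdegK eqxx.
exists c; rewrite -xE -cprojK.
rewrite -(comb_additive _ _ (cprojD d) (cproj_scal d)) -cE xE -{1}xE.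
by rewrite cprojK /cproj hdegK eqxx.
Qed.

Variables (d : nat) (z : Pi).
Hypotheses (zW : cproj d z = z) (z0 : z != 0) (zJ : forall a, arr a * z = 0).
Hypothesis zmin : forall m x, (m < d)%N -> cproj m x = x ->
  (forall a, arr a * x = 0) -> x = 0.

(* A degree preserving partial endomorphism of Pi e_i in degree m, from which an
   endomorphism in all degrees m, ..., d, d + 1 vanishing in degree d + 1 extends. *)
Record partial_endo m (phi : Pi -> Pi) : Prop := PartialEndo {
  phiD : forall x y, phi (x + y) = phi x + phi y;
  phiZ : forall c x, phi (scal c * x) = scal c * phi x;
  phi_vtx : forall v x, phi (vtx v * x) = vtx v * phi x;
  phiW : forall x, cproj m (phi x) = phi x;
  phi_rel : forall n (w : Pi), m = n.+1 -> cproj n w = w ->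
    \sum_a sgn a * (arr a * phi (arr (dual_arrow a) * w)) = 0;
  phi_homothety : forall c, (forall w : Pi, cproj m w = w -> phi w = scal c * w) ->
    forall w : Pi, cproj d.+1 w = 0 }.

(** The map is [x] to [lambda(x) y], where [y] is a nonzero component [e_j z] and [lambda] is a
    coordinate of [e_j x] in degree [d] that does not vanish at [y]. Arrows kill [y], so the
    relations hold trivially. *)
Lemma partial_endo_top : exists phi, partial_endo d phi.
Proof.
have [j vz0] : exists j, vtx j * z != 0.
  apply: contrapT => nj; case/eqP: z0; rewrite -[z]mul1r -sum_vtx mulr_suml big1 // => j _.
  by apply/eqP/negPn/negP => vz0; apply: nj; exists j.
pose y := vtx j * z.
have yJ a : arr a * y = 0.
  by rewrite /y mulrA arr_vtx; case: eqP; rewrite ?zJ ?mul0r.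
have yW : cproj d y = y by rewrite /y cproj_vtx zW.
have [n /spanned_basis[k [e [eU eS ef]]]] := cproj_spanned d.
have span x : kspan scal e (cproj d (vtx j * x)) by apply: eS; apply: cprojK.
pose co x := sval (boolp.cid (span x)).
have coE x : cproj d (vtx j * x) = comb scal e (co x) by rewrite /co; case: boolp.cid.
have co_uniq c c' : comb scal e c = comb scal e c' -> forall l, c l = c' l.
  move=> cc' l; apply/eqP; rewrite -subr_eq0; apply/eqP.
  apply: (ef (fun l => c l - c' l)).
  transitivity (comb scal e c + kscale scal (-1) (comb scal e c')).
    by rewrite combZ combD; apply: eq_bigr => l' _; rewrite mulN1r.
  by rewrite cc' kscaleNl kscale1 subrr.
have [l yl] : exists l, co y l != 0.
  have yE : y = comb scal e (co y) by rewrite -coE /y vtxx -/y.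
  apply: contrapT => nl; case/eqP: vz0; rewrite -[LHS]/y yE.
  apply: big1 => l _; have [->|cl] := eqVneq (co y l) 0; first by rewrite kscale0l.
  by case: nl; exists l.
exists (fun x => scal (co x l) * y); split.
- move=> x x'; rewrite -mulrDl -rmorphD; congr (scal _ * _).
  by apply: (co_uniq _ (fun l => co x l + co x' l)); rewrite -combD -!coE mulrDr cprojD.
- move=> c x; rewrite mulrA -rmorphM; congr (scal _ * _).
  apply: (co_uniq _ (fun l => c * co x l)); rewrite -combZ -!coE kscale_reg.
  by rewrite -cproj_scal !mulrA preproj_scalC.
- move=> v x; rewrite [RHS]mulrA -preproj_scalC -[RHS]mulrA.
  have [->|vj] := eqVneq v j.
    by rewrite {2}/y vtxx; congr (scal _ * _); apply: co_uniq; rewrite -!coE vtxx.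
  have -> : vtx v * y = 0 by rewrite /y mulrA vtxM (negPf vj) mul0r.
  rewrite mulr0 (_ : co _ l = 0) ?rmorph0 ?mul0r //.
  apply: (co_uniq _ (fun=> 0)); rewrite -coE mulrA vtxM eq_sym (negPf vj) mul0r cproj0.
  by rewrite /comb big1 // => l' _; rewrite kscale0l.
- by move=> x; rewrite cproj_scal yW.
- move=> n' w _ _; apply: big1 => a _.
  by rewrite (mulrA (arr a)) -preproj_scalC -mulrA yJ !mulr0.
(* The value at [y] shows [c != 0]. For [x] of degree [d] the element [c x] is a multiple of [y], so
   arrows kill it, while degree [d + 1] is spanned by arrows times degree [d]. *)
- move=> c cE w; have c0 : c != 0.
    apply: contra yl => /eqP c0; have := cE y yW.
    by rewrite c0 rmorph0 mul0r => /scal_eq0->.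
  have [x ->] := cproj_decomposition d w; apply: big1 => a _.
  have := cE _ (cprojK d (x a)) => /(congr1 ( *%R (arr a))).
  rewrite mulrA -preproj_scalC -mulrA yJ mulr0 mulrA -preproj_scalC -mulrA => /esym ax.
  by apply/eqP/contraT => /(scal_eq0 ax) c0'; rewrite c0' eqxx in c0.
Qed.

(** For [x] of degree [m] the elements [phi (a x)] satisfy the Koszul relation, so [koszul_exact]
    gives [y] with [a y = phi (a x)] for all arrows [a]. As [m < d], minimality makes [y] unique,
    whence all the structure of [psi]. A homothety [psi] forces [phi] to be one, since arrows
    generate degree [m + 1] from degree [m]. *)
Lemma partial_endo_down m phi : (m < d)%N -> partial_endo m.+1 phi ->
  exists psi, partial_endo m psi.
Proof.
move=> md [pD pZ pv pW prel phom].
have p0 : phi 0 = 0 by apply: (addrI (phi 0)); rewrite -pD !addr0.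
have ex x : exists y, cproj m y = y /\ forall a, arr a * y = phi (arr a * cproj m x).
  have [a|| y yE] := koszul_exact (x := fun a => sgn a * phi (arr (dual_arrow a) * cproj m x)).
  - by rewrite mulrA -preproj_scalC -mulrA -pv arr_dual_target.
  - rewrite -[RHS](prel m (cproj m x) erefl (cprojK _ _)); apply: eq_bigr => a _.
    by rewrite mulrA -preproj_scalC -mulrA.
  exists (cproj m y); split=> [|b]; first exact: cprojK.
  have := congr1 ( *%R (sgn (dual_arrow b))) (yE (dual_arrow b)).
  by rewrite !sgnK dual_arrowK => yb; rewrite -(cproj_arr m b y) -yb pW.
have [psi psiP] := choice ex.
have uniq x y : cproj m y = y -> (forall a, arr a * y = phi (arr a * cproj m x)) -> psi x = y.
  move=> yW yE; apply/eqP; rewrite -subr_eq0; apply/eqP; apply: (zmin md).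
    by rewrite cprojD cprojN yW (psiP x).1.
  by move=> a; rewrite mulrBr (psiP x).2 yE subrr.
exists psi; split.
- move=> x y; apply: uniq => [|a]; first by rewrite cprojD !(psiP _).1.
  by rewrite mulrDr !(psiP _).2 cprojD mulrDr pD.
- move=> c x; apply: uniq => [|a]; first by rewrite cproj_scal (psiP _).1.
  by rewrite mulrA -preproj_scalC -mulrA (psiP _).2 -pZ cproj_scal !mulrA preproj_scalC.
- move=> v x; apply: uniq => [|a]; first by rewrite cproj_vtx (psiP _).1.
  by rewrite cproj_vtx !arr_vtxl; case: eqP => // _; apply: (psiP x).2.
- by move=> x; rewrite (psiP x).1.
(* The required sum is [phi] applied to the preprojective relation times [w]. *)
- move=> n w mn wW; rewrite -[RHS]p0 -[in RHS](preproj_relation0 w).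
  rewrite (big_morph phi pD p0); apply: eq_bigr => a _.
  by rewrite (psiP _).2 mn cproj_arr wW pZ.
- move=> c cE; apply: (phom c) => w <-; have [x ->] := cproj_decomposition m w.
  rewrite (big_morph phi pD p0) mulr_sumr; apply: eq_bigr => a _.
  have := (psiP (x a)).2 a => <-; rewrite -[psi _](_ : psi (cproj m (x a)) = _).
    by rewrite cE ?cprojK // mulrA -preproj_scalC -mulrA.
  by apply: uniq => [|b]; rewrite ?cprojK ?(psiP _).1 ?(psiP _).2.
Qed.

(** The descent reaches degree 0, where [Pi e_i] is spanned by [e_i]; a linear map there is a
    homothety. *)
Lemma socle_vanishing w : cproj d.+1 w = 0.
Proof.
have [phi phiP] : exists phi, partial_endo 0 phi.
  suff: forall k, (k <= d)%N -> exists phi, partial_endo (d - k)%N phi.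
    by move=> /(_ d (leqnn d)); rewrite subnn.
  elim=> [|k IHk] kd; first by rewrite subn0; apply: partial_endo_top.
  have [phi phiP] := IHk (ltnW kd).
  by apply: (@partial_endo_down _ phi); rewrite ?subnSK //; lia.
have W0 x : cproj 0 x = x -> exists c, x = scal c * vtx i.
  move=> <-; have [c [y ->]] := preproj_decomposition x; exists (c i).
  rewrite cprojD !cproj_sum [X in _ + X]big1 ?addr0 => [|a _]; last first.
    by rewrite /cproj hdeg_arr0 mul0r.
  rewrite (bigD1 i) //= big1 ?addr0 => [|v vi]; rewrite cproj_scal /cproj hdeg_vtx vtxM ?eqxx //.
  by rewrite (negPf vi) mulr0.
have [c cE] := W0 _ (phiW phiP (vtx i)).
apply: (phi_homothety phiP (c := c)) => x /W0[c' ->].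
by rewrite (phiZ phiP) cE !mulrA -!rmorphM mulrC.
Qed.

End Column.
End Socle.

(** Rank and nullity: a basis of the left kernel of the matrix of [D] gives a free family in the
    span of [g], so the nullity is at most [#|J'|], and the rank is at most [#|J|]. *)
Lemma exact_card (K : fieldType) (A : pzRingType) (scal : {rmorphism K -> A})
    (M N : lmodType A^c) (I J J' : finType) (e : I -> M) (b : J -> N) (g : J' -> M)
    (D : M -> N) :
  (forall c, D (comb scal e c) = comb scal (fun i => D (e i)) c) ->
  kfree scal e -> (forall i, kspan scal b (D (e i))) ->
  (forall c, D (comb scal e c) = 0 -> kspan scal g (comb scal e c)) ->
  (#|I| <= #|J| + #|J'|)%N.
Proof.
move=> De ef /choice[C CE] Dg.
pose B : 'M[K]_(#|I|, #|J|) := \matrix_(i, j) C (enum_val i) (enum_val j).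
pose W := row_base (kermx B).
pose f k := comb scal e (fun i => W k (enum_rank i)).
have combW d : comb scal f d = comb scal e (fun i => \sum_k d k * W k (enum_rank i)).
  rewrite {1}/comb; under eq_bigr do rewrite /f combZ.
  rewrite exchange_big; apply: eq_bigr => i _.
  by rewrite kscale_suml.
have ff : kfree scal f.
  move=> d; rewrite combW => /ef d0 k.
  have : \row_k d k *m W = 0.
    apply/rowP => i; rewrite !mxE -[RHS](d0 (enum_val i)) enum_valK.
    by apply: eq_bigr => l _; rewrite mxE.
  move/eqP; rewrite mulmx_free_eq0 ?row_base_free // => /eqP/rowP/(_ k).
  by rewrite !mxE.
have WB : W *m B = 0 by apply/sub_kermxP; rewrite eq_row_base.
have fg k : kspan scal g (f k).
  apply: Dg; rewrite De.
  transitivity (comb scal b (fun j => \sum_i W k (enum_rank i) * C i j)).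
    transitivity (\sum_i \sum_j kscale scal (W k (enum_rank i) * C i j) (b j)).
      apply: eq_bigr => i _; rewrite [D _]CE kscale_sum.
      by apply: eq_bigr => j _; rewrite kscaleA.
    by rewrite exchange_big /comb; apply: eq_bigr => j _; rewrite kscale_suml.
  apply: big1 => j _; rewrite (_ : \sum_i _ = 0) ?kscale0l //.
  have /matrixP/(_ k (enum_rank j)) := WB; rewrite !mxE => wj; rewrite -[RHS]wj.
  rewrite [RHS](reindex _ (onW_bij _ (enum_rank_bij I))) /=; apply: eq_bigr => i _.
  by rewrite [B _ _]mxE !enum_rankK.
have := steinitz ff fg; rewrite card_ord mxrank_ker leq_subLR => /leq_trans; apply.
by rewrite leq_add2r rank_leq_col.
Qed.

(** * Superharmonic functions on the graph *)

Section PositiveDefinite.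
Variables (G : multigraph) (R : realType) (i : vertex G) (u : vertex G -> nat).
Hypothesis Gc : connected G.

Definition nedges (v w : vertex G) : nat := #|[pred e | joins e v w]|.

Lemma joinsC (e : edge G) v w : joins e v w = joins e w v.
Proof.
apply/existsP/existsP => -[b /andP[b1 b2]]; exists (~~ b);
  by rewrite negbK b1 b2.
Qed.

Lemma nedgesC v w : nedges v w = nedges w v.
Proof. by apply: eq_card => e; rewrite !inE joinsC. Qed.

Hypothesis uP : forall v, (\sum_w nedges v w * u w + (i == v) <= 2 * u v)%N.

(** At [i] the extra 1 excludes [u i = 0]. A zero of [u] at [y] forces zeros at all neighbours of
    [y], so positivity spreads along edges. *)
Lemma superharmonic_gt0 v : (0 < u v)%N.
Proof.
have ui : (0 < u i)%N.
  by have := uP i; rewrite eqxx; case: (u i) => //; rewrite muln0 addn1.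
have step x y : adjacent x y -> (0 < u x)%N -> (0 < u y)%N.
  move=> /existsP[e exy] ux; have := uP y; case: (u y) => //.
  rewrite muln0 leqn0 addn_eq0 sum_nat_eq0 => /andP[/forallP/(_ x)].
  rewrite muln_eq0 -[X in _ || X]leqn0 leqNgt ux orbF /= => /eqP/card0_eq/(_ e).
  by rewrite !inE joinsC exy.
have [_ /(_ i v)/connectP[p ip ->]] := Gc.
suff: forall x, path (@adjacent G) x p -> (0 < u x)%N -> (0 < u (last x p))%N by apply.
elim: {ip} p => [|y p IHp] x //= /andP[xy yp] ux.
exact: IHp yp (step _ _ xy ux).
Qed.

(** Put [X = Y U] and [r = (2I - A) U], so [r >= delta_i]. The quadratic form becomes the sum of
    [r_v U_v Y_v^2] plus half the sum of [a_vw U_v U_w (Y_v - Y_w)^2]. If it vanishes, [Y] is zero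
    at [i] and constant along edges, hence zero by connectedness. *)
Lemma superharmonic_finite_type : finite_type G R.
Proof.
move=> x x0; pose X v := x (enum_rank v) 0.
pose U v : R := (u v)%:R.
have U0 v : 0 < U v by rewrite ltr0n superharmonic_gt0.
pose a v w : R := (nedges v w)%:R.
pose Y v := X v / U v.
have XE v : X v = Y v * U v by rewrite divfK // gt_eqF.
have qE : (x^T *m cartan_mx G R *m x) 0 0 =
    \sum_v 2 * X v ^+ 2 - \sum_v \sum_w a v w * X v * X w.
  transitivity (\sum_w \sum_v X v * cartan_mx G R (enum_rank v) (enum_rank w) * X w).
    rewrite mxE (reindex _ (onW_bij _ (enum_rank_bij (vertex G)))).
    apply: eq_bigr => w _; rewrite mxE mulr_suml.
    rewrite (reindex _ (onW_bij _ (enum_rank_bij (vertex G)))).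
    by apply: eq_bigr => v _; rewrite mxE.
  rewrite exchange_big -sumrB; apply: eq_bigr => v _.
  transitivity (\sum_w ((2 * (v == w)%:R * X v * X w) - a v w * X v * X w)).
    apply: eq_bigr => w _; rewrite !mxE !enum_rankK (inj_eq enum_rank_inj).
    rewrite -mulrBl; congr (_ * _); rewrite mulrC mulrBl; congr (_ * _ - _).
    by rewrite mulr_natr.
  rewrite sumrB; congr (_ - _); rewrite (bigD1 v) //= eqxx mulr1 big1 ?addr0.
    by rewrite expr2 mulrA.
  by move=> w wv; rewrite eq_sym (negPf wv) mulr0 !mul0r.
pose r v : R := 2 * U v - \sum_w a v w * U w.
have rP v : (i == v)%:R <= r v.
  have := uP v; rewrite -(ler_nat R) natrD natrM natr_sum => h.
  rewrite lerBrDl; apply: le_trans h; rewrite lerD2r.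
  by under [X in _ <= X]eq_bigr do rewrite natrM.
have -> : (x^T *m cartan_mx G R *m x) 0 0 = \sum_v r v * U v * Y v ^+ 2 +
    \sum_v \sum_w a v w * U v * U w * (Y v - Y w) ^+ 2 / 2.
  pose T := \sum_v \sum_w a v w * U v * U w * Y v ^+ 2.
  pose S := \sum_v \sum_w a v w * X v * X w.
  have -> : \sum_v r v * U v * Y v ^+ 2 = \sum_v 2 * X v ^+ 2 - T.
    rewrite -sumrB; apply: eq_bigr => v _; rewrite /r !mulrBl XE; congr (_ - _); first by ring.
    by rewrite !mulr_suml; apply: eq_bigr => w _; ring.
  have -> : \sum_v \sum_w a v w * U v * U w * (Y v - Y w) ^+ 2 / 2 = T - S; last first.
    by rewrite qE addrA subrK.
  have T2 : T = \sum_v \sum_w a v w * U v * U w * Y w ^+ 2.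
    rewrite /T exchange_big; apply: eq_bigr => v _; apply: eq_bigr => w _.
    by rewrite /a nedgesC; ring.
  transitivity (T / 2 + T / 2 - S); last by rewrite -splitr.
  rewrite {2}T2 /T /S !mulr_suml -big_split -sumrB; apply: eq_bigr => v _ /=.
  rewrite !mulr_suml -big_split -sumrB; apply: eq_bigr => w _ /=.
  by rewrite !XE; field.
have r0 v : 0 <= r v * U v * Y v ^+ 2.
  have rv : 0 <= r v by apply: le_trans (rP v); rewrite ler0n.
  by rewrite mulr_ge0 ?sqr_ge0 // mulr_ge0 // ltW.
have t0 v w : 0 <= a v w * U v * U w * (Y v - Y w) ^+ 2 / 2.
  have aUU : 0 <= a v w * U v * U w by rewrite !mulr_ge0 ?ler0n.
  by apply: divr_ge0; rewrite ?ler0n // mulr_ge0 // sqr_ge0.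
rewrite lt_neqAle eq_sym addr_ge0 ?sumr_ge0 // ?andbT => [|v _]; last exact: sumr_ge0.
apply: contra x0; rewrite paddr_eq0 ?sumr_ge0 // => [|v _]; last exact: sumr_ge0.
move=> /andP[/eqP s1 /eqP s2].
have Yi : Y i = 0.
  have /eqP := s1; rewrite psumr_eq0 => [/allP/(_ i (mem_index_enum _)) /=|v _]; last exact: r0.
  rewrite mulf_eq0 mulf_eq0 (gt_eqF (U0 i)) orbF sqrf_eq0 => /orP[/eqP ri|/eqP//].
  by have := rP i; rewrite eqxx ri ler10.
have step v w : adjacent v w -> Y v = Y w.
  move=> /existsP[e evw]; have /eqP := s2.
  rewrite psumr_eq0 => [/allP/(_ v (mem_index_enum _)) /=|v' _]; last exact: sumr_ge0.
  rewrite psumr_eq0 => [/allP/(_ w (mem_index_enum _)) /=|w' _]; last exact: t0.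
  rewrite !mulf_eq0 (gt_eqF (U0 v)) (gt_eqF (U0 w)) invr_eq0 pnatr_eq0 !orbF orbb.
  rewrite pnatr_eq0 subr_eq0 => /orP[/orP[/eqP n0|/eqP//]|//].
  by have := card0_eq n0 e; rewrite !inE evw.
have Y0 v : Y v = 0.
  have [_ /(_ i v)/connectP[p ip ->]] := Gc.
  suff: forall z, path (@adjacent G) z p -> Y z = 0 -> Y (last z p) = 0 by move=> /(_ i ip Yi).
  elim: {ip} p => [|y p IHp] z //= /andP[zy yp] Yz.
  by apply: IHp yp _; rewrite -(step _ _ zy).
apply/eqP/colP => k; rewrite mxE -(enum_valK k).
by have := XE (enum_val k); rewrite Y0 mul0r.
Qed.

End PositiveDefinite.

Lemma big_tagged (V : zmodType) (I : finType) (n : I -> nat) (F : forall i, 'I_(n i) -> V) :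
  \sum_(p : {i : I & 'I_(n i)}) F (tag p) (tagged p) = \sum_i \sum_k F i k.
Proof. exact/esym/(@sig_big_dep _ _ _ I (fun i => 'I_(n i) : finType) xpredT (fun=> xpredT)). Qed.

(** * A finite-dimensional column forces finite type *)

Section FiniteColumn.
Variables (K : fieldType) (G : multigraph) (eps : qarrow (doubled_quiver G) -> bool).
Local Notation Q := (doubled_quiver G).
Local Notation Pi := (preproj K eps).
Local Notation scal := (@preproj_scal K G eps).
Local Notation vtx := (@vtx K G eps).
Local Notation arr := (@arr K G eps).
Local Notation sgn := (@sgn K G eps).
Local Notation reg := ((Pi^c)^o : lmodType Pi^c).
Implicit Types (x y z : Pi) (a b : qarrow Q) (v : qvertex Q).

Variables (i : qvertex Q) (N : nat).
Hypothesis vanish : forall m x, (N <= m)%N -> cproj i m x = 0.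

Definition corner j : reg -> Prop := fun x => vtx j * (x : Pi) = x /\ (x : Pi) * vtx i = x.

Lemma cproj_sum_all x : x * vtx i = x -> x = \sum_(m < N) cproj i m x.
Proof.
move=> xi; apply: hdeg_ext => d; rewrite hdeg_sum.
have xE m : hdeg m x = cproj i m x by rewrite -[in LHS]xi hdeg_vtxr.
have [dN|Nd] := ltnP d N; last first.
  rewrite xE vanish // big1 // => m _; rewrite -xE hdegK.
  by rewrite gtn_eqF // (leq_trans _ Nd).
rewrite (bigD1 (Ordinal dN)) //= -[in RHS]xE hdegK eqxx big1 ?addr0 // => m md.
rewrite -xE hdegK; case: eqP => // dm; case/eqP: md; exact: val_inj.
Qed.

Lemma corner_spanned j : exists n, spanned scal (corner j) n.
Proof.
pose n m := sval (boolp.cid (cproj_spanned K eps i m)).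
have nP m : spanned scal (fun x : reg => cproj i m x = x) (n m) by rewrite /n; case: boolp.cid.
pose e m := sval (boolp.cid (nP m)).
have eP m : (forall k, cproj i m (e m k) = e m k) /\
    forall x : reg, cproj i m x = x -> kspan scal (e m) x by rewrite /e; case: boolp.cid.
exists #|{: {m : 'I_N & 'I_(n m)}}|.
apply: (spanned_fin (e := fun p : {m : 'I_N & 'I_(n m)} => vtx j * e (tag p) (tagged p) : reg)).
  move=> [m k]; split; first exact: vtxx.
  by rewrite /= -mulrA -[in LHS](eP m).1 /cproj -mulrA vtxM eqxx -/(cproj i m _) (eP m).1.
move=> x [jx xi].
have ex (m : 'I_N) : kspan scal (e m) (cproj i m x) by apply: (eP m).2; apply: cprojK.
pose c m := sval (boolp.cid (ex m)).
have cE (m : 'I_N) : cproj i m x = comb scal (e m) (c m) by rewrite /c; case: boolp.cid.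
exists (fun p => c (tag p) (tagged p)).
rewrite -[LHS]jx [in LHS](cproj_sum_all xi) mulr_sumr /comb.
rewrite (@big_tagged reg _ (fun m : 'I_N => n m)
  (fun m k => kscale scal (c m k) (vtx j * e m k : reg))).
apply: eq_bigr => m _; rewrite cE [LHS]mulr_sumr; apply: eq_bigr => k _.
by rewrite !kscale_reg !mulrA preproj_scalC.
Qed.

Section Euler.
Variables (u : vertex G -> nat) (e : forall j, 'I_(u j) -> reg).
Hypothesis eU : forall j k, corner j (@e j k).
Hypothesis eS : forall j x, corner j x -> kspan scal (@e j) x.
Hypothesis ef : forall j, kfree scal (@e j).
Hypothesis vi : vtx i != 0.
Variable j : qvertex Q.

Local Notation out := {a : qarrow Q | qsource a == j}.
Local Notation mid := ({ffun option (qarrow Q) -> (Pi^c)^o} : lmodType Pi^c).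
Local Notation idx := ({s : out & 'I_(u (qtarget (val s)))} + 'I_(i == j))%type.

(** A basis of the middle term at [j]. The coordinate [None] holds a copy of the line through [e_i],
    present when [i == j]; it replaces the cokernel of the last Koszul map and produces the term
    [delta_i]. *)
Definition mid_elt (p : idx) : mid :=
  match p with
  | inl q => [ffun o => if o == Some (val (tag q)) then e (tagged q) else 0]
  | inr _ => [ffun o => if o == None then vtx i else 0]
  end.

Definition mid_map (x : mid) : reg := \sum_a arr a * (x (Some a) : Pi) + (x None : Pi).

Definition mid_gen (k : 'I_(u j)) : mid :=
  [ffun o => if o is Some a then sgn a * (arr (dual_arrow a) * (e k : Pi)) else 0].

Lemma comb_midE (J : finType) (g : J -> mid) c o :
  comb scal g c o = \sum_k scal (c k) * (g k o : Pi).
Proof.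
rewrite /comb sum_ffunE; apply: eq_bigr => k _.
by rewrite ffunE -[RHS]kscale_reg.
Qed.

Lemma comb_mid_some c a : comb scal mid_elt c (Some a) =
  if insub a is Some s then comb scal (@e (qtarget (val (s : out))))
    (fun k => c (inl (Tagged (fun s : out => 'I_(u (qtarget (val s)))) k))) else 0.
Proof.
rewrite comb_midE big_sumType /= [X in _ + X]big1 ?addr0; last first.
  by move=> k _; rewrite ffunE mulr0.
pose T (s : out) := 'I_(u (qtarget (val s))).
pose F (s : out) (k : T s) : Pi := scal (c (inl (Tagged T k))) *
  (([ffun o => if o == Some (val s) then @e (qtarget (val s)) k else 0] : mid) (Some a) : Pi).
transitivity (\sum_(p : {s : out & T s}) F (tag p) (tagged p)).
  by apply: eq_bigr => -[s k].
rewrite big_tagged.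
case: insubP => [s _ sa|na].
  rewrite (bigD1 s) //= [X in _ + X]big1 ?addr0 => [|s' s's]; last first.
    apply: big1 => k _; rewrite /F ffunE; case: (Some a =P Some (val s')) => [[as']|_]; last by rewrite mulr0.
    by case/eqP: s's; apply: val_inj; rewrite sa as'.
  apply: eq_bigr => k _; rewrite /F ffunE ifT ?kscale_reg //.
  by apply/eqP; congr Some; exact: esym sa.
apply: big1 => s _; apply: big1 => k _; rewrite /F ffunE.
case: (Some a =P Some (val s)) => [[as']|_]; last by rewrite mulr0.
by case/negP: na; rewrite as' (valP s).
Qed.

Lemma comb_mid_none c : comb scal mid_elt c None = \sum_k scal (c (inr k)) * vtx i.
Proof.
rewrite comb_midE big_sumType /= big1 ?add0r => [|k _]; last by rewrite ffunE mulr0.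
by apply: eq_bigr => k _; rewrite ffunE.
Qed.

(** With the extra line added, the middle term maps to [e_j Pi e_i], and by [koszul_exact] the
    kernel is the image of another copy of [e_j Pi e_i]. Hence the middle dimension is at most twice
    [u j]. *)
Lemma euler_corner : (\sum_(s : out) u (qtarget (val s)) + (i == j) <= 2 * u j)%N.
Proof.
have -> : (\sum_(s : out) u (qtarget (val s)) + (i == j))%N = #|{: idx}|.
  rewrite card_sum card_ord card_tagged sumnE big_map big_enum /=; congr (_ + _)%N.
  by apply: eq_bigr => s _; rewrite card_ord.
rewrite mul2n -addnn -[X in (_ <= X + X)%N]card_ord.
apply: (@exact_card _ _ scal mid reg _ _ _ mid_elt (@e j) mid_gen mid_map).
- move=> c; rewrite /mid_map comb_midE.
  under eq_bigr => a _ do rewrite comb_midE mulr_sumr.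
  rewrite exchange_big -big_split; apply: eq_bigr => p _.
  rewrite kscale_reg mulrDr mulr_sumr; congr (_ + _); apply: eq_bigr => a _.
  by rewrite !mulrA preproj_scalC.
- move=> c c0 [[s k]|k].
    have := congr1 (fun x : mid => x (Some (val s))) c0; rewrite comb_mid_some valK ffunE.
    by move=> /ef/(_ k).
  have := congr1 (fun x : mid => x None) c0; rewrite comb_mid_none ffunE.
  rewrite (bigD1 k) //= big1 ?addr0 => [/scal_eq0->//|k' k'k].
  have l0 (l : 'I_(i == j)) : l = 0%N :> nat.
    by case: l => l /=; case: (i == j); case: l.
  by case/eqP: k'k; apply: val_inj; rewrite /= !l0.
- move=> [[s k]|k]; apply: eS; rewrite /mid_map.
    rewrite !ffunE /= addr0 (bigD1 (val s)) //= !ffunE eqxx big1 ?addr0 => [|a as_]; last first.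
      by rewrite ffunE; case: eqP => [[e']|_]; [case/eqP: as_ | rewrite mulr0].
    have [te ei] := eU k; split; last by rewrite -mulrA ei.
    apply: etrans _ (arr_source (val s) _); congr (vtx _ * _).
    exact/esym/eqP/(valP s).
  rewrite !ffunE /= big1 ?add0r => [|a _]; last by rewrite ffunE mulr0.
  have ij : i = j by case: eqP k => [//|_ []].
  by split; rewrite ?ij vtxM eqxx.
- move=> c; set x := comb _ _ _; rewrite /mid_map => Dx.
  have xt a : vtx (qtarget a) * (x (Some a) : Pi) = x (Some a) /\ (x (Some a) : Pi) * vtx i = x (Some a).
    rewrite /x comb_mid_some; case: insubP => [s _ <-|_]; last by rewrite mulr0 mul0r.
    split.
      rewrite /comb mulr_sumr; apply: eq_bigr => k _.
      by rewrite kscale_reg mulrA -preproj_scalC -mulrA (eU k).1.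
    rewrite /comb mulr_suml; apply: eq_bigr => k _.
    by rewrite kscale_reg -mulrA (eU k).2.
  (* The extra coordinate has degree 0, whereas left multiples of arrows have no part of degree
     0. *)
  have x0 : x None = 0.
    have := congr1 (hdeg 0) Dx; rewrite hdegD hdeg_sum big1 ?add0r; last first.
      by move=> a _; rewrite hdeg_arr0.
    rewrite hdeg0 /x comb_mid_none hdeg_sum => h; rewrite -[RHS]h; apply: eq_bigr => k _.
    by rewrite hdeg_scal hdeg_vtx.
  rewrite x0 addr0 in Dx.
  have [y yE] := koszul_exact (fun a => (xt a).1) Dx.
  (* Cutting [y] down to [e_j y e_i] puts it in the span of the basis and does not change the
     coordinates at arrows starting at [j]. *)
  pose y' := vtx j * y * vtx i.
  have y'U : corner j y' by split; rewrite /y' -?mulrA ?vtxM ?eqxx // mulrA vtxM eqxx.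
  have [d dE] := eS y'U.
  exists d; apply/ffunP => -[a|]; last first.
    by rewrite x0 comb_midE big1 // => k _; rewrite ffunE mulr0.
  rewrite comb_midE; transitivity (sgn a * (arr (dual_arrow a) * y')); last first.
    rewrite dE /comb !mulr_sumr; apply: eq_bigr => k _; rewrite ffunE kscale_reg.
    by rewrite !mulrA -(preproj_scalC _ (sgn a * _)) !mulrA.
  have [/eqP aj|aj] := boolP (qsource a == j).
    by rewrite /y' -aj -!mulrA arr_dual_source !mulrA -(mulrA (sgn a)) -yE (xt a).2.
  rewrite /y' -!mulrA arr_vtxl target_dual (negPf aj) mulr0.
  by rewrite /x comb_mid_some insubF //; apply/negbTE.
Qed.

End Euler.

Lemma column_finite_type (R : realType) :
  connected G -> vtx i != 0 -> finite_type G R.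
Proof.
move=> Gc vi0.
have ex j : exists n, exists e : 'I_n -> reg, [/\ forall k, corner j (e k),
    forall x, corner j x -> kspan scal e x & kfree scal e].
  by have [n /spanned_basis] := corner_spanned j.
pose u j := sval (boolp.cid (ex j)).
have uP j : exists e : 'I_(u j) -> reg, [/\ forall k, corner j (e k),
    forall x, corner j x -> kspan scal e x & kfree scal e] by rewrite /u; case: boolp.cid.
pose e j := sval (boolp.cid (uP j)).
have eP j : [/\ forall k, corner j (e j k),
    forall x, corner j x -> kspan scal (e j) x & kfree scal (e j)] by rewrite /e; case: boolp.cid.
apply: (@superharmonic_finite_type G R i u Gc) => j.
have eU k l : corner k (e k l) by case: (eP k).
have eS k x : corner k x -> kspan scal (e k) x by case: (eP k) => _ eSk _; apply: eSk.
have ef k : kfree scal (e k) by case: (eP k).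
apply: leq_trans (euler_corner eU eS ef vi0 j); rewrite leq_add2r.
rewrite [X in (_ <= X)%N](partition_big (fun s : {a : qarrow Q | qsource a == j} => qtarget (val s)) xpredT) //=.
apply: leq_sum => w _.
rewrite (eq_bigr (fun=> u w)) => [|s /eqP-> //]; rewrite sum_nat_const leq_mul2r; apply/orP; right.
(* Forgetting the orientation maps the arrows from [j] to [w] onto the edges joining them, so there
   are at least as many arrows as edges. *)
pose f (s : {a : qarrow Q | qsource a == j}) := (val s).1.
apply: leq_trans (leq_image_card f _); apply: subset_leq_card.
apply/fintype.subsetP => d.
rewrite inE => /existsP[b /andP[bj bw]]; apply/mapP.
have bj' : qsource ((d, b) : qarrow Q) == j by [].
by exists (exist _ (d, b) bj'); rewrite ?mem_enum ?inE.
Qed.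

End FiniteColumn.

(** Being killed by arrows on the left passes to homogeneous components and to columns, so a socle
    element can be taken of least degree in one column. Vanishing in the following degree persists
    upwards, and the whole column is finite dimensional. *)
Lemma no_socle (R : realType) (K : fieldType) (G : multigraph)
    (eps : qarrow (doubled_quiver G) -> bool) (x : preproj K eps) :
  connected G -> ~ finite_type G R ->
  (forall a, arr K eps a * x = 0) -> x = 0.
Proof.
move=> Gc nft xJ; apply: contrapT => x0; apply: nft.
have [d [i xdi]] : exists d i, cproj i d x != 0.
  apply: contrapT => nx; apply: x0; apply: hdeg_ext => d.
  rewrite hdeg0 -[LHS]mulr1 -(sum_vtx K eps) mulr_sumr big1 // => i _.
  by apply/eqP/negPn/negP => xdi; apply: nx; exists d, i.
pose P m := `[< exists z : preproj K eps, [/\ cproj i m z = z, z != 0 & forall a, arr K eps a * z = 0] >].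
have exP : exists m, P m.
  exists d; apply/asboolP; exists (cproj i d x); split; rewrite ?cprojK // => a.
  by rewrite -cproj_arr xJ cproj0.
case: (ex_minnP exP) => m /asboolP[z [zW z0 zJ]] mmin.
have van (w : preproj K eps) : cproj i m.+1 w = 0.
  refine (socle_vanishing zW z0 zJ _ w) => k y km yW yJ.
  apply: contrapT => /eqP y0; suff : (m <= k)%N by rewrite leqNgt km.
  by apply: mmin; apply/asboolP; exists y.
have bounded_column k (w : preproj K eps) : (m.+1 <= k)%N -> cproj i k w = 0.
  elim: k w => [|k IHk] w //; rewrite leq_eqVlt => /orP[/eqP[<-]|]; first exact: van.
  rewrite ltnS => mk; have [y ->] := cproj_decomposition i k w.
  by rewrite big1 // => a _; rewrite IHk ?mulr0.
have vi0 : vtx K eps i != 0 by apply: contra z0 => /eqP vi0; rewrite -zW /cproj vi0 mulr0.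
exact: (column_finite_type bounded_column Gc vi0).
Qed.

(** * Nilpotent modules and the Koszul complex *)

Section Nilpotent.
Variables (K : fieldType) (G : multigraph) (eps : qarrow (doubled_quiver G) -> bool).
Local Notation Q := (doubled_quiver G).
Local Notation Pi := (preproj K eps).
Local Notation scal := (@preproj_scal K G eps).
Local Notation vtx := (@vtx K G eps).
Local Notation arr := (@arr K G eps).
Local Notation reg := ((Pi^c)^o : lmodType Pi^c).
Local Notation J := (@arrow_ideal K G eps).
Implicit Types (x y z : Pi) (a b : qarrow Q) (v : qvertex Q).

Lemma arrow_ideal_arr a : J (arr a).
Proof. by apply: ideal_gen_sub; exists a. Qed.

(** By definition powers of [J] grow by factors on the right, while the decomposition of elements
    puts arrows on the left. *)
Lemma ideal_powerMl l x y : J x -> ideal_power J l y -> ideal_power J l.+1 (x * y).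
Proof.
elim: l x y => [|l IHl] x y Jx Jy.
  apply: ideal_gen_sub; exists 1 => //; exists (x * y); last by rewrite mul1r.
  by have [_ _ JM] := ideal_gen_ideal [set arr a | a in setT]%classic; have [] := JM y x Jx.
pose H : set Pi := fun y => forall x, J x -> ideal_power J l.+2 (x * y).
suff: H y by apply.
have [I0 ID IM] := ideal_power_ideal J l.+2.
apply: ideal_gen_min Jy; last first.
  move=> _ [u Ju [w Jw <-]] z Jz; apply: ideal_gen_sub.
  by exists (z * u); [apply: IHl | exists w; rewrite ?mulrA].
split=> [z _|u w Hu Hw z Jz|b u Hu]; first by rewrite mulr0.
  by rewrite mulrDr; apply: ID; [apply: Hu | apply: Hw].
split=> z Jz; last by rewrite mulrA; have [] := IM b _ (Hu z Jz).
rewrite mulrA; apply: Hu.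
by have [_ _ JM] := ideal_gen_ideal [set arr a | a in setT]%classic; have [] := JM b z Jz.
Qed.

(** The part of degree at least [m]. *)
Definition high m x : Pi := x - \sum_(d < m) hdeg d x.

Lemma high_sum m (I : finType) (F : I -> Pi) : high m (\sum_i F i) = \sum_i high m (F i).
Proof.
rewrite /high sumrB; congr (_ - _); rewrite exchange_big.
by apply: eq_bigr => d _; apply: hdeg_sum.
Qed.

Lemma high_arr m a x : arr a * high m x = high m.+1 (arr a * x).
Proof.
rewrite /high mulrBr mulr_sumr big_ord_recl hdeg_arr0 add0r; congr (_ - _).
by apply: eq_bigr => d _; rewrite hdeg_arrS.
Qed.

Lemma high_vtx m v x : vtx v * high m x = high m (vtx v * x).
Proof.
rewrite /high mulrBr mulr_sumr; congr (_ - _).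
by apply: eq_bigr => d _; rewrite hdeg_vtxl.
Qed.

Lemma high_scal m c x : scal c * high m x = high m (scal c * x).
Proof.
rewrite /high mulrBr mulr_sumr; congr (_ - _).
by apply: eq_bigr => d _; rewrite hdeg_scal.
Qed.

Lemma high0 m : high m 0 = 0.
Proof. by rewrite /high big1 ?subr0 // => d _; apply: hdeg0. Qed.

Lemma hdeg_high m d x : (d < m)%N -> hdeg d (high m x) = 0.
Proof.
move=> dm; rewrite hdegD hdegN hdeg_sum (bigD1 (Ordinal dm)) //= hdegK eqxx.
rewrite big1 ?addr0 ?subrr // => e ed; rewrite hdegK; case: eqP => // de.
by case/eqP: ed; apply: val_inj.
Qed.

Lemma high_id m x : (forall d, (d < m)%N -> hdeg d x = 0) -> high m x = x.
Proof. by move=> x0; rewrite /high big1 ?subr0 // => d _; apply: x0. Qed.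

Lemma arrow_decomposition x : hdeg 0 x = 0 -> exists y : qarrow Q -> Pi, x = \sum_a arr a * y a.
Proof.
have [c [y ->]] := preproj_decomposition x; rewrite hdegD !hdeg_sum.
rewrite [X in _ + X]big1 ?addr0 => [|a _]; last by rewrite hdeg_arr0.
under eq_bigr => v _ do rewrite hdeg_scal hdeg_vtx.
by move=> ->; exists y; rewrite add0r.
Qed.

(** Together with [hdeg_ideal_power], this identifies the power [J^l] with the part of degree at
    least [l]. In a decomposition into arrows times coefficients, the coefficients may be replaced
    by their high parts. *)
Lemma ideal_power_high l x : (forall d, (d < l)%N -> hdeg d x = 0) -> ideal_power J l x.
Proof.
elim: l x => [|l IHl] x x0 //; have [y xE] := arrow_decomposition (x0 0%N isT).
have [I0 ID IM] := ideal_power_ideal J l.+1.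
rewrite -(high_id x0) xE high_sum; elim/big_ind: _ => // a _.
rewrite -high_arr; apply: ideal_powerMl; first exact: arrow_ideal_arr.
by apply: IHl => d dl; apply: hdeg_high.
Qed.

Lemma hdeg_ideal_power l d x : ideal_power J l x -> (d < l)%N -> hdeg d x = 0.
Proof.
have J0 y : J y -> hdeg 0 y = 0.
  pose H : set Pi := fun y => hdeg 0 y = 0.
  move=> Jy; suff : H y by [].
  apply: ideal_gen_min Jy => [|_ [a _ <-]]; last exact: hdeg_arr.
  split=> [|u w Hu Hw|b u Hu]; first exact: hdeg0.
    by rewrite /H hdegD Hu Hw addr0.
  by split; rewrite /H hdegM big_ord1 Hu ?mulr0 ?mul0r.
elim: l d x => [|l IHl] d x // Jx dl.
pose H : set Pi := fun x => forall d, (d < l.+1)%N -> hdeg d x = 0.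
suff: H x by apply.
apply: ideal_gen_min Jx => [|_ [u Ju [w Jw <-]] {d dl} d]; last first.
  rewrite ltnS => dl; rewrite hdegM big1 // => i _.
  have [il|li] := ltnP i l; first by rewrite (IHl i) ?mul0r.
  have -> : (d - i)%N = 0%N by apply/eqP; rewrite subn_eq0 (leq_trans dl).
  by rewrite (J0 w) ?mulr0.
split=> [d' _|u w Hu Hw d' d'l|b u Hu]; first exact: hdeg0.
  by rewrite hdegD Hu ?Hw ?addr0.
split=> d' d'l; rewrite hdegM big1 // => i _.
  by rewrite (Hu (d' - i)%N) ?mulr0 // (leq_ltn_trans (leq_subr _ _)).
by rewrite (Hu i) ?mul0r // (leq_ltn_trans _ d'l) // -ltnS.
Qed.

(** Modulo [J^l] only the degrees below [l] act, and each of these is finite dimensional. *)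
Lemma nilp_finitely_generated (M : lmodType Pi^c) (I : finType) (g : I -> M) l :
  (forall m : M, exists x : I -> Pi, m = \sum_i ract (x i) (g i)) ->
  (forall (m : M) x, ideal_power J l x -> ract x m = 0) -> is_nilp scal J M.
Proof.
move=> gen Jl; split; last by exists l.
have ractD x y (m : M) : ract (x + y) m = ract x m + ract y m by apply: scalerDl.
have ract0 (m : M) : ract (0 : Pi) m = 0 by apply: scale0r.
pose n d := sval (boolp.cid (hdeg_spanned K eps d)).
have nP d : spanned scal (fun x : reg => hdeg d x = x) (n d) by rewrite /n; case: boolp.cid.
pose e d := sval (boolp.cid (nP d)).
have eP d : forall x : reg, hdeg d x = x -> kspan scal (e d) x by rewrite /e; case: boolp.cid => ? [].
apply/finite_dimP; exists #|{: I * {d : 'I_l & 'I_(n d)}}|.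
pose ge (p : I * {d : 'I_l & 'I_(n d)}) : M := ract (e (tag p.2) (tagged p.2) : Pi) (g p.1).
refine (@spanned_fin _ _ scal M (fun=> True) _ ge _ _) => // m _.
have [x ->] := gen m.
have ex i (d : 'I_l) : kspan scal (e d) (hdeg d (x i)) by apply: eP; rewrite hdegK eqxx.
pose c i d := sval (boolp.cid (ex i d)).
have cE i (d : 'I_l) : hdeg d (x i) = comb scal (e d) (c i d) by rewrite /c; case: boolp.cid.
exists (fun p => c p.1 (tag p.2) (tagged p.2)).
rewrite /comb -(pair_bigA _ (fun i (q : {d : 'I_l & 'I_(n d)}) =>
  kscale scal (c i (tag q) (tagged q)) (ract (e (tag q) (tagged q) : Pi) (g i)))) /=.
apply: eq_bigr => i _.
rewrite (@big_tagged M _ (fun d : 'I_l => n d) (fun d k => kscale scal (c i d k) (ract (e d k : Pi) (g i)))).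
have -> : x i = high l (x i) + \sum_(d < l) hdeg d (x i) by rewrite subrK.
rewrite ractD (Jl _ (high l (x i))) ?add0r; last first.
  by apply: ideal_power_high => d dl; apply: hdeg_high.
rewrite (big_morph (fun y => ract y (g i)) (fun y z => ractD y z (g i)) (ract0 (g i))).
apply: eq_bigr => d _; rewrite cE /comb.
rewrite (big_morph (fun y => ract y (g i)) (fun y z => ractD y z (g i)) (ract0 (g i))).
apply: eq_bigr => k _; rewrite kscale_reg preproj_scalC /kscale /ract.
by rewrite scalerA.
Qed.

(** Take the least power of [J] that kills [M]; the image of the preceding power is nonzero and is
    killed by arrows. Some vertex component of such an element is nonzero. *)
Lemma nilp_socle (M : lmodType Pi^c) (m : M) : nilpotent_mod J M -> m != 0 ->
  exists v (s : M), [/\ s != 0, ract (vtx v) s = s & forall a, ract (arr a) s = 0].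
Proof.
move=> [l0 Jl0] m0.
have ractA x y (s : M) : ract y (ract x s) = ract (x * y) s by rewrite /ract scalerA.
pose P l := `[< forall (m : M) x, ideal_power J l x -> ract x m = 0 >].
have exP : exists l, P l by exists l0; apply/asboolP.
case: (ex_minnP exP) => -[|l] /asboolP Jl lmin.
  by case/eqP: m0; rewrite -(Jl m 1) // /ract scale1r.
have [s [r [Jr sr]]] : exists s r, ideal_power J l r /\ ract r (s : M) != 0.
  apply: contrapT => nex; suff /lmin : P l by rewrite ltnn.
  apply/asboolP => s r Jr; apply/eqP/negPn/negP => sr; apply: nex; by exists s, r.
have srJ a : ract (arr a) (ract r s) = 0.
  rewrite ractA; apply: Jl; apply: ideal_gen_sub; exists r => //.
  by exists (arr a) => //; apply: arrow_ideal_arr.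
have [v sv] : exists v, ract (vtx v) (ract r s) != 0.
  apply: contrapT => nex; case/eqP: sr.
  rewrite -[LHS]scale1r -[1](sum_vtx K eps) scaler_suml big1 // => v _.
  by apply/eqP/negPn/negP => sv; apply: nex; exists v.
exists v, (ract (vtx v) (ract r s)); split=> // [|a]; first by rewrite ractA vtxM eqxx.
rewrite ractA vtx_arr; case: ifP => _; first exact: srJ.
exact: scale0r.
Qed.

End Nilpotent.

(** * The Koszul complex of a vertex *)

Section Koszul.
Variables (K : fieldType) (G : multigraph) (eps : qarrow (doubled_quiver G) -> bool).
Local Notation Q := (doubled_quiver G).
Local Notation Pi := (preproj K eps).
Local Notation vtx := (@vtx K G eps).
Local Notation arr := (@arr K G eps).
Local Notation sgn := (@sgn K G eps).
Implicit Types (x y z : Pi) (a b : qarrow Q) (v : qvertex Q).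

Variables (v : qvertex Q) (c : int).

(* The summands of the complex: [None] is the top term, [Some (Some a)] the
   middle summand of the arrow a and [Some None] the bottom term. *)
Definition kidx : finType := option (option (qarrow Q)).

Definition kdeg (o : kidx) : nat :=
  match o with None => 0 | Some (Some _) => 1 | Some None => 2 end.

(** The summand [o] is the right ideal generated by this idempotent. Arrows that do not start at [v]
    receive 0, so the index type does not depend on [v]. *)
Definition kidem (o : kidx) : Pi :=
  match o with
  | Some (Some a) => if qsource a == v then vtx (qtarget a) else 0
  | _ => vtx v
  end.

Definition ktotal : lmodType Pi^c := {ffun kidx -> (Pi^c)^o}.

Definition kcoord (s : ktotal) (o : kidx) : Pi := s o.

Lemma kcoordD s t o : kcoord (s + t) o = kcoord s o + kcoord t o.
Proof. by rewrite /kcoord ffunE. Qed.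

Lemma kcoordZ (r : Pi) (s : ktotal) o : kcoord ((r : Pi^c) *: s) o = kcoord s o * r.
Proof. by rewrite /kcoord ffunE. Qed.

Lemma kcoord0 o : kcoord 0 o = 0.
Proof. by rewrite /kcoord ffunE. Qed.

Lemma kidemK o x : kidem o * (kidem o * x) = kidem o * x.
Proof. by case: o => [[a|]|] /=; rewrite ?vtxx //; case: ifP; rewrite ?vtxx ?mul0r. Qed.

(** One ambient module holds the summands of all degrees, and degree [n] is cut out by the numerical
    condition on [kdeg]. This avoids terms defined by cases on the integer [n]. *)
Definition kpred (n : int) : {pred ktotal} := fun s => `[< forall o,
  kidem o * kcoord s o = kcoord s o /\ (n + (kdeg o)%:Z != c + 1 -> kcoord s o = 0) >].

Lemma kpred_submod_closed n : submod_closed (kpred n).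
Proof.
split; first by apply/asboolP => o; rewrite kcoord0 mulr0.
move=> r s t /asboolP sP /asboolP tP; apply/asboolP => o.
have [s1 s0] := sP o; have [t1 t0] := tP o.
rewrite kcoordD kcoordZ; split; first by rewrite mulrDr mulrA s1 t1.
by move=> no; rewrite s0 // t0 // mul0r addr0.
Qed.

HB.instance Definition _ n := GRing.isSubmodClosed.Build Pi^c ktotal (kpred n)
  (GRing.submod_closed_semi (kpred_submod_closed n)).

Definition kterm (n : int) : lmodType Pi^c := submod (kpred n).

Lemma kval_linear n r (s t : kterm n) : \val (r *: s + t) = r *: \val s + \val t.
Proof. by rewrite GRing.valD GRing.valZ. Qed.

Lemma kval0 n o : kcoord (\val (0 : kterm n)) o = 0.
Proof. by rewrite GRing.val0 kcoord0. Qed.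

Lemma kval_sum n (I : finType) (r : I -> Pi) (F : I -> kterm n) o :
  kcoord (\val (\sum_i (r i : Pi^c) *: F i)) o = \sum_i kcoord (\val (F i)) o * r i.
Proof.
have [g gE] := @ex_linear _ (kterm n) ktotal (fun s => \val s) (@kval_linear n).
rewrite -gE linear_sum (big_morph (kcoord^~ o) (fun s t => kcoordD s t o) (kcoord0 o)).
by apply: eq_bigr => i _; rewrite linearZ -gE -kcoordZ.
Qed.

Lemma ktermP n (s : kterm n) o :
  kidem o * kcoord (\val s) o = kcoord (\val s) o /\
  (n + (kdeg o)%:Z != c + 1 -> kcoord (\val s) o = 0).
Proof. by have /asboolP := valP s; apply. Qed.

Definition kdiff_fun (s : ktotal) : ktotal :=
  [ffun o : kidx => match o with
    | None => \sum_a arr a * kcoord s (Some (Some a))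
    | Some (Some a) => if qsource a == v then sgn a * (arr (dual_arrow a) * kcoord s (Some None)) else 0
    | Some None => 0
    end : Pi].

Lemma kdiff_fun_linear : linear kdiff_fun.
Proof.
move=> r s t; apply/ffunP => o.
rewrite -[RHS]/(kcoord _ o) kcoordD kcoordZ /kcoord !ffunE.
case: o => [[a|]|]; rewrite -/(kcoord _ _).
- case: ifP => _; last by rewrite mul0r addr0.
  by rewrite kcoordD kcoordZ !mulrDr !mulrA.
- by rewrite mul0r addr0.
- rewrite mulr_suml -big_split; apply: eq_bigr => a _.
  by rewrite kcoordD kcoordZ mulrDr mulrA.
Qed.

HB.instance Definition _ := GRing.isLinear.Build Pi^c ktotal ktotal *:%R kdiff_fun kdiff_fun_linear.

Lemma kcoord_diff s o : kcoord (kdiff_fun s) o = match o with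
    | None => \sum_a arr a * kcoord s (Some (Some a))
    | Some (Some a) => if qsource a == v then sgn a * (arr (dual_arrow a) * kcoord s (Some None)) else 0
    | Some None => 0
    end.
Proof. by rewrite /kcoord ffunE. Qed.

Lemma kdiff_pred n s : s \in kpred n -> kdiff_fun s \in kpred (n + 1).
Proof.
move=> /asboolP sP; apply/asboolP => o; rewrite kcoord_diff.
case: o => [[a|]|] /=.
- have [_ s0] := sP (Some None); split; last first.
    by move=> nd; case: ifP => // _; rewrite s0 ?mulr0 //=; lia.
  case: ifP => _; last by rewrite mulr0.
  by rewrite mulrA -preproj_scalC -mulrA arr_dual_target.
- by split; rewrite ?mulr0.
- split; last first.
    move=> nd; apply: big1 => a _; have [_ -> //=] := sP (Some (Some a)); first exact: mulr0.
    by lia.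
  rewrite mulr_sumr; apply: eq_bigr => a _.
  have [/= sa _] := sP (Some (Some a)); rewrite -sa.
  by case: eqP => [<-|_]; [rewrite arr_source | rewrite mul0r !mulr0].
Qed.

Lemma ex_kdiff n : exists d : {linear kterm n -> kterm (n + 1)},
  forall s, \val (d s) = kdiff_fun (\val s).
Proof.
have [|d dE] := @ex_linear _ (kterm n) (kterm (n + 1))
  (fun s => exist _ (kdiff_fun (\val s)) (kdiff_pred (valP s))).
  by move=> r s t; apply: val_inj; apply: etrans (esym (kval_linear _ _ _));
  rewrite -kdiff_fun_linear -kval_linear.
by exists d => s; rewrite dE.
Qed.

Definition kdiff n := sval (boolp.cid (ex_kdiff n)).

Lemma kdiffE n s : \val (kdiff n s) = kdiff_fun (\val s).
Proof. by rewrite /kdiff; case: boolp.cid. Qed.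

Lemma kterm_ext n (s t : kterm n) :
  (forall o, kcoord (\val s) o = kcoord (\val t) o) -> s = t.
Proof. by move=> st; apply/val_inj/ffunP. Qed.

Lemma kdiffK n s : kdiff (n + 1) (kdiff n s) = 0.
Proof.
apply: kterm_ext => o; rewrite kval0 !kdiffE !kcoord_diff.
case: o => [[a|]|] //; first by rewrite !mulr0 if_same.
have [/= sv _] := ktermP s (Some None).
apply: etrans (preproj_relation0 (kcoord (\val s) (Some None))); apply: eq_bigr => a _.
rewrite kcoord_diff; case: ifP => sa; first by rewrite mulrA -preproj_scalC -mulrA.
by rewrite -sv arr_vtxl target_dual sa !mulr0.
Qed.

Definition kcomplex : cochain Pi^c := Cochain kdiffK.

Lemma kterm0 n : n != c + 1 -> n + 1 != c + 1 -> n + 2 != c + 1 -> forall s : kterm n, s = 0.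
Proof.
move=> n0 n1 n2 s; apply: kterm_ext => o; rewrite kval0.
by have [_ ->] := ktermP s o; case: o => [[a|]|] //=; rewrite addr0.
Qed.

Lemma bounded_kcomplex : bounded kcomplex.
Proof. by exists (c - 1), (c + 1) => n nab; apply: kterm0; lia. Qed.

Definition kgen_fun n (o : kidx) : ktotal :=
  [ffun o' : kidx => if (o' == o) && (n + (kdeg o)%:Z == c + 1) then kidem o else 0 : Pi].

Lemma kgen_pred n o : kgen_fun n o \in kpred n.
Proof.
apply/asboolP => o'; rewrite /kcoord ffunE; case: (o' =P o) => [->|_] /=; last by rewrite mulr0.
case: eqP => _ /=; last by rewrite mulr0.
by split=> //; rewrite -[X in _ * X]mulr1 kidemK mulr1.
Qed.

Definition kgen n o : kterm n := exist _ (kgen_fun n o) (kgen_pred n o).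

Lemma kgen_span n (s : kterm n) : s = \sum_o (kcoord (\val s) o : Pi^c) *: kgen n o.
Proof.
apply: kterm_ext => o.
rewrite kval_sum (bigD1 o) //= big1 ?addr0 => [|o' o'o]; rewrite /kcoord [kgen_fun _ _ _]ffunE.
  rewrite eqxx /=; have [sk s0] := ktermP s o.
  by case: eqP => [_|/eqP/s0]; rewrite -/(kcoord _ _) ?sk // => ->; rewrite mul0r.
by rewrite eq_sym (negPf o'o) mul0r.
Qed.

(** The coordinates are linear and [kgen_span] is a dual basis formula, so a map is lifted by
    choosing preimages of the generators. *)
Lemma projective_kterm n : projective (kterm n).
Proof.
move=> N N' g f gf; have [y yE] := choice (fun o => gf (kgen n o)).
have [|h hE] := @ex_linear _ (kterm n) N (fun s => \sum_o (kcoord (\val s) o : Pi^c) *: y o).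
  move=> r s t; rewrite scaler_sumr -big_split; apply: eq_bigr => o _.
  by rewrite /= scalerA -scalerDl kcoordD kcoordZ.
exists h => s; rewrite hE [in RHS](kgen_span s) !linear_sum; apply: eq_bigr => o _.
by rewrite !linearZ yE.
Qed.

End Koszul.

Section KoszulExact.
Variables (K : fieldType) (G : multigraph) (eps : qarrow (doubled_quiver G) -> bool).
Local Notation Q := (doubled_quiver G).
Local Notation Pi := (preproj K eps).
Local Notation scal := (@preproj_scal K G eps).
Local Notation vtx := (@vtx K G eps).
Local Notation arr := (@arr K G eps).
Local Notation sgn := (@sgn K G eps).
Local Notation J := (@arrow_ideal K G eps).
Implicit Types (x y z : Pi) (a b : qarrow Q).

Variables (v : qvertex Q) (c : int).
Local Notation kidx := (kidx G).
Local Notation kterm := (@kterm K G eps v c).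
Local Notation kdiff := (@kdiff K G eps v c).
Local Notation kpred := (@kpred K G eps v c).
Local Notation kcomplex := (@kcomplex K G eps v c).
Local Notation ktotal := (@ktotal K G eps).
Local Notation kidem := (@kidem K G eps v).

Lemma kelt (n : int) (f : kidx -> Pi) :
  (forall o, kidem o * f o = f o /\ (n + (kdeg o)%:Z != c + 1 -> f o = 0)) ->
  exists s : kterm n, forall o, kcoord (\val s) o = f o.
Proof.
move=> fP; pose s : ktotal := [ffun o : kidx => f o].
have sk : s \in kpred n by apply/asboolP => o; rewrite /kcoord ffunE.
by exists (exist _ s sk) => o; rewrite /kcoord ffunE.
Qed.

Lemma kdiff_ext n (s : kterm (n + 1)) (t : kterm n) :
  kcoord (\val s) None = \sum_a arr a * kcoord (\val t) (Some (Some a)) ->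
  (forall a, qsource a = v -> kcoord (\val s) (Some (Some a)) =
     sgn a * (arr (dual_arrow a) * kcoord (\val t) (Some None))) ->
  kcoord (\val s) (Some None) = 0 -> kdiff n t = s.
Proof.
move=> s0 s1 s2; apply: kterm_ext => -[[a|]|]; rewrite kdiffE kcoord_diff //.
case: eqP => [/s1 -> //|/eqP/negPf sa].
by have [/= <- _] := ktermP s (Some (Some a)); rewrite sa mul0r.
Qed.

Lemma kaugmentation_exact (s : kterm (c + 1)) :
  hdeg 0 (kcoord (\val s) None) = 0 -> exists t, kdiff c t = s.
Proof.
move=> /arrow_decomposition[y yE].
have [s1 s2] : (forall a, kcoord (\val s) (Some (Some a)) = 0) /\ kcoord (\val s) (Some None) = 0.
  by split=> [a|]; [have [_] := ktermP s (Some (Some a)) | have [_] := ktermP s (Some None)];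
    apply; rewrite /=; lia.
have [|t tE] := @kelt c (fun o => match o with
  | Some (Some a) => if qsource a == v then vtx (qtarget a) * y a else 0 | _ => 0 end).
  move=> [[a|]|] /=; rewrite ?mulr0; split=> //; last by lia.
  by case: ifP => _; rewrite ?mulr0 // vtxx.
exists t; apply: kdiff_ext => [|a _|//].
  have [/= <- _] := ktermP s None; rewrite yE mulr_sumr; apply: eq_bigr => a _.
  rewrite tE mulrA vtx_arr; case: ifP => _; rewrite ?mulr0 ?mul0r //.
  by rewrite arr_target.
by rewrite s1 tE !mulr0.
Qed.

Lemma kdiff_augmentation (t : kterm c) : hdeg 0 (kcoord (\val (kdiff c t)) None) = 0.
Proof.
rewrite kdiffE kcoord_diff hdeg_sum big1 // => a _; exact: hdeg_arr0.
Qed.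

Hypothesis nosocle : forall x, (forall a, arr a * x = 0) -> x = 0.

(** In degree [c] this is [koszul_exact]. In degree [c - 1] a bottom coordinate in the kernel is
    killed by every arrow, so it vanishes by [nosocle]; lower terms are zero. *)
Lemma kcomplex_exact n (s : kterm (n + 1)) : n < c -> kdiff (n + 1) s = 0 ->
  exists t, kdiff n t = s.
Proof.
move=> nc ds; have s0 : kcoord (\val s) None = 0.
  by have [_] := ktermP s None; apply; rewrite /=; lia.
have dE o : kcoord (\val (kdiff (n + 1) s)) o = 0 by rewrite ds kcoord0.
have [nc1|nc1] := eqVneq (n + 1) c; last first.
  have s1 a : kcoord (\val s) (Some (Some a)) = 0.
    by have [_] := ktermP s (Some (Some a)); apply; rewrite /=; lia.
  have s2 : kcoord (\val s) (Some None) = 0.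
    apply: nosocle => b; have [/= sv _] := ktermP s (Some None).
    have := dE (Some (Some (dual_arrow b))); rewrite kdiffE kcoord_diff.
    case: ifP => [_ e|sb _].
      by rewrite dual_arrowK in e; rewrite -[LHS](sgnK (dual_arrow b)) e mulr0.
    by rewrite -sv arr_vtxl -source_dual sb.
  exists 0; rewrite linear0; apply: kterm_ext => o; rewrite kcoord0.
  by case: o => [[a|]|]; rewrite ?s0 ?s1 ?s2.
have s2 : kcoord (\val s) (Some None) = 0.
  by have [_] := ktermP s (Some None); apply; rewrite /=; lia.
have := dE None; rewrite kdiffE kcoord_diff => s1.
have [a|y yE] := koszul_exact _ s1.
  have [/= <- _] := ktermP s (Some (Some a)).
  by case: ifP => _; rewrite ?mul0r ?mulr0 // vtxx.
have [|t tE] := @kelt n (fun o => if o is Some None then vtx v * y else 0).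
  move=> [[a|]|] /=; rewrite ?mulr0; split=> //; first exact: vtxx.
  by lia.
exists t; apply: kdiff_ext; rewrite ?s0 ?s2 //.
  by rewrite big1 // => a _; rewrite tE mulr0.
by move=> a sa; rewrite tE yE -sa arr_dual_source.
Qed.

Section Truncation.
Variable l : nat.

(** The differential raises the path degree by one, so the cut rises by one from each term to the
    next: the elements above the cut form a subcomplex and the truncated differential loses
    nothing. *)
Definition kcut (o : kidx) : nat :=
  match o with None => l.+2 | Some (Some _) => l.+1 | Some None => l end.

Definition ktrunc_pred n : {pred kterm n} := fun s => `[< forall o d,
  (d < kcut o)%N -> hdeg d (kcoord (\val s) o) = 0 >].

Lemma ktrunc_submod_closed n : submod_closed (@ktrunc_pred n).
Proof.
split; first by apply/asboolP => o d _; rewrite kcoord0 hdeg0.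
move=> r s t /asboolP sP /asboolP tP; apply/asboolP => o d dl.
rewrite linearD linearZ kcoordD kcoordZ hdegD tP // addr0 hdegM big1 // => i _.
by rewrite sP ?mul0r // (leq_ltn_trans _ dl) // -ltnS.
Qed.

HB.instance Definition _ n := GRing.isSubmodClosed.Build Pi^c (kterm n) (@ktrunc_pred n)
  (GRing.submod_closed_semi (@ktrunc_submod_closed n)).

Definition kquot n : lmodType Pi^c := quotmod (@ktrunc_pred n).
Definition kquot_pi n : {linear kterm n -> kquot n} := @quotmod_pi _ _ _.

Lemma kquot_pi_surj n (y : kquot n) : exists s, kquot_pi n s = y.
Proof. exact: quotmod_pi_surj. Qed.

Lemma kquot_pi0 n s : kquot_pi n s = 0 <-> s \in @ktrunc_pred n.
Proof. by rewrite -(linear0 (kquot_pi n)) /kquot_pi quotmod_piP subr0. Qed.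

Lemma kdiff_trunc n s : s \in @ktrunc_pred n -> kdiff n s \in @ktrunc_pred (n + 1).
Proof.
move=> /asboolP sP; apply/asboolP => o d; rewrite kdiffE kcoord_diff /kcut.
case: o => [[a|]|] /=; last 2 first.
- by rewrite hdeg0.
- move=> dl; rewrite hdeg_sum big1 // => a _.
  case: d dl => [|d] dl; first exact: hdeg_arr0.
  by rewrite hdeg_arrS sP ?mulr0 // /kcut /=; lia.
- case: ifP => _ dl; last exact: hdeg0.
  rewrite hdeg_scal; case: d dl => [|d] dl; first by rewrite hdeg_arr0 mulr0.
  by rewrite hdeg_arrS sP ?mulr0 // /kcut /=; lia.
Qed.

Lemma ex_kquot_diff n : exists d : {linear kquot n -> kquot (n + 1)},
  forall s, d (kquot_pi n s) = kquot_pi (n + 1) (kdiff n s).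
Proof.
apply: (linear_factor (q := kquot_pi n) (f := kquot_pi (n + 1) \o kdiff n)).
  exact: kquot_pi_surj.
by move=> s /kquot_pi0/kdiff_trunc/kquot_pi0.
Qed.

Definition kquot_diff n := sval (boolp.cid (ex_kquot_diff n)).

Lemma kquot_diffE n s : kquot_diff n (kquot_pi n s) = kquot_pi (n + 1) (kdiff n s).
Proof. by rewrite /kquot_diff; case: boolp.cid. Qed.

Lemma kquot_diffK n (y : kquot n) : kquot_diff (n + 1) (kquot_diff n y) = 0.
Proof.
have [s <-] := kquot_pi_surj y.
by rewrite !kquot_diffE kdiffK linear0.
Qed.

Definition kquotient : cochain Pi^c := Cochain kquot_diffK.

Lemma bounded_kquotient : bounded kquotient.
Proof.
exists (c - 1), (c + 1) => n nab y; have [s <-] := kquot_pi_surj y.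
by rewrite (_ : s = 0) ?linear0 //; apply: kterm0; lia.
Qed.

Lemma nilp_kquot n : is_nilp scal J (kquot n).
Proof.
apply: (@nilp_finitely_generated _ _ _ _ _ (fun o => kquot_pi n (kgen K eps v c n o)) l.+2).
  move=> y; have [s <-] := kquot_pi_surj y; exists (fun o => kcoord (\val s) o).
  rewrite [in LHS](kgen_span s) linear_sum.
  by apply: eq_bigr => o _; rewrite linearZ.
move=> y x Jx; have [s <-] := kquot_pi_surj y.
rewrite /ract -linearZ; apply/kquot_pi0/asboolP => o d dl.
rewrite linearZ kcoordZ hdegM big1 // => i _.
rewrite (hdeg_ideal_power Jx) ?mulr0 // (leq_ltn_trans (leq_subr _ _)) //.
by apply: leq_trans dl _; case: o => [[a|]|]; rewrite /= ?leqnSn // -addn2 leq_addr.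
Qed.

Definition bkquotient : bcomplex (Nilp K eps) :=
  @BComplex _ (Nilp K eps) kquotient bounded_kquotient nilp_kquot.

Definition kquot_map : chain_map kcomplex bkquotient.
Proof. by exists kquot_pi => n s; rewrite [RHS]kquot_diffE. Defined.

Lemma kquot_map_surj n (y : kquot n) : exists s, kquot_map n s = y.
Proof. exact: kquot_pi_surj. Qed.

(* The truncation is homogeneous, so a preimage under the differential may be
   replaced by its high degree part. *)
Lemma kquot_map_quasi_iso : quasi_iso kquot_map.
Proof.
apply/(@quasi_iso_surj _ kcomplex bkquotient kquot_map kquot_map_surj) => n s /kquot_pi0/asboolP sP ds.
have [t0 t0E] : exists t, kdiff n t = s.
  have [nc|cn|nc] := ltgtP n c; first exact: kcomplex_exact.
    by exists 0; rewrite linear0; apply/esym/kterm0; lia.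
  by subst n; apply: kaugmentation_exact; apply: sP.
have [o|t tE] := @kelt n (fun o => high (kcut o) (kcoord (\val t0) o)).
  have [t01 t02] := ktermP t0 o; split; last by move=> /t02->; apply: high0.
  rewrite -[in RHS]t01; case: o {t01 t02} => [[a|]|] /=; rewrite ?high_vtx //.
  by case: ifP => _; rewrite ?high_vtx // !mul0r high0.
exists t; first by apply/kquot_pi0/asboolP => o d dl; rewrite tE hdeg_high.
apply: kdiff_ext => [|a sa|].
- rewrite -[LHS](high_id (sP None)) -t0E kdiffE kcoord_diff high_sum.
  by apply: eq_bigr => a _; rewrite tE high_arr.
- rewrite -[LHS](high_id (sP (Some (Some a)))) -t0E kdiffE kcoord_diff sa eqxx tE.
  by rewrite high_arr /sgn high_scal.
- by rewrite -t0E kdiffE kcoord_diff.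
Qed.

End Truncation.

(** Only three degrees are nonzero, so one [l] bounds the nilpotency exponents of their targets.
    Elements in the kernel of the truncation have coordinates in [J^l], which every linear map to
    these targets kills. *)
Lemma approximable_kcomplex : approximable (Nilp K eps) kcomplex.
Proof.
move=> N phi PN.
have ex n : exists l, forall (m : N n) x, ideal_power J l x -> ract x m = 0.
  by have [_ [l lP]] := PN n; exists l.
pose ln n := sval (boolp.cid (ex n)).
have lnP n (m : N n) x : ideal_power J (ln n) x -> ract x m = 0.
  by rewrite /ln; case: boolp.cid => l lP /=; apply: lP.
pose l := maxn (ln (c + 1)) (maxn (ln c) (ln (c - 1))).
exists (@Model _ (Nilp K eps) kcomplex (bkquotient l) (kquot_map l)
  (@kquot_map_quasi_iso l) (@kquot_map_surj l)) => n s /kquot_pi0/asboolP sP.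
have [nl|nl] := leqP (ln n) l.
  rewrite [s]kgen_span linear_sum big1 // => o _; rewrite linearZ.
  apply: lnP; apply: ideal_power_high => d dl; apply: sP.
  rewrite /kcut; case: o => [[a|]|] /=; apply: leq_trans dl _; lia.
(* An exponent above [l] can only occur outside the degrees [c - 1], [c] and [c + 1], where the
   complex is zero. *)
rewrite (_ : s = 0) ?linear0 //; apply: kterm0.
- by apply: contraTneq nl => ->; rewrite -leqNgt leq_maxl.
- by apply: contraTneq nl => /addIr->; rewrite -leqNgt /l maxnA -maxnA leq_max leq_maxl orbT.
- apply: contraTneq nl => e; rewrite -leqNgt (_ : n = c - 1); last by lia.
  by rewrite /l !leq_max leqnn !orbT.
Qed.

End KoszulExact.

(** A socle vector [m] of [M] at [v] spans a simple submodule. The Koszul complex of [v] resolves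
    it, the augmentation being the action of the top coordinate on [m]. *)
Lemma nilp_simple_resolution (K : fieldType) (G : multigraph)
    (eps : qarrow (doubled_quiver G) -> bool)
    (nosocle : forall x : preproj K eps, (forall a, arr K eps a * x = 0) -> x = 0)
    (M : lmodType (preproj K eps)^c) (x : M) (c : int) :
  Nilp K eps M -> x != 0 ->
  exists (S : bcomplex (all_modules (preproj K eps)^c)) (e : {linear S (c + 1) -> M}),
    [/\ (forall n, projective (S n)) /\ approximable (Nilp K eps) S,
        forall n, c + 1 < n -> forall s : S n, s = 0,
        forall n (s : S (n + 1)), n < c -> cdiff S (n + 1) s = 0 -> exists t, cdiff S n t = s,
        forall s, e s = 0 <-> exists t, cdiff S c t = s &
        exists s, e s != 0].
Proof.
move=> [_ Mn] x0; have [v [m [m0 vm mJ]]] := nilp_socle Mn x0.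
pose S : bcomplex (all_modules (preproj K eps)^c) :=
  @BComplex _ (all_modules _) (kcomplex K eps v c) (bounded_kcomplex K eps v c) (fun=> I).
have [|e eE] := @ex_linear _ (S (c + 1)) M (fun s => ract (kcoord (\val (s : kterm K eps v c (c + 1))) None) m).
  by move=> r s t; rewrite linearD linearZ kcoordD kcoordZ /ract scalerDl -scalerA.
have eH s : hdeg 0 (kcoord (\val (s : kterm K eps v c (c + 1))) None) = 0 -> e s = 0.
  rewrite eE => /arrow_decomposition[y ->].
  rewrite /ract scaler_suml big1 // => a _.
  by rewrite -[LHS]/(ract (arr K eps a * y a) m) /ract -scalerA -/(ract (arr K eps a) m) mJ scaler0.
exists S, e; split.
- by split=> [n|]; [apply: projective_kterm | apply: approximable_kcomplex].
- by move=> n cn; apply: kterm0; lia.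
- by move=> n s nc; apply: kcomplex_exact.
- move=> s; split=> [es|[t <-]]; last by apply: eH; apply: kdiff_augmentation.
  apply: kaugmentation_exact.
  have [d [y sE]] := preproj_decomposition (kcoord (\val (s : kterm K eps v c (c + 1))) None).
  have [/= sv _] := ktermP s None; have s1 : kcoord (\val s) None =
      preproj_scal eps (d v) * vtx K eps v + \sum_a arr K eps a * (if qsource a == v then y a else 0).
    rewrite -sv sE mulrDr !mulr_sumr (bigD1 v) //= big1 ?addr0 => [|w wv]; last first.
      by rewrite mulrA -preproj_scalC -mulrA vtxM eq_sym (negPf wv) mulr0.
    rewrite mulrA -preproj_scalC -mulrA vtxM eqxx; congr (_ + _); apply: eq_bigr => a _.
    by rewrite mulrA vtx_arr; case: ifP => _; rewrite ?mul0r ?mulr0.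
  have rM a z : ract (arr K eps a * z) m = 0.
    by rewrite /ract -[_ *: m]/((z : (preproj K eps)^c) * arr K eps a *: m) -scalerA -/(ract (arr K eps a) m) mJ scaler0.
  (* Arrows kill [m] and the idempotent of [v] fixes it, so [e s] is [d v] times the nonzero vector
     [m]. *)
  have d0 : d v = 0.
    move: es; rewrite eE s1 /ract scalerDl scaler_suml [X in _ + X]big1 ?addr0 => [|a _]; last first.
      by case: ifP => _; [exact: rM | rewrite mulr0 scale0r].
    rewrite preproj_scalC -[_ *: m]/((preproj_scal eps (d v) : (preproj K eps)^c) * vtx K eps v *: m).
    rewrite -scalerA -/(ract (vtx K eps v) m) vm => dm.
    apply/eqP; apply: contra_neqT m0 => dv.
    rewrite -(kscale1 (@preproj_scal K G eps) m) -(mulVf dv) -kscaleA.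
    by rewrite [kscale _ (d v) m]dm kscale0r.
  rewrite s1 d0 rmorph0 mul0r add0r hdeg_sum big1 // => a _.
  by case: ifP => _; rewrite ?mulr0 ?hdeg0 // hdeg_arr0.
- exists (kgen K eps v c (c + 1) None); rewrite eE /kcoord ffunE /= addr0 eqxx.
  by rewrite -[ract _ _]/(ract (vtx K eps v) m) vm.
Qed.

Local Open Scope complex_scope.

Theorem theorem1p4 (R : realType) (G : multigraph)
    (eps : qarrow (doubled_quiver G) -> bool) :
  (forall a, eps (dual_arrow a) != eps a) ->
  loopless G -> connected G -> ~ finite_type G R ->
  triangulated_equivalence (Db_inclusion (Nilp R[i] eps)).
Proof.
move=> _ _ Gc nft; apply: Db_inclusion_equivalence => X PX.
have ns (x : preproj R[i] eps) := @no_socle R R[i] G eps x Gc nft.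
apply: (@resolvable_coh _ (Nilp R[i] eps) (kdim (@preproj_scal R[i] G eps)) _ _ _ X PX).
- by move=> M N f [Mf _]; apply: kdim_le.
- by move=> M N f x [Mf _]; apply: kdim_lt.
- by move=> M x c; apply: nilp_simple_resolution.
Qed.
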